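(* Let $N$ be a connected closed Riemannian manifold of positive Ricci curvature and let $f:N\to\mathbb{R}$ be a properly isoparametric function. Then there exists a unique minimal isoparametric hypersurface in the family of isoparametric hypersurfaces of $f$; that is, there is exactly one regular value $t$ of $f$ such that the level hypersurface $M_t=f^{-1}(t)$ is a minimal hypersurface of $N$.
   Context: Let $N$ be a smooth connected Riemannian manifold. A non-constant smooth function $f:N\to\mathbb{R}$ is called transnormal if there is a smooth function $b:J\to\mathbb{R}$, where $J=f(N)\subset\mathbb{R}$, such that $|\nabla f|^2=b(f)$. It is called isoparametric if moreover there is a continuous function $a:J\to\mathbb{R}$ such that $\triangle f=a(f)$, where $\triangle$ is the Laplacian. The regular level hypersurfaces $M_t:=f^{-1}(t)$ ($t$ a regular value in $J$) of an isoparametric function are called isoparametric hypersurfaces. The preimages $M_{+}$ and $M_{-}$ of the maximum and the minimum of $f$ are called the focal varieties of $f$; by a theorem of Q.M. Wang they are smooth submanifolds when $N$ is complete, $f$ has no critical values in the interior of $J$, and each regular level hypersurface is a tubular hypersurface (at constant distance) over either of $M_{\pm}$. An isoparametric function is called proper (properly isoparametric) if each component of $M_{\pm}$ has codimension not less than $2$. Closed means compact without boundary. *)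

(* Defs.v *)
From HB Require Import structures.
From mathcomp Require Import all_boot all_order all_algebra.
From mathcomp Require Import all_classical all_reals all_analysis.
Import Order.TTheory GRing.Theory Num.Theory.
Import numFieldNormedType.Exports.

Set Implicit Arguments.
Unset Strict Implicit.
Unset Printing Implicit Defensive.

Local Open Scope classical_set_scope.
Local Open Scope ring_scope.

Fixpoint Ck_on (R : realType) (V W : normedModType R) (k : nat) (U : set V)
    (f : V -> W) : Prop :=
  match k with
  | 0%N => forall x, U x -> {for x, continuous f}
  | k'.+1 => (forall x, U x -> differentiable f x) /\
             (forall v, Ck_on k' U ('D_v f))
  end.

(* meaningful for U open *)
Definition smooth_on (R : realType) (V W : normedModType R) (U : set V)
    (f : V -> W) : Prop :=
  forall k, Ck_on k U f.

(* smoothness on an arbitrary subset of the line: local smooth extensions *)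
Definition smooth_within (R : realType) (A : set R) (b : R -> R) : Prop :=
  forall s, A s -> exists (U : set R) (g : R -> R),
    [/\ open U, U s, smooth_on U g & forall r, U r -> A r -> b r = g r].

(* [chart_map] and [chart_inv] are total functions, irrelevant outside
   [chart_dom] and its image respectively. *)
Record chart (R : realType) (n : nat) (T : topologicalType) := Chart {
  chart_dom : set T;
  chart_map : T -> 'rV[R]_n;
  chart_inv : 'rV[R]_n -> T;
  chart_dom_open : open chart_dom;
  chart_img_open : open (chart_map @` chart_dom);
  chart_mapK : forall p, chart_dom p -> chart_inv (chart_map p) = p;
  chart_map_continuous :
    forall p, chart_dom p -> {for p, continuous chart_map};
  chart_inv_continuous :
    forall x, (chart_map @` chart_dom) x -> {for x, continuous chart_inv}
}.

Definition chart_img (R : realType) (n : nat) (T : topologicalType)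
    (c : chart R n T) : set 'rV[R]_n :=
  chart_map c @` chart_dom c.

Definition transition (R : realType) (n : nat) (T : topologicalType)
    (c d : chart R n T) : 'rV[R]_n -> 'rV[R]_n :=
  chart_map d \o chart_inv c.

Definition overlap (R : realType) (n : nat) (T : topologicalType)
    (c d : chart R n T) : set 'rV[R]_n :=
  chart_map c @` (chart_dom c `&` chart_dom d).

Record smooth_manifold (R : realType) (n : nat) (T : topologicalType) :=
  SmoothManifold {
    atlas : set (chart R n T);
    manifold_hausdorff : hausdorff_space T;
    manifold_second_countable : @second_countable T;
    atlas_cover : forall p, exists2 c, atlas c & chart_dom c p;
    atlas_compatible : forall c d, atlas c -> atlas d ->
      smooth_on (overlap c d) (transition c d)
  }.

(* A Riemannian metric is given by its matrices in the charts of the atlas.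
   Tangent vectors are rows of components, so that the differential of a
   change of coordinates tau is v |-> v *m 'J tau x. *)
Record riemannian_manifold (R : realType) (n : nat) (T : topologicalType) :=
  RiemannianManifold {
    base_manifold :> smooth_manifold R n T;
    metric : chart R n T -> 'rV[R]_n -> 'M[R]_n;
    metric_smooth : forall c, atlas base_manifold c ->
      smooth_on (chart_img c) (metric c);
    metric_sym : forall c x, atlas base_manifold c -> chart_img c x ->
      (metric c x)^T = metric c x;
    metric_posdef : forall c x (v : 'rV[R]_n), atlas base_manifold c ->
      chart_img c x -> v != 0 -> 0 < (v *m metric c x *m v^T) 0 0;
    metric_compatible : forall c d x, atlas base_manifold c ->
      atlas base_manifold d -> overlap c d x ->
      metric c x = 'J (transition c d) x *m
                   metric d (transition c d x) *m
                   ('J (transition c d) x)^T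
  }.

Section Coordinates.
Context {R : realType} {n : nat}.
(* G is the field of matrices of the metric in a chart *)
Implicit Types (G : 'rV[R]_n -> 'M[R]_n) (x v w : 'rV[R]_n).

Definition partial {W : normedModType R} (i : 'I_n) (h : 'rV[R]_n -> W) x : W :=
  'D_(delta_mx 0 i) h x.

Definition inner G x v w : R := (v *m G x *m w^T) 0 0.

(* christoffel G i j k x is Gamma_{ij}^k *)
Definition christoffel G (i j k : 'I_n) x : R :=
  2^-1 * \sum_l invmx (G x) k l *
    (partial i (fun y => G y j l) x + partial j (fun y => G y i l) x
     - partial l (fun y => G y i j) x).

(* the component R^l_{ijk} of R(d_i, d_j) d_k on d_l, where
   R(X,Y)Z = nabla_X nabla_Y Z - nabla_Y nabla_X Z - nabla_[X,Y] Z *)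
Definition riemann G (i j k l : 'I_n) x : R :=
  partial i (christoffel G j k l) x - partial j (christoffel G i k l) x
  + \sum_m (christoffel G j k m x * christoffel G i m l x
            - christoffel G i k m x * christoffel G j m l x).

(* Ric(Y,Z) is the trace of X |-> R(X,Y)Z *)
Definition ricci G x : 'M[R]_n := \matrix_(j, k) \sum_i riemann G i j k i x.

Definition grad G (h : 'rV[R]_n -> R) x : 'rV[R]_n :=
  (\row_i partial i h x) *m invmx (G x).

(* Levi-Civita derivative of the vector field X in the direction v *)
Definition covd G v (X : 'rV[R]_n -> 'rV[R]_n) x : 'rV[R]_n :=
  'D_v X x + \row_k \sum_i \sum_j v 0 i * X x 0 j * christoffel G i j k x.

Definition divergence G (X : 'rV[R]_n -> 'rV[R]_n) x : R :=
  \sum_i covd G (delta_mx 0 i) X x 0 i.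

Definition laplacian G (h : 'rV[R]_n -> R) x : R := divergence G (grad G h) x.

End Coordinates.

Section Geometry.
Context {R : realType} {n : nat} {T : topologicalType}.
Implicit Types (N : riemannian_manifold R n T) (f : T -> R) (S : set T).

Definition positive_ricci N : Prop :=
  forall c x (v : 'rV[R]_n), atlas N c -> chart_img c x -> v != 0 ->
    0 < (v *m ricci (metric N c) x *m v^T) 0 0.

Definition smooth_function N f : Prop :=
  forall c, atlas N c -> smooth_on (chart_img c) (f \o chart_inv c).

Definition transnormal N f : Prop :=
  [/\ exists p q, f p != f q,
      smooth_function N f &
      exists2 b : R -> R, smooth_within (range f) b &
        forall c x, atlas N c -> chart_img c x ->
          let fc := f \o chart_inv c in
          let nabla := grad (metric N c) fc x in
          inner (metric N c) x nabla nabla = b (fc x)].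

Definition isoparametric N f : Prop :=
  transnormal N f /\
  exists2 a : R -> R, {within range f, continuous a} &
    forall c x, atlas N c -> chart_img c x ->
      let fc := f \o chart_inv c in
      laplacian (metric N c) fc x = a (fc x).

(* Near p, S is the zero set F = 0 of a submersion F to R^k defined on the
   open set U of the image of the chart c *)
Definition local_equation N S (p : T) (k : nat) (c : chart R n T)
    (U : set 'rV[R]_n) (F : 'rV[R]_n -> 'rV[R]_k) : Prop :=
  [/\ atlas N c, chart_dom c p,
      [/\ open U, U `<=` chart_img c & U (chart_map c p)],
      smooth_on U F &
      forall x, U x -> \rank ('J F x) = k /\ (S (chart_inv c x) <-> F x = 0)].

Definition submanifold_at N S (p : T) (k : nat) : Prop :=
  exists c U (F : 'rV[R]_n -> 'rV[R]_k), local_equation N S p c U F.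

Definition focal_max f : set T := [set p | forall q, f q <= f p].
Definition focal_min f : set T := [set p | forall q, f p <= f q].

(* S is a submanifold each of whose components has codimension at least 2;
   different components may have different dimensions. *)
Definition components_codim_ge2 N S : Prop :=
  forall p, S p -> exists2 k, (2 <= k)%N &
    forall q, connected_component S p q -> submanifold_at N S q k.

Definition properly_isoparametric N f : Prop :=
  [/\ isoparametric N f,
      components_codim_ge2 N (focal_max f) &
      components_codim_ge2 N (focal_min f)].

Definition regular_value N f (t : R) : Prop :=
  forall p c, f p = t -> atlas N c -> chart_dom c p ->
    grad (metric N c) (f \o chart_inv c) (chart_map c p) != 0.

(* H is the mean curvature at p of the hypersurface S: the trace of the
   second fundamental form h(v,w) = - <nabla_v nu, w>, where nu is a vector
   field defined near p in the manifold and restricting to a unit normal field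
   on S, and e is an orthonormal basis of T_p S. The kernel of the differential
   of F is the tangent space of S. H is determined up to the choice of the side
   of the normal, that is, up to sign. *)
Definition mean_curvature_at N S (p : T) (H : R) : Prop :=
  exists c U (F : 'rV[R]_n -> 'rV[R]_1) (nu : 'rV[R]_n -> 'rV[R]_n)
         (e : 'I_n.-1 -> 'rV[R]_n),
    let G := metric N c in
    let x0 := chart_map c p in
    [/\ local_equation N S p c U F,
        smooth_on U nu,
        forall x, U x -> F x = 0 ->
          inner G x (nu x) (nu x) = 1 /\
          forall v, v *m 'J F x = 0 -> inner G x (nu x) v = 0,
        forall i, e i *m 'J F x0 = 0 /\
          forall j, inner G x0 (e i) (e j) = (i == j)%:R &
        H = \sum_i - inner G x0 (covd G (e i) nu x0) (e i)].

Definition minimal_hypersurface N S : Prop :=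
  forall p, S p -> mean_curvature_at N S p 0.

End Geometry.

(* Main.v *)
(** Write X for the gradient of f, M for its covariant derivative, mu = b'/2 and
phi = a - mu. Differentiating |X|^2 = b(f) gives M X = mu(f) X, so the trace of
the second fundamental form of a regular level f = t is -phi(t) / sqrt(b(t)) up
to sign, and the level is minimal if and only if phi(t) = 0.

Uniqueness: Bochner's formula reads X(tr M) = div(M X) - tr(M^2) - Ric(X, X).
Since tr(M^2) >= mu^2, positive Ricci curvature makes X(phi o f) negative where
phi vanishes. Hence phi crosses zero only downwards, thus at most once.

Existence: b vanishes only at the two ends of the range of f, and b' does not
vanish there: if b(t) = b'(t) = 0, then |X| <= C |f - t| locally, so {f = t} is
open and closed. At a focal point M^2 = mu M, so that tr M = mu rank(M) and
phi = (rank(M) - 1) mu. The rank is at least the codimension of the focal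
variety: |f - t| is bounded below by a multiple of the squared distance to
{f = t}, while it is o(s^2) in the directions of the kernel of M, which are
therefore tangent to {f = t}. Codimension at least 2 makes phi positive near the
minimum and negative near the maximum of f. *)

Require Import Defs.
From mathcomp Require Import all_boot all_order all_algebra.
From mathcomp Require Import all_classical all_reals all_analysis.
From mathcomp Require Import ring lra zify.
Import Order.TTheory GRing.Theory Num.Theory.
Import numFieldNormedType.Exports.
Set Implicit Arguments.
Unset Strict Implicit.
Unset Printing Implicit Defensive.
Local Open Scope classical_set_scope.
Local Open Scope ring_scope.

(** * Smooth maps *)

(** Minimality is stated for any submersion F cutting out the level and any field nu that is unit
    and normal on it, so uniqueness has to start from such arbitrary data. Tangency is handled
    through the tangent cone [tangent_to]: a map vanishing on a set has zero derivative along its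
    cone, and this replaces parametrisations of levels and focal varieties.

    The lower bound of |f - t| by the squared distance has this origin: near a simple zero t of b,
    |X|^2 = b(f) is comparable to |f - t|, so sqrt |f - t| has slope bounded below, and descending
    it reaches {f = t} within a distance proportional to sqrt |f - t|.

    M^2 = mu M comes from differentiating M X = mu X where X = 0, since there the derivative of X is
    M.

    Two points of regularity shape the statements. The function a is only continuous, so the
    downward crossing is expressed by signs and the derivatives are taken on N rather than on the
    line. The function b is constrained only on the range of f, so at its ends b' means the
    derivative of a local smooth extension. *)

Section Calculus.
Context {R : realType}.

Lemma near_eq_differentiable (V W : normedModType R) (f g : V -> W) x :
  (\near x, f x = g x) -> differentiable f x -> differentiable g x.
Proof.
move=> fg df.
have gE : g \o shift x = cst (g x) + 'd f x +o_0 id.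
  apply/eqaddoP => e e0.
  have /eqaddoP/(_ _ e0) := diff_locally df.
  have : \forall y \near (0 : V), f (y + x) = g (y + x).
    by move: fg; rewrite (near_shift 0 x) /=; apply: filterS => y /=; rewrite ?subr0.
  apply: filterS2 => y /=; rewrite !fctE => fgy.
  by rewrite /= fgy (nbhs_singleton fg).
have dfc : continuous ('d f x) by exact: diff_continuous.
by apply/diff_locallyP; rewrite (diff_unique dfc gE); split.
Qed.

Section Ck.
Context {V : normedModType R} (U : set V).
Hypothesis oU : open U.

Lemma Ck_on_ext (W : normedModType R) k (f g : V -> W) :
  (forall x, U x -> f x = g x) -> Ck_on k U f -> Ck_on k U g.
Proof.
elim: k f g => [|k IH] f g fg /=.
  move=> fc x Ux; suff : g @ x --> g x by [].
  rewrite -(fg _ Ux).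
  apply: cvg_trans (fc x Ux); apply: near_eq_cvg.
  by apply: filterS (open_nbhs_nbhs (conj oU Ux)) => y Uy; rewrite fg.
move=> [fd fk]; split.
  move=> x Ux; apply: near_eq_differentiable (fd x Ux).
  by apply: filterS (open_nbhs_nbhs (conj oU Ux)) => y Uy; rewrite fg.
move=> v; apply: IH (fk v) => x Ux.
apply: near_eq_derive.
by apply: filterS (open_nbhs_nbhs (conj oU Ux)) => y Uy; rewrite fg.
Qed.

Lemma Ck_on_le (W : normedModType R) k (f : V -> W) :
  Ck_on k.+1 U f -> Ck_on k U f.
Proof.
elim: k f => [|k IH] f /=.
  by move=> [fd _] x Ux; apply: differentiable_continuous; exact: fd.
by move=> [fd fk]; split => // v; apply: IH.
Qed.

Lemma Ck_on_sub (W : normedModType R) k (U' : set V) (f : V -> W) :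
  U' `<=` U -> Ck_on k U f -> Ck_on k U' f.
Proof.
move=> sU; elim: k f => [|k IH] f /=; first by move=> h x /sU; exact: h.
by move=> [fd fk]; split => [x /sU|v]; [exact: fd|exact: IH].
Qed.

Lemma Ck_on_cst (W : normedModType R) k (w : W) : Ck_on k U (fun=> w).
Proof.
elim: k w => [|k IH] w /=; first by move=> x _; exact: cst_continuous.
split=> [x _|v]; first exact: differentiable_cst.
suff -> : 'D_v (fun _ : V => w) = (fun=> 0) by [].
by apply/funext => x; rewrite derive_cst.
Qed.

Lemma Ck_onD (W : normedModType R) k (f g : V -> W) :
  Ck_on k U f -> Ck_on k U g -> Ck_on k U (fun x => f x + g x).
Proof.
elim: k f g => [|k IH] f g /=.
  by move=> fc gc x Ux; apply: continuousD; [exact: fc|exact: gc].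
move=> [fd fk] [gd gk]; split.
  by move=> x Ux; apply: differentiableD; [exact: fd|exact: gd].
move=> v; apply: Ck_on_ext (IH _ _ (fk v) (gk v)) => x Ux.
by rewrite -deriveD //; apply: diff_derivable; [exact: fd|exact: gd].
Qed.

Lemma Ck_on_sum (W : normedModType R) k (m : nat) (f : 'I_m -> V -> W) :
  (forall i, Ck_on k U (f i)) -> Ck_on k U (fun x => \sum_i f i x).
Proof.
elim: m f => [|m IH] f fk.
  by apply: Ck_on_ext (Ck_on_cst _ 0) => x _; rewrite big_ord0.
apply: Ck_on_ext (Ck_onD (fk ord0) (IH _ (fun i => fk (lift ord0 i)))) => x _.
by rewrite big_ord_recl.
Qed.

Lemma Ck_onM k (f g : V -> R) :
  Ck_on k U f -> Ck_on k U g -> Ck_on k U (fun x => f x * g x).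
Proof.
elim: k f g => [|k IH] f g.
  by move=> fc gc x Ux; apply: continuousM; [exact: fc|exact: gc].
move=> fk1 gk1; have [fd fk] := fk1; have [gd gk] := gk1; split.
  by move=> x Ux; apply: differentiableM; [exact: fd|exact: gd].
move=> v; apply: Ck_on_ext
  (Ck_onD (IH _ _ (Ck_on_le fk1) (gk v)) (IH _ _ (Ck_on_le gk1) (fk v))) => x Ux.
by rewrite [RHS]deriveM //; apply: diff_derivable; [exact: fd|exact: gd].
Qed.

Lemma Ck_onN k (f : V -> R) : Ck_on k U f -> Ck_on k U (fun x => - f x).
Proof.
by move=> fk; apply: Ck_on_ext (Ck_onM (Ck_on_cst k (-1 : R)) fk) => x _; rewrite mulN1r.
Qed.

Lemma Ck_onB k (f g : V -> R) :
  Ck_on k U f -> Ck_on k U g -> Ck_on k U (fun x => f x - g x).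
Proof. by move=> fk gk; apply: Ck_onD => //; exact: Ck_onN. Qed.

Lemma Ck_onV k (f : V -> R) : (forall x, U x -> f x != 0) ->
  Ck_on k U f -> Ck_on k U (fun x => (f x)^-1).
Proof.
move=> f0; elim: k => [|k IH].
  by move=> fc x Ux; apply: cvgV; [exact: f0|exact: fc].
move=> fk1; have [fd fk] := fk1; split.
  by move=> x Ux; apply: differentiableV; [exact: fd|exact: f0].
have Vk := IH (Ck_on_le fk1).
move=> v; apply: Ck_on_ext (Ck_onM (Ck_onM Vk Vk) (Ck_onN (fk v))) => x Ux.
rewrite [RHS]deriveV ?f0 //; last by apply: diff_derivable; exact: fd.
by rewrite -expr2 exprVn mulrN scaleNr.
Qed.

Lemma Ck_on_mxE k m n (M : V -> 'M[R]_(m, n)) i j :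
  Ck_on k U M -> Ck_on k U (fun x => M x i j).
Proof.
elim: k M => [|k IH] M.
  move=> Mc x Ux; apply: (@continuous_comp _ _ _ M (fun N : 'M[R]_(m, n) => N i j)).
    exact: Mc.
  exact: coord_continuous.
move=> [Md Mk]; split => [x Ux|v].
  apply: (@differentiable_comp _ _ _ _ M (fun N : 'M[R]_(m, n) => N i j)).
    exact: Md.
  exact: differentiable_coord.
apply: Ck_on_ext (IH _ (Mk v)) => x Ux.
by rewrite derive_mx ?mxE //; apply: diff_derivable; exact: Md.
Qed.

Lemma Ck_onZl (W : normedModType R) k (f : V -> R) (w : W) :
  Ck_on k U f -> Ck_on k U (fun x => f x *: w).
Proof.
elim: k f => [|k IH] f.
  by move=> fc x Ux; apply: cvgZr_tmp; exact: fc.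
move=> [fd fk]; split => [x Ux|v]; first by apply: differentiableZl; exact: fd.
apply: Ck_on_ext (IH _ (fk v)) => x Ux.
have dfx := fd _ Ux.
by rewrite !deriveE ?diffZl //; exact: differentiableZl.
Qed.

Lemma Ck_on_mx k m n (M : V -> 'M[R]_(m, n)) :
  (forall i j, Ck_on k U (fun x => M x i j)) -> Ck_on k U M.
Proof.
move=> Mk; apply: Ck_on_ext (_ : Ck_on k U
   (fun x => \sum_i \sum_j M x i j *: delta_mx i j)).
  by move=> x _; rewrite -matrix_sum_delta.
by apply: Ck_on_sum => i; apply: Ck_on_sum => j; apply: Ck_onZl.
Qed.

Lemma Ck_on_mulmx k m n p (A : V -> 'M[R]_(m, n)) (B : V -> 'M[R]_(n, p)) :
  Ck_on k U A -> Ck_on k U B -> Ck_on k U (fun x => A x *m B x).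
Proof.
move=> Ak Bk; apply: Ck_on_mx => i j.
apply: Ck_on_ext (_ : Ck_on k U (fun x => \sum_l A x i l * B x l j)).
  by move=> x _; rewrite mxE.
by apply: Ck_on_sum => l; apply: Ck_onM; exact: Ck_on_mxE.
Qed.

Lemma Ck_on_det k n (A : V -> 'M[R]_n) :
  Ck_on k U A -> Ck_on k U (fun x => \det (A x)).
Proof.
elim: n A => [|n IH] A Ak.
  by apply: Ck_on_ext (Ck_on_cst k (1 : R)) => x _; rewrite det_mx00.
apply: Ck_on_ext (_ : Ck_on k U (fun x => \sum_j A x ord0 j *
   ((-1) ^+ (0 + j) * \det (row' ord0 (col' j (A x)))))).
  by move=> x _; rewrite (expand_det_row (A x) ord0).
apply: Ck_on_sum => j; apply: Ck_onM; first exact: Ck_on_mxE.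
apply: Ck_onM; first exact: Ck_on_cst.
apply: IH; apply: Ck_on_mx => i l.
apply: Ck_on_ext (Ck_on_mxE (lift ord0 i) (lift j l) Ak) => x _.
by rewrite !mxE.
Qed.

(** Cramer's rule: the entries are cofactors over a nonvanishing determinant. *)
Lemma Ck_on_invmx k n (A : V -> 'M[R]_n) : (forall x, U x -> A x \in unitmx) ->
  Ck_on k U A -> Ck_on k U (fun x => invmx (A x)).
Proof.
move=> Au Ak; apply: Ck_on_mx => i j.
apply: Ck_on_ext (_ : Ck_on k U (fun x => (\det (A x))^-1 *
   ((-1) ^+ (j + i) * \det (row' j (col' i (A x)))))).
  by move=> x Ux; rewrite /invmx (Au _ Ux) !mxE.
apply: Ck_onM.
  apply: Ck_onV; last exact: Ck_on_det.
  by move=> x Ux; rewrite -unitfE -unitmxE Au.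
apply: Ck_onM; first exact: Ck_on_cst.
apply: Ck_on_det; apply: Ck_on_mx => r s.
apply: Ck_on_ext (Ck_on_mxE (lift j r) (lift i s) Ak) => x _.
by rewrite !mxE.
Qed.

End Ck.
End Calculus.

Section Lines.
Context {R : realType} {V : normedModType R}.

Lemma is_derive_line (W : normedModType R) (f : V -> W) x v (r : R) :
  differentiable f (x + r *: v) ->
  is_derive r 1 (fun s : R => f (x + s *: v)) ('D_v f (x + r *: v)).
Proof.
move=> /(diff_derivable (v := v)); rewrite /derivable => df.
have E : (fun h : R => h^-1 *: (((fun s : R => f (x + s *: v)) \o shift r) (h *: 1)
            - f (x + r *: v))) =
         (fun h : R => h^-1 *: ((f \o shift (x + r *: v)) (h *: v) - f (x + r *: v))).
  apply/funext => h /=; congr (_ *: (f _ - _)).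
  by rewrite [h *: 1]mulr1 scalerDl addrCA.
by apply: DeriveDef; rewrite /derivable /derive E.
Qed.

Lemma MVT_line (f : V -> R) x v (s : R) : 0 < s ->
  (forall r, 0 <= r <= s -> differentiable f (x + r *: v)) ->
  exists2 r, 0 <= r <= s & f (x + s *: v) - f x = s * 'D_v f (x + r *: v).
Proof.
move=> s0 df.
have d1 r : r \in `]0, s[%R -> is_derive r 1 (fun r => f (x + r *: v))
    ('D_v f (x + r *: v)).
  rewrite in_itv /= => /andP[r0 rs]; apply: is_derive_line; apply: df.
  by rewrite !ltW.
have d2 : {within `[0, s], continuous (fun r => f (x + r *: v))}.
  apply: derivable_within_continuous => r; rewrite in_itv /= => rs.
  by apply: ex_derive; apply: is_derive_line; apply: df.
have [r rs E] := MVT s0 d1 d2.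
exists r; first by move: rs; rewrite in_itv /= => /andP[/ltW -> /ltW ->].
by move: E; rewrite /= scale0r addr0 subr0 mulrC.
Qed.

(** Two mean value steps, in direction v for the increment of f along s w, then in direction w for
    ['D_v f], turn the second difference into s^2 times ['D_w ('D_v f)] at a nearby point;
    continuity of that derivative bounds the error. *)
Lemma second_difference (U : set V) (f : V -> R) x v w (e : R) : open U -> U x ->
  Ck_on 2 U f -> 0 < e -> exists2 d, 0 < d & forall s, 0 < s < d ->
  `|f (x + s *: w + s *: v) - f (x + s *: v) - f (x + s *: w) + f x
     - s ^+ 2 * 'D_w ('D_v f) x| <= e * s ^+ 2.
Proof.
move=> oU Ux [fd /(_ v) [fvd /(_ w) fvw]] e0.
have : \forall y \near x, U y /\ `|'D_w ('D_v f) x - 'D_w ('D_v f) y| < e.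
  near=> y; split; near: y; first exact: open_nbhs_nbhs.
  by move/cvgrPdist_lt: (fvw x Ux); apply.
move=> /nbhs_ballP[rho /= rho0 near_x].
have vw0 : 0 < `|v| + `|w| + 1 by rewrite ltr_wpDl // addr_ge0.
(* Below this bound on s, the parallelogram spanned by s v and s w at x stays in the ball of radius
   rho. *)
exists (rho / (`|v| + `|w| + 1)); first exact: divr_gt0.
move=> s /andP[s0 sd].
have P a b : 0 <= a <= s -> 0 <= b <= s ->
    U (x + b *: w + a *: v) /\
    `|'D_w ('D_v f) x - 'D_w ('D_v f) (x + b *: w + a *: v)| < e.
  move=> /andP[a0 as_] /andP[b0 bs].
  apply: near_x; rewrite -ball_normE /= -addrA opprD addrA subrr sub0r normrN.
  rewrite (le_lt_trans (ler_normD _ _)) // !normrZ !ger0_norm //.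
  apply: (@le_lt_trans _ _ (s * (`|v| + `|w| + 1))).
    by rewrite mulrDr mulr1 mulrDr addrC -[leLHS]addr0 !lerD // ?ler_wpM2r // ltW.
  by rewrite -ltr_pdivlMr.
have s0s : 0 <= s <= s by rewrite lexx ltW.
have z0s : 0 <= (0 : R) <= s by rewrite lexx ltW.
have [r rs Er] : exists2 r, 0 <= r <= s &
    f (x + s *: w + s *: v) - f (x + s *: v) - f (x + s *: w) + f x =
    s * ('D_v f (x + s *: w + r *: v) - 'D_v f (x + r *: v)).
  pose g r := f (x + s *: w + r *: v) - f (x + r *: v).
  pose dg r := 'D_v f (x + s *: w + r *: v) - 'D_v f (x + r *: v).
  have gd r : 0 <= r <= s -> is_derive r 1 g (dg r).
    move=> rs; apply: is_deriveB; apply: is_derive_line; apply: fd.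
      exact: (P r s rs s0s).1.
    by have := (P r 0 rs z0s).1; rewrite scale0r addr0.
  have d1 r : r \in `]0, s[%R -> is_derive r 1 g (dg r).
    by rewrite in_itv /= => /andP[r0 rs]; apply: gd; rewrite !ltW.
  have d2 : {within `[0, s], continuous g}.
    apply: derivable_within_continuous => r; rewrite in_itv /= => rs.
    exact: (@ex_derive _ _ _ _ _ _ _ (gd r rs)).
  have [r rs E] := MVT s0 d1 d2.
  exists r; first by move: rs; rewrite in_itv /= => /andP[/ltW -> /ltW ->].
  move: E; rewrite /g /dg !scale0r !addr0 subr0 mulrC => <-.
  by rewrite opprB addrA addrAC.
rewrite Er.
have [] := @MVT_line ('D_v f) (x + r *: v) w s s0.
  move=> t ts; rewrite addrAC; apply: fvd; exact: (P r t rs ts).1.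
move=> t ts; rewrite addrAC => ->; rewrite [_ + r *: v + t *: w]addrAC.
rewrite mulrA -expr2 -mulrBr normrM (ger0_norm (sqr_ge0 s)) mulrC ler_wpM2r ?sqr_ge0 //.
by rewrite distrC ltW // (P r t rs ts).2.
Unshelve. all: by end_near. Qed.

Lemma dist_le_of_approx (a b c d p q h e : R) : 0 < h ->
  `|a - c - b + d - h * p| <= e / 2 * h -> `|a - b - c + d - h * q| <= e / 2 * h ->
  `|q - p| <= e.
Proof.
move=> h0 H1 H2; rewrite -(ler_pM2l h0) -{1}(ger0_norm (ltW h0)) -normrM mulrBr.
rewrite (_ : h * e = e / 2 * h + e / 2 * h); last by rewrite -mulrDl -splitr mulrC.
move: H1 H2; move: (h * p) (h * q) (e / 2 * h) => P Q k.
by rewrite !ler_norml => /andP[a1 a2] /andP[b1 b2]; apply/andP; split; lra.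
Qed.

(** Schwarz's theorem: the second difference is symmetric in v and w, and both mixed derivatives are
    its limit after division by s^2. *)
Lemma derive_commute (U : set V) (f : V -> R) x v w : open U -> U x ->
  Ck_on 2 U f -> 'D_w ('D_v f) x = 'D_v ('D_w f) x.
Proof.
move=> oU Ux f2; apply/eqP; rewrite -subr_eq0 -normr_le0; apply/ler_addgt0Pl => e e0.
rewrite addr0.
have e20 : 0 < e / 2 by rewrite divr_gt0.
have [d d0 /= D] := second_difference v w oU Ux f2 e20.
have [d' d'0 /= D'] := second_difference w v oU Ux f2 e20.
pose s := Num.min d d' / 2.
have m0 : 0 < Num.min d d' by rewrite lt_min d0 d'0.
have s0 : 0 < s by rewrite divr_gt0.
have : s < Num.min d d' by rewrite /s ltr_pdivrMr // ltr_pMr // ltr1n.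
rewrite lt_min => /andP[sd sd'].
have := D s; rewrite s0 sd => /(_ isT).
have := D' s; rewrite s0 sd' => /(_ isT).
rewrite [x + s *: v + s *: w]addrAC.
have s20 : 0 < s ^+ 2 by rewrite exprn_gt0.
exact: dist_le_of_approx.
Qed.

End Lines.

(** * Inner products on row vectors *)

Local Notation ip G v w := ((v *m G *m w^T) 0 0).

Section LinearAlgebra.
Context {R : realType}.

Definition posdef n (G : 'M[R]_n) :=
  forall v : 'rV[R]_n, v != 0 -> 0 < ip G v v.

Lemma posdef_unitmx n (G : 'M[R]_n) : posdef G -> G \in unitmx.
Proof.
move=> Gpos; rewrite -row_free_unit -kermx_eq0; apply/rowV0P => v /sub_kermxP vG.
by apply: contrapT => /eqP /Gpos; rewrite vG mul0mx mxE ltxx.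
Qed.

Lemma posdef_ge0 n (G : 'M[R]_n) (v : 'rV[R]_n) : posdef G -> 0 <= ip G v v.
Proof.
move=> Gpos; have [->|v0] := eqVneq v 0; first by rewrite mul0mx mul0mx mxE.
exact/ltW/Gpos.
Qed.

Lemma posdef_eq0 n (G : 'M[R]_n) (v : 'rV[R]_n) : posdef G -> ip G v v = 0 -> v = 0.
Proof. by move=> Gpos vv; apply: contrapT => /eqP /Gpos; rewrite vv ltxx. Qed.

Lemma ip_sym n (G : 'M[R]_n) (v w : 'rV[R]_n) : G^T = G -> ip G v w = ip G w v.
Proof.
move=> GT; have -> : w *m G *m v^T = (v *m G *m w^T)^T.
  by rewrite !trmx_mul trmxK GT mulmxA.
by rewrite [RHS]mxE.
Qed.

Lemma ip_linearl n (G : 'M[R]_n) (a : R) (u v w : 'rV[R]_n) :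
  ip G (a *: u + v) w = a * ip G u w + ip G v w.
Proof. by rewrite !mulmxDl -!scalemxAl !mxE. Qed.

Lemma ip_linearr n (G : 'M[R]_n) (a : R) (u v w : 'rV[R]_n) :
  ip G w (a *: u + v) = a * ip G w u + ip G w v.
Proof. by rewrite linearD linearZ /= mulmxDr -scalemxAr !mxE. Qed.

Lemma ip_scalel n (G : 'M[R]_n) (a : R) (v w : 'rV[R]_n) :
  ip G (a *: v) w = a * ip G v w.
Proof. by rewrite -!scalemxAl mxE. Qed.

Lemma ip_scaler n (G : 'M[R]_n) (a : R) (v w : 'rV[R]_n) :
  ip G w (a *: v) = a * ip G w v.
Proof. by rewrite linearZ /= -scalemxAr mxE. Qed.

Lemma cauchy_schwarz n (G : 'M[R]_n) (v w : 'rV[R]_n) : G^T = G -> posdef G ->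
  ip G v w ^+ 2 <= ip G v v * ip G w w.
Proof.
move=> GT Gpos; have [->|w0] := eqVneq w 0.
  by rewrite trmx0 !mulmx0 !mxE expr0n mulr0.
have c0 := Gpos _ w0.
set c := ip G w w in c0 *; set d := ip G v w.
have := posdef_ge0 (c *: v + - d *: w) Gpos.
rewrite ip_linearl ip_scalel !ip_linearr !ip_scaler (ip_sym w v GT) -/c -/d.
have -> : c * (c * ip G v v + - d * d) + - d * (c * d + - d * c)
   = c * (ip G v v * c - d ^+ 2) by ring.
by rewrite pmulr_rge0 // subr_ge0.
Qed.

(** Induction on j: the rows chosen so far are fewer than n, so some nonzero vector is orthogonal to
    all of them; it is normalised and added. *)
Lemma orthonormal_complement n k (G : 'M[R]_n) (B : 'M[R]_(k, n)) j :
  G^T = G -> posdef G -> B *m G *m B^T = 1%:M -> (k + j <= n)%N ->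
  exists2 E : 'M[R]_(j, n), E *m G *m E^T = 1%:M & B *m G *m E^T = 0.
Proof.
move=> GT Gpos BB; elim: j => [|j IH] kj.
  by exists 0; [apply/matrixP => -[]|rewrite trmx0 mulmx0].
have [|E EE BE] := IH; first by rewrite (leq_trans _ kj) // leq_add2l.
have EB : E *m G *m B^T = 0.
  by apply: trmx_inj; rewrite !trmx_mul trmxK GT mulmxA BE trmx0.
have : kermx (G *m (col_mx B E)^T) != 0.
  rewrite -mxrank_eq0 mxrank_ker subn_eq0 -ltnNge.
  by apply: leq_ltn_trans (rank_leq_col _) _; rewrite -addnS.
move=> /rowV0Pn[v /sub_kermxP]; rewrite tr_col_mx mul_mx_row mul_mx_row -[0]hsubmxK.
move=> /eq_row_mx[]; rewrite !linear0 !mulmxA => vB vE v0.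
have c0 := Gpos _ v0; set c := ip G v v in c0.
pose w := (Num.sqrt c)^-1 *: v.
have ww : w *m G *m w^T = 1%:M.
  rewrite [LHS]mx11_scalar; congr (_ %:M).
  rewrite /w linearZ /= -scalemxAr -!scalemxAl mxE [X in _ * X]mxE mulrA -invfM -expr2.
  by rewrite sqr_sqrtr ?ltW // mulVf // gt_eqF.
have wE : w *m G *m E^T = 0 by rewrite /w -!scalemxAl vE scaler0.
have wB : w *m G *m B^T = 0 by rewrite /w -!scalemxAl vB scaler0.
have Ew : E *m G *m w^T = 0.
  by apply: trmx_inj; rewrite !trmx_mul trmxK GT mulmxA wE trmx0.
have Bw : B *m G *m w^T = 0.
  by apply: trmx_inj; rewrite !trmx_mul trmxK GT mulmxA wB trmx0.
have CC : col_mx w E *m G *m (col_mx w E)^T = 1%:M.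
  by rewrite tr_col_mx mul_col_mx mul_col_row ww EE wE Ew -scalar_mx_block.
have BC : B *m G *m (col_mx w E)^T = 0 by rewrite tr_col_mx mul_mx_row BE Bw row_mx0.
by exists (col_mx w E).
Qed.

Lemma orthonormal_frame m (G : 'M[R]_m.+1) (u : 'rV[R]_m.+1) :
  G^T = G -> posdef G -> ip G u u = 1 ->
  exists2 E : 'M[R]_(m, m.+1), E *m G *m E^T = 1%:M & u *m G *m E^T = 0.
Proof.
move=> GT Gpos uu; apply: orthonormal_complement => //.
by rewrite [LHS]mx11_scalar uu.
Qed.

Section Frame.
Context {m : nat} (G : 'M[R]_m.+1) (u : 'rV[R]_m.+1) (E : 'M[R]_(m, m.+1)).
Hypotheses (GT : G^T = G) (uu : ip G u u = 1).
Hypotheses (EE : E *m G *m E^T = 1%:M) (uE : u *m G *m E^T = 0).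
Let F : 'M[R]_m.+1 := col_mx u E.

Lemma frame_orthonormal : F *m G *m F^T = 1%:M.
Proof.
have Eu : E *m G *m u^T = 0.
  by apply: trmx_inj; rewrite !trmx_mul trmxK GT mulmxA uE trmx0.
have uu1 : u *m G *m u^T = 1%:M by rewrite [LHS]mx11_scalar uu.
have : col_mx u E *m G *m (col_mx u E)^T = 1%:M.
  by rewrite tr_col_mx mul_col_mx mul_col_row EE uE Eu uu1 -scalar_mx_block.
by [].
Qed.

Lemma frame_inv : G *m F^T *m F = 1%:M.
Proof. by apply: mulmx1C; rewrite mulmxA frame_orthonormal. Qed.

(** In the frame with rows u, E the matrix A becomes F A G F^T, because G F^T inverts F; the trace
    is unchanged and is read off the diagonal. *)
Lemma trace_frame (A : 'M[R]_m.+1) :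
  \tr A = ip G (u *m A) u + \sum_i ip G (row i E *m A) (row i E).
Proof.
rewrite -[A in LHS]mulmx1 -frame_inv !mulmxA mxtrace_mulC !mulmxA.
have K : col_mx u E *m A *m G *m (col_mx u E)^T = block_mx (u *m A *m G *m u^T)
    (u *m A *m G *m E^T) (E *m A *m G *m u^T) (E *m A *m G *m E^T).
  by rewrite tr_col_mx !(mul_col_mx _ _ A) (mul_col_mx _ _ G) mul_col_row.
transitivity (\tr (col_mx u E *m A *m G *m (col_mx u E)^T)) => //.
rewrite K mxtrace_block [\tr (u *m _ *m _ *m _)]big_ord1; congr (_ + _).
apply: eq_bigr => i _; rewrite -!row_mul tr_row !mxE; apply: eq_bigr => j _.
by rewrite !mxE.
Qed.

(** In the orthonormal frame A becomes a symmetric matrix C whose first diagonal entry is mu, and tr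
    (C C) is the sum of the squares of all entries of C. *)
Lemma trace_sqr_frame (A : 'M[R]_m.+1) (mu : R) :
  (A *m G)^T = A *m G -> u *m A = mu *: u -> mu ^+ 2 <= \tr (A *m A).
Proof.
move=> AT uA; pose C := F *m A *m G *m F^T.
have CT : C^T = C.
  by rewrite /C -(mulmxA F) 2!trmx_mul trmxK AT !mulmxA.
have -> : \tr (A *m A) = \tr (C *m C).
  have -> : C *m C = F *m (A *m A *m G *m F^T).
    transitivity (F *m A *m (G *m F^T *m F) *m A *m G *m F^T).
      by rewrite /C !mulmxA.
    by rewrite frame_inv mulmx1 !mulmxA.
  rewrite [RHS]mxtrace_mulC; congr (\tr _).
  by rewrite -[LHS]mulmx1 -frame_inv !mulmxA.
have C00 : C ord0 ord0 = mu.
  have F0 : row ord0 F = u.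
    apply/rowP => j; rewrite mxE /F.
    by rewrite (_ : ord0 = lshift m (ord0 : 'I_1)) ?(col_mxEu u) //; apply: val_inj.
  have -> : C ord0 ord0 = (row ord0 F *m A *m G *m (row ord0 F)^T) 0 0.
    by rewrite -!row_mul tr_row !mxE; apply: eq_bigr => j _; rewrite !mxE.
  by rewrite F0 uA -!scalemxAl mxE uu mulr1.
clearbody C.
rewrite /mxtrace -C00 (bigD1 ord0) //= mxE (bigD1 ord0) //= -expr2 -addrA lerDl.
have sq i j : 0 <= C i j * C j i.
  by rewrite -{2}CT mxE -expr2 sqr_ge0.
rewrite addr_ge0 // ?sumr_ge0 // => i _; rewrite mxE sumr_ge0 //.
Qed.

End Frame.

(** A rank factorisation M = P Q satisfies P (Q P) Q = l P Q; cancelling the full-rank factors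
    leaves Q P = l on a space of dimension rank M, and tr (P Q) = tr (Q P). *)
Lemma trace_scaled_idempotent n (M : 'M[R]_n) (l : R) : l != 0 -> M *m M = l *: M ->
  \tr M = l * (\rank M)%:R.
Proof.
move=> l0 MM; have E : row_base M *m col_base M = l%:M.
  apply: (row_free_inj (row_base_free M)); apply: (row_full_inj (col_base_full M)).
  rewrite /= mul_scalar_mx -scalemxAr mulmx_base -MM.
  transitivity ((col_base M *m row_base M) *m (col_base M *m row_base M)).
    by rewrite !mulmxA.
  by rewrite mulmx_base.
by rewrite -[in LHS](mulmx_base M) mxtrace_mulC E mxtrace_scalar mulr_natr.
Qed.

Lemma orthonormal_basis_exists n (G : 'M[R]_n) (u : 'rV[R]_n) :
  G^T = G -> posdef G -> ip G u u = 1 ->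
  exists e : 'I_n.-1 -> 'rV[R]_n, forall i,
    ip G u (e i) = 0 /\ forall j, ip G (e i) (e j) = (i == j)%:R.
Proof.
(* In dimension 0 the index type ['I_n.-1] is ['I_0], hence empty, and any family will do. *)
case: n G u => [|m] G u GT Gpos uu; first by exists (fun=> 0) => -[].
have [E EE uE] := orthonormal_frame GT Gpos uu.
exists (fun i => row i E) => i; split.
  have := congr1 (fun A : 'rV[R]_m => A 0 i) uE; rewrite [in RHS]mxE => <-.
  by rewrite tr_row !mxE; apply: eq_bigr => j _; rewrite !mxE.
move=> j; have := congr1 (fun A : 'M[R]_m => A i j) EE; rewrite [in RHS]mxE => <-.
by rewrite -!row_mul tr_row !mxE; apply: eq_bigr => k _; rewrite !mxE.
Qed.

Lemma trace_orthonormal n (G A : 'M[R]_n) (u : 'rV[R]_n) (e : 'I_n.-1 -> 'rV[R]_n) :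
  G^T = G -> ip G u u = 1 ->
  (forall i, ip G u (e i) = 0) -> (forall i j, ip G (e i) (e j) = (i == j)%:R) ->
  \tr A = ip G (u *m A) u + \sum_i ip G (e i *m A) (e i).
Proof.
case: n G A u e => [|m] G A u e GT uu ue ee.
  by move: uu; rewrite mxE big_ord0 => /eqP; rewrite eq_sym oner_eq0.
pose E : 'M[R]_(m, m.+1) := \matrix_i e i.
have EE : E *m G *m E^T = 1%:M.
  apply/matrixP => i j; rewrite [RHS]mxE -ee !mxE; apply: eq_bigr => k _.
  rewrite !mxE; congr (_ * _).
  by apply: eq_bigr => l _; rewrite !mxE.
have uE : u *m G *m E^T = 0.
  apply/rowP => j; rewrite [RHS]mxE -(ue j) !mxE; apply: eq_bigr => k _.
  by rewrite !mxE.
rewrite (trace_frame GT uu EE uE); congr (_ + _); apply: eq_bigr => i _.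
by rewrite rowK.
Qed.

Lemma trace_sqr_ge n (G A : 'M[R]_n) (u : 'rV[R]_n) (mu : R) :
  G^T = G -> posdef G -> ip G u u = 1 -> (A *m G)^T = A *m G -> u *m A = mu *: u ->
  mu ^+ 2 <= \tr (A *m A).
Proof.
case: n G A u => [|m] G A u GT Gpos uu AT uA.
  by move: uu; rewrite mxE big_ord0 => /eqP; rewrite eq_sym oner_eq0.
have [E EE uE] := orthonormal_frame GT Gpos uu.
exact: (trace_sqr_frame GT uu EE uE AT uA).
Qed.

End LinearAlgebra.

(** * The Bochner formula in a chart *)

Section BochnerAlgebra.
Context {R : comRingType} {n : nat}.

(* The Ricci identity contracted with x = grad h: M is the covariant derivative
   of grad h, Ga i the matrix (Gamma_ij^k)_jk, DGa i j the derivative of Ga j in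
   direction i, P i j k the second derivatives of the k-th component of grad h,
   and Dx k the derivative of grad h in direction k. *)
Lemma bochner_sums (x : 'rV[R]_n) (M : 'M[R]_n) (Ga : 'I_n -> 'M[R]_n)
    (DGa : 'I_n -> 'I_n -> 'M[R]_n) (P : 'I_n -> 'I_n -> 'I_n -> R) :
  (forall i j k, P i j k = P j i k) ->
  (forall i j k, Ga i j k = Ga j i k) ->
  let Dx k := row k M - x *m Ga k in
  \sum_k ((Dx k *m M) 0 k
    + \sum_j x 0 j * (P k j k + (Dx k *m Ga j) 0 k + (x *m DGa k j) 0 k)
    + (x *m M *m Ga k) 0 k) =
  \sum_j x 0 j * \sum_k (P j k k + (Dx j *m Ga k) 0 k + (x *m DGa j k) 0 k)
  + \tr (M *m M)
  + \sum_j x 0 j * \sum_k (x *m (DGa k j - DGa j k + Ga j *m Ga k - Ga k *m Ga j)) 0 k.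
Proof.
move=> Psym Gsym Dx.
(* Symmetry of Ga in its lower indices, the absence of torsion, makes the sums of F and E below
   cancel. *)
have swap : \sum_k (x *m Ga k *m M) 0 k = \sum_k \sum_j x 0 j * (row k M *m Ga j) 0 k.
  transitivity (\sum_k \sum_l \sum_j x 0 j * Ga k j l * M l k).
    apply: eq_bigr => k _; rewrite mxE; apply: eq_bigr => l _.
    by rewrite mxE mulr_suml.
  rewrite exchange_big /=; apply: eq_bigr => l _.
  rewrite exchange_big /=; apply: eq_bigr => j _.
  rewrite mxE mulr_sumr; apply: eq_bigr => k _.
  by rewrite mxE Gsym -mulrA (mulrC (Ga _ _ _)).
have rowM k : (x *m M *m Ga k) 0 k = \sum_j x 0 j * (row j M *m Ga k) 0 k.
  rewrite [x *m M]mulmx_sum_row mulmx_suml summxE; apply: eq_bigr => j _.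
  by rewrite -scalemxAl mxE.
(* A and B carry the second derivatives of the gradient and the derivatives of Ga, C and C' are
   quadratic in Ga, and E, E', F pair Ga with M. By [Psym] the second derivatives cancel in A -
   B. *)
pose A k j := x 0 j * (P k j k + (x *m DGa k j) 0 k).
pose B k j := x 0 j * (P j k k + (x *m DGa j k) 0 k).
pose C k j := x 0 j * (x *m Ga k *m Ga j) 0 k.
pose C' k j := x 0 j * (x *m Ga j *m Ga k) 0 k.
pose E k j := x 0 j * (row k M *m Ga j) 0 k.
pose E' k j := x 0 j * (row j M *m Ga k) 0 k.
pose F k := (x *m Ga k *m M) 0 k.
have e1 k : (Dx k *m M) 0 k = (M *m M) k k - F k.
  by rewrite /Dx mulmxBl mxE -row_mul mxE [X in _ + X]mxE.
have e2 k j : x 0 j * (P k j k + (Dx k *m Ga j) 0 k + (x *m DGa k j) 0 k)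
    = A k j + E k j - C k j.
  by rewrite /Dx mulmxBl [X in _ + X + _]mxE [X in _ + (_ + X) + _]mxE /A /E /C; ring.
have e3 k j : x 0 j * (P j k k + (Dx j *m Ga k) 0 k + (x *m DGa j k) 0 k)
    = B k j + E' k j - C' k j.
  by rewrite /Dx mulmxBl [X in _ + X + _]mxE [X in _ + (_ + X) + _]mxE /B /E' /C'; ring.
have e4 k j : x 0 j * (x *m (DGa k j - DGa j k + Ga j *m Ga k - Ga k *m Ga j)) 0 k
    = A k j - B k j + C' k j - C k j.
  have -> : (x *m (DGa k j - DGa j k + Ga j *m Ga k - Ga k *m Ga j)) 0 k =
      (x *m DGa k j) 0 k - (x *m DGa j k) 0 k + (x *m Ga j *m Ga k) 0 k
      - (x *m Ga k *m Ga j) 0 k.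
    rewrite mulmxBr mulmxDr mulmxBr !mulmxA.
    by rewrite mxE [X in X + _]mxE [X in X + _ + _]mxE [X in _ + X + _ + _]mxE [X in _ + X]mxE.
  by rewrite /A /B /C /C' (Psym k j k); ring.
have -> : \sum_k ((Dx k *m M) 0 k
    + \sum_j x 0 j * (P k j k + (Dx k *m Ga j) 0 k + (x *m DGa k j) 0 k)
    + (x *m M *m Ga k) 0 k) =
    \tr (M *m M) - \sum_k F k + \sum_k \sum_j (A k j + E k j - C k j + E' k j).
  rewrite /mxtrace -sumrB -big_split /=; apply: eq_bigr => k _.
  by rewrite e1 (eq_bigr _ (fun j _ => e2 k j)) rowM [in RHS]big_split /= addrA.
have -> : \sum_j x 0 j * \sum_k (P j k k + (Dx j *m Ga k) 0 k + (x *m DGa j k) 0 k)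
    = \sum_k \sum_j (B k j + E' k j - C' k j).
  rewrite exchange_big /=; apply: eq_bigr => j _; rewrite mulr_sumr.
  by apply: eq_bigr => k _; exact: e3.
have -> : \sum_j x 0 j * \sum_k
      (x *m (DGa k j - DGa j k + Ga j *m Ga k - Ga k *m Ga j)) 0 k
    = \sum_k \sum_j (A k j - B k j + C' k j - C k j).
  rewrite exchange_big /=; apply: eq_bigr => j _; rewrite mulr_sumr.
  by apply: eq_bigr => k _; exact: e4.
have -> : \sum_k F k = \sum_k \sum_j E k j by exact: swap.
rewrite addrAC -addrA [RHS]addrAC [RHS]addrC; congr (_ + _).
rewrite -sumrB -big_split /=; apply: eq_bigr => k _.
rewrite -sumrB -big_split /=; apply: eq_bigr => j _; ring.
Qed.
End BochnerAlgebra.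

Section Derivatives.
Context {R : realType} {V : normedModType R}.
Implicit Types (f g : V -> R) (x v : V).

Lemma derive_mul f g x v : differentiable f x -> differentiable g x ->
  'D_v (fun y => f y * g y) x = 'D_v f x * g x + f x * 'D_v g x.
Proof.
move=> /(diff_derivable (v := v)) df /(diff_derivable (v := v)) dg.
transitivity (f x * 'D_v g x + g x * 'D_v f x); first exact: (deriveM df dg).
by rewrite addrC [g x * _]mulrC.
Qed.

Lemma derive_add f g x v : differentiable f x -> differentiable g x ->
  'D_v (fun y => f y + g y) x = 'D_v f x + 'D_v g x.
Proof.
move=> /(diff_derivable (v := v)) df /(diff_derivable (v := v)) dg.
exact: deriveD.
Qed.

Lemma derive_bigsum m (f : 'I_m -> V -> R) x v : (forall i, differentiable (f i) x) ->
  'D_v (fun y => \sum_i f i y) x = \sum_i 'D_v (f i) x.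
Proof.
move=> df; rewrite -(@derive_sum _ _ _ _ f x v); last first.
  by move=> i; apply: diff_derivable.
by rewrite fct_sumE.
Qed.

Lemma differentiable_mxE m n (M : V -> 'M[R]_(m, n)) x i j :
  differentiable M x -> differentiable (fun y => M y i j) x.
Proof.
move=> dM; apply: (@differentiable_comp _ _ _ _ M (fun N : 'M[R]_(m, n) => N i j)) => //.
exact: differentiable_coord.
Qed.

Lemma derive_mxE m n (M : V -> 'M[R]_(m, n)) x v i j : differentiable M x ->
  ('D_v M x) i j = 'D_v (fun y => M y i j) x.
Proof. by move=> dM; rewrite derive_mx ?mxE //; exact: diff_derivable. Qed.

Lemma derive_mulmx m n p (A : V -> 'M[R]_(m, n)) (B : V -> 'M[R]_(n, p)) x v :
  differentiable A x -> differentiable B x -> differentiable (fun y => A y *m B y) x ->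
  'D_v (fun y => A y *m B y) x = 'D_v A x *m B x + A x *m 'D_v B x.
Proof.
move=> dA dB dAB; apply/matrixP => i j; rewrite derive_mxE // !mxE -big_split /=.
under eq_fun do rewrite mxE.
rewrite derive_bigsum; last first.
  by move=> k; apply: differentiableM; exact: differentiable_mxE.
apply: eq_bigr => k _; rewrite derive_mul; try exact: differentiable_mxE.
by rewrite !derive_mxE.
Qed.

Lemma derive_chain (g : R -> R) f x v : differentiable f x -> differentiable g (f x) ->
  'D_v (g \o f) x = 'D_1 g (f x) * 'D_v f x.
Proof.
move=> df dg; rewrite deriveE; last exact: differentiable_comp.
rewrite diff_comp //= !deriveE //.
move: ('d f x v) => r; rewrite mulrC -[X in 'd g (f x) X = _](mulr1 r).
exact: linearZ.
Qed.

End Derivatives.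

Lemma derive_partials {R : realType} {n : nat} (W : normedModType R)
    (f : 'rV[R]_n -> W) x v : differentiable f x ->
  'D_v f x = \sum_i v 0 i *: partial i f x.
Proof.
move=> df; rewrite deriveE // [v in LHS]row_sum_delta linear_sum; apply: eq_bigr => i _.
by rewrite linearZ /partial deriveE.
Qed.

Lemma mulmx_row_entry {R : nzRingType} {m n p : nat} (A : 'M[R]_(m, n))
    (B : 'M[R]_(n, p)) i j : (A *m B) i j = (row i A *m B) 0 j.
Proof. by rewrite -row_mul [RHS]mxE. Qed.

Lemma mx_entry_addK {R : nzRingType} {m n : nat} (A B : 'M[R]_(m, n)) i j :
  (A + B) i j - B i j = A i j.
Proof. by rewrite mxE addrK. Qed.

Lemma mx_entry_scale {R : nzRingType} {m n : nat} (a : R) (A : 'M[R]_(m, n)) i j :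
  (a *: A) i j = a * A i j.
Proof. by rewrite mxE. Qed.

Lemma mx_entry_add {R : nzRingType} {m n : nat} (A B : 'M[R]_(m, n)) i j :
  (A + B) i j = A i j + B i j.
Proof. by rewrite mxE. Qed.

Lemma mx_entry_sub {R : nzRingType} {m n : nat} (A B : 'M[R]_(m, n)) i j :
  (A - B) i j = A i j - B i j.
Proof. by rewrite !mxE. Qed.

(** With D = d_i X, C the connection matrix in direction i and C G + (C G)^T = d_i G, this says d_i
    <X, X> = 2 <nabla_i X, X>. *)
Lemma norm_derivative_entry {R : comNzRingType} {n : nat} (X D : 'rV[R]_n) (C G : 'M[R]_n) :
  G^T = G ->
  ((D *m G + X *m (C *m G + (C *m G)^T)) *m X^T + X *m G *m D^T) 0 0
  = 2 * ((D + X *m C) *m G *m X^T) 0 0.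
Proof.
move=> GT; have tr0 (A : 'M[R]_1) : A^T 0 0 = A 0 0 by rewrite mxE.
have e1 : (X *m G *m D^T) 0 0 = (D *m G *m X^T) 0 0.
  by rewrite -tr0 !trmx_mul trmxK GT mulmxA.
have e2 : (X *m (C *m G)^T *m X^T) 0 0 = (X *m C *m G *m X^T) 0 0.
  by rewrite -tr0 !trmx_mul !trmxK !mulmxA.
rewrite mx_entry_add e1 mulmxDl mulmxDr mulmxDl mx_entry_add mx_entry_add e2.
by rewrite !mulmxDl mx_entry_add !mulmxA; ring.
Qed.

Lemma mx_entry_tr {T : Type} {m n : nat} (A : 'M[T]_(m, n)) i j : A^T i j = A j i.
Proof. by rewrite mxE. Qed.

Lemma mx_entry_mul {R : nzRingType} {m n p : nat} (A : 'M[R]_(m, n))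
    (B : 'M[R]_(n, p)) i j : (A *m B) i j = \sum_k A i k * B k j.
Proof. by rewrite mxE. Qed.

Lemma sum_delta {R : nzRingType} {n : nat} (A : 'I_n -> R) l :
  \sum_k A k * (l == k)%:R = A l.
Proof.
rewrite (bigD1 l) //= eqxx mulr1 big1 ?addr0 // => k kl.
by rewrite eq_sym (negbTE kl) mulr0.
Qed.

Section Chart.
Context {R : realType} {n : nat} (U : set 'rV[R]_n).
Hypothesis oU : open U.

Lemma smooth_differentiable (W : normedModType R) (f : 'rV[R]_n -> W) x :
  smooth_on U f -> U x -> differentiable f x.
Proof. by move=> fs Ux; exact: (fs 1%N).1. Qed.

Lemma smooth_derive (W : normedModType R) (f : 'rV[R]_n -> W) v :
  smooth_on U f -> smooth_on U ('D_v f).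
Proof. by move=> fs k; exact: (fs k.+1).2. Qed.

Variable G : 'rV[R]_n -> 'M[R]_n.
Hypotheses (Gs : smooth_on U G) (GT : forall x, U x -> (G x)^T = G x).
Hypothesis Gpos : forall x, U x -> posdef (G x).

Lemma metric_unit x : U x -> G x \in unitmx.
Proof. by move=> Ux; exact/posdef_unitmx/Gpos. Qed.

Lemma smooth_metric_entry i j : smooth_on U (fun x => G x i j).
Proof. by move=> k; apply: Ck_on_mxE => //; exact: Gs. Qed.

Lemma smooth_invmx : smooth_on U (fun x => invmx (G x)).
Proof. by move=> k; apply: Ck_on_invmx (Gs k) => //; exact: metric_unit. Qed.

Lemma smooth_christoffel i j k : smooth_on U (christoffel G i j k).
Proof.
move=> d; apply: Ck_onM => //; first exact: Ck_on_cst.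
apply: Ck_on_sum => // l; apply: Ck_onM => //.
  by apply: Ck_on_mxE => //; exact: smooth_invmx.
apply: Ck_onB => //; [apply: Ck_onD => //|];
  by apply: smooth_derive; exact: smooth_metric_entry.
Qed.

(** The connection matrix in direction i, acting on rows from the right: nabla_i Y is d_i Y plus the
    row Y times this matrix. *)
Definition christoffel_mx (i : 'I_n) x : 'M[R]_n := \matrix_(j, k) christoffel G i j k x.

Lemma christoffel_mxE i x j k : christoffel_mx i x j k = christoffel G i j k x.
Proof. by rewrite mxE. Qed.

Lemma smooth_christoffel_mx i : smooth_on U (christoffel_mx i).
Proof.
move=> d; apply: Ck_on_mx => // j k.
apply: Ck_on_ext (smooth_christoffel i j k d) => // x _; by rewrite mxE.
Qed.

Lemma partial_metric_sym i j k x : U x ->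
  partial k (fun y => G y i j) x = partial k (fun y => G y j i) x.
Proof.
move=> Ux; apply: near_eq_derive; near=> y.
have Uy : U y by near: y; exact: open_nbhs_nbhs.
by rewrite -{1}(GT Uy) mxE.
Unshelve. all: by end_near. Qed.

Lemma christoffel_sym i j k x : U x -> christoffel G i j k x = christoffel G j i k x.
Proof.
move=> Ux; rewrite /christoffel; congr (_ * _); apply: eq_bigr => l _.
by rewrite [X in _ * (X - _)]addrC (partial_metric_sym i j l Ux).
Qed.

(** Lowering the upper index with G cancels the inverse metric and leaves the Christoffel symbols of
    the first kind. *)
Lemma christoffel_mx_lower i j l x : U x -> (christoffel_mx i x *m G x) j l =
  2^-1 * (partial i (fun y => G y j l) x + partial j (fun y => G y i l) x
     - partial l (fun y => G y i j) x).
Proof.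
move=> Ux; rewrite mxE; under eq_bigr do rewrite mxE.
rewrite /christoffel.
set A := fun l => partial i (fun y => G y j l) x + partial j (fun y => G y i l) x
     - partial l (fun y => G y i j) x.
transitivity (2^-1 * \sum_k A k * \sum_r G x l r * invmx (G x) r k).
  transitivity (\sum_k \sum_r 2^-1 * (A r * (G x l k * invmx (G x) k r))).
    apply: eq_bigr => k _; rewrite -mulrA mulr_suml mulr_sumr; apply: eq_bigr => r _.
    have -> : G x k l = G x l k by rewrite -[in LHS](GT Ux) mxE.
    by rewrite /A; ring.
  rewrite exchange_big mulr_sumr /=; apply: eq_bigr => r _.
  by rewrite -!mulr_sumr.
have I k : \sum_r G x l r * invmx (G x) r k = (l == k)%:R.
  by have := mulmxV (metric_unit Ux) => /matrixP/(_ l k); rewrite !mxE.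
rewrite (eq_bigr (fun k => A k * (l == k)%:R)) => [|k _]; last by rewrite I.
by rewrite sum_delta.
Qed.

(** Parallelism of the metric: in the sum of the two first-kind symbols with j and l exchanged only
    d_i g_jl survives. *)
Lemma metric_compatibility i x : U x ->
  partial i G x = christoffel_mx i x *m G x + (christoffel_mx i x *m G x)^T.
Proof.
move=> Ux; apply/matrixP => j l; rewrite mxE [X in _ = _ + X]mxE !christoffel_mx_lower //.
rewrite /partial derive_mxE; last exact: smooth_differentiable Gs Ux.
rewrite -!/(partial _ _ _) (partial_metric_sym l j i Ux).
by field.
Qed.

Lemma covdE v (Y : 'rV[R]_n -> 'rV[R]_n) x :
  covd G v Y x = 'D_v Y x + \sum_i v 0 i *: (Y x *m christoffel_mx i x).
Proof.
congr (_ + _); apply/rowP => k; rewrite mxE summxE; apply: eq_bigr => i _.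
by rewrite !mxE mulr_sumr; apply: eq_bigr => j _; rewrite mxE mulrA.
Qed.

Variable h : 'rV[R]_n -> R.
Hypothesis hs : smooth_on U h.
Local Notation X := (grad G h).
Local Notation dh := (fun x => \row_i partial i h x).

Lemma smooth_dh : smooth_on U dh.
Proof.
move=> k; apply: Ck_on_mx => // i j.
by apply: Ck_on_ext (smooth_derive (delta_mx 0 j) hs k) => // x _; rewrite mxE.
Qed.

Lemma smooth_grad : smooth_on U X.
Proof. by move=> k; apply: Ck_on_mulmx => //; [exact: smooth_dh|exact: smooth_invmx]. Qed.

Lemma grad_mul x : U x -> X x *m G x = dh x.
Proof. by move=> Ux; rewrite /grad mulmxKV // metric_unit. Qed.

Lemma inner_grad x w : U x -> inner G x (X x) w = 'D_w h x.
Proof.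
move=> Ux; rewrite /inner grad_mul // derive_partials; last exact: smooth_differentiable hs Ux.
by rewrite mxE; apply: eq_bigr => i _; rewrite !mxE [RHS]mulrC.
Qed.

(* Vectors are rows: nabla_v (grad h) is v *m cov_mx x. *)
Definition cov_mx x : 'M[R]_n :=
  \matrix_i ('D_(delta_mx 0 i) X x + X x *m christoffel_mx i x).

Lemma row_cov_mx i x : row i (cov_mx x) = partial i X x + X x *m christoffel_mx i x.
Proof. by rewrite rowK. Qed.

Lemma covd_gradE v x : U x -> covd G v X x = v *m cov_mx x.
Proof.
move=> Ux; rewrite mulmx_sum_row covdE derive_partials; last first.
  exact: smooth_differentiable smooth_grad Ux.
by rewrite -big_split /=; apply: eq_bigr => i _; rewrite -scalerDr row_cov_mx.
Qed.

Lemma cov_mxE i j x : cov_mx x i j = (partial i X x + X x *m christoffel_mx i x) 0 j.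
Proof. by rewrite -row_cov_mx [RHS]mxE. Qed.

(* Keeps unification from comparing entries of these matrices by unfolding. *)
Opaque christoffel_mx christoffel grad cov_mx.

Lemma laplacianE x : U x -> laplacian G h x = \tr (cov_mx x).
Proof.
move=> Ux; apply: eq_bigr => i _; by rewrite covd_gradE // -rowE mxE.
Qed.

Lemma smooth_cov_mx : smooth_on U cov_mx.
Proof.
move=> k; apply: Ck_on_mx => // i j.
apply: (@Ck_on_ext _ _ _ oU _ _ (fun x => (partial i X x + X x *m christoffel_mx i x) 0 j)).
  by move=> x _; rewrite cov_mxE.
apply: Ck_on_mxE => //; apply: Ck_onD => //; first exact: smooth_derive smooth_grad k.
by apply: Ck_on_mulmx => //; [exact: smooth_grad|exact: smooth_christoffel_mx].
Qed.

Lemma smooth_mulmx m p q (A : 'rV[R]_n -> 'M[R]_(m, p)) (B : 'rV[R]_n -> 'M[R]_(p, q)) :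
  smooth_on U A -> smooth_on U B -> smooth_on U (fun y => A y *m B y).
Proof. by move=> As Bs k; apply: Ck_on_mulmx. Qed.

Lemma derive_smooth_mulmx m p q (A : 'rV[R]_n -> 'M[R]_(m, p)) (B : 'rV[R]_n -> 'M[R]_(p, q)) x v :
  smooth_on U A -> smooth_on U B -> U x ->
  'D_v (fun y => A y *m B y) x = 'D_v A x *m B x + A x *m 'D_v B x.
Proof.
move=> As Bs Ux; apply: derive_mulmx; [exact: smooth_differentiable As Ux
  |exact: smooth_differentiable Bs Ux|].
exact: (smooth_differentiable (smooth_mulmx As Bs) Ux).
Qed.

(** Differentiate X G = dh in direction i and split X d_i G by metric compatibility: one summand
    completes d_i X to the covariant derivative, the other is the correction to d_i d_j h. *)
Lemma hessian_entry i j x : U x -> (cov_mx x *m G x) i j =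
  partial i (partial j h) x - (X x *m (christoffel_mx i x *m G x)^T) 0 j.
Proof.
move=> Ux.
rewrite mulmx_row_entry.
have -> : partial i (partial j h) x = (partial i (fun y => X y *m G y) x) 0 j.
  rewrite /partial derive_mxE; last first.
    exact: (smooth_differentiable (smooth_mulmx smooth_grad Gs) Ux).
  apply: near_eq_derive; near=> y.
  have Uy : U y by near: y; exact: open_nbhs_nbhs.
  by rewrite grad_mul // mxE.
rewrite /partial derive_smooth_mulmx //; last exact: smooth_grad.
rewrite -!/(partial _ _ _) (metric_compatibility i Ux) row_cov_mx mulmxDl mulmxDr.
by rewrite mulmxA addrA mx_entry_addK.
Unshelve. all: by end_near. Qed.

Lemma hessian_entry_lower i j x : U x -> (cov_mx x *m G x) i j =
  partial i (partial j h) x - \sum_k X x 0 k *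
    (2^-1 * (partial i (fun y => G y j k) x + partial j (fun y => G y i k) x
     - partial k (fun y => G y i j) x)).
Proof.
move=> Ux; rewrite hessian_entry //; congr (_ - _); rewrite mx_entry_mul.
by apply: eq_bigr => k _; rewrite mx_entry_tr christoffel_mx_lower.
Qed.

(** In first-kind symbols the Hessian is d_i d_j h minus a contraction that is symmetric in i and
    j. *)
Lemma hessian_sym x : U x -> (cov_mx x *m G x)^T = cov_mx x *m G x.
Proof.
move=> Ux; apply/matrixP => i j; rewrite [LHS]mx_entry_tr.
rewrite (hessian_entry_lower j i Ux) (hessian_entry_lower i j Ux).
have e1 : partial j (partial i h) x = partial i (partial j h) x.
  exact: (derive_commute (delta_mx 0 i) (delta_mx 0 j) oU Ux (hs 2)).
rewrite e1; congr (_ - _); apply: eq_bigr => k _.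
by rewrite (partial_metric_sym i j k Ux) (addrC (partial j (fun y => G y i k) x)).
Qed.

Lemma derive_norm_grad v x : U x ->
  'D_v (fun y => inner G y (X y) (X y)) x = 2 * inner G x (v *m cov_mx x) (X x).
Proof.
move=> Ux.
have Xs := smooth_grad.
have XTs : smooth_on U (fun y => (X y)^T).
  move=> k; apply: Ck_on_mx => // i j.
  by apply: Ck_on_ext (Ck_on_mxE oU j i (Xs k)) => // y _; rewrite mx_entry_tr.
have XGs := smooth_mulmx Xs Gs.
have s3 := smooth_mulmx XGs XTs.
have DT w : 'D_w (fun y => (X y)^T) x = ('D_w X x)^T.
  apply/matrixP => i j; rewrite [RHS]mxE !derive_mxE; last 2 first.
  - exact: (smooth_differentiable Xs Ux).
  - exact: (smooth_differentiable XTs Ux).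
  by congr (derive _ x w); apply/funext => y; rewrite [LHS]mxE.
have Di i : partial i (fun y => inner G y (X y) (X y)) x
    = 2 * inner G x (row i (cov_mx x)) (X x).
  have -> : partial i (fun y => inner G y (X y) (X y)) x =
      (partial i (fun y => X y *m G y *m (X y)^T) x) 0 0.
    by rewrite /partial derive_mxE //; exact: (smooth_differentiable s3 Ux).
  rewrite /partial (derive_smooth_mulmx _ XGs XTs Ux) (derive_smooth_mulmx _ Xs Gs Ux) DT.
  rewrite -!/(partial _ _ _) (metric_compatibility i Ux) row_cov_mx /inner.
  exact: norm_derivative_entry (GT Ux).
have dI : differentiable (fun y => inner G y (X y) (X y)) x.
  by apply: differentiable_mxE; exact: (smooth_differentiable s3 Ux).
rewrite derive_partials // [v *m _]mulmx_sum_row /inner !mulmx_suml summxE mulr_sumr.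
apply: eq_bigr => i _; rewrite Di -!scalemxAl [in RHS]mx_entry_scale.
by rewrite [RHS]mulrCA.
Qed.

Lemma laplacian_smooth : smooth_on U (laplacian G h).
Proof.
move=> k; apply: Ck_on_ext (_ : Ck_on k U (fun x => \sum_i cov_mx x i i)) => //.
  by move=> x Ux; rewrite laplacianE.
by apply: Ck_on_sum => // i; apply: Ck_on_mxE => //; exact: smooth_cov_mx.
Qed.

Lemma divergence_smooth (Y : 'rV[R]_n -> 'rV[R]_n) x : smooth_on U Y -> U x ->
  divergence G Y x = \sum_i ((partial i Y x) 0 i + (Y x *m christoffel_mx i x) 0 i).
Proof.
move=> Ys Ux; apply: eq_bigr => i _; rewrite covdE -/(partial i Y x).
have -> : \sum_j (delta_mx 0 i : 'rV[R]_n) 0 j *: (Y x *m christoffel_mx j x)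
    = Y x *m christoffel_mx i x.
  rewrite (bigD1 i) //= mxE !eqxx scale1r big1 ?addr0 // => j ji.
  by rewrite mxE (negbTE ji) andbF scale0r.
by rewrite mxE.
Qed.

(** A contraction of the curvature of the connection matrices. As these act on rows, the product
    with index j on the left has the positive sign. *)
Lemma ricci_christoffel_mx j l x : U x -> ricci G x j l =
  \sum_k (partial k (christoffel_mx j) x - partial j (christoffel_mx k) x
     + christoffel_mx j x *m christoffel_mx k x
     - christoffel_mx k x *m christoffel_mx j x) l k.
Proof.
move=> Ux; rewrite mxE; apply: eq_bigr => k _; rewrite /riemann sumrB addrA.
rewrite mx_entry_sub mx_entry_add mx_entry_sub; congr (_ - _ + _ - _).
- rewrite /partial derive_mxE; last exact: (smooth_differentiable (smooth_christoffel_mx j) Ux).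
  by congr (derive _ x _); apply/funext => y; rewrite christoffel_mxE.
- rewrite /partial derive_mxE; last exact: (smooth_differentiable (smooth_christoffel_mx k) Ux).
  by congr (derive _ x _); apply/funext => y; rewrite christoffel_mxE.
- by rewrite mxE; apply: eq_bigr => m _; rewrite !christoffel_mxE.
- by rewrite mxE; apply: eq_bigr => m _; rewrite !christoffel_mxE.
Qed.

Lemma partial_gradE i x : U x -> partial i X x = row i (cov_mx x) - X x *m christoffel_mx i x.
Proof. by move=> Ux; rewrite row_cov_mx addrK. Qed.

Lemma partial_cov_mx i j k x : U x -> (partial i cov_mx x) j k =
  partial i (partial j (fun y => X y 0 k)) x
  + (partial i X x *m christoffel_mx j x) 0 k + (X x *m partial i (christoffel_mx j) x) 0 k.
Proof.
move=> Ux; have Xs := smooth_grad; have Gs' := smooth_christoffel_mx.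
have XGs := smooth_mulmx Xs (Gs' j).
have pXs : smooth_on U (partial j X) by exact: smooth_derive.
rewrite /partial derive_mxE; last exact: (smooth_differentiable smooth_cov_mx Ux).
rewrite -!/(partial _ _ _).
have -> : (fun y => cov_mx y j k) =
    (fun y => (partial j X y) 0 k + (X y *m christoffel_mx j y) 0 k).
  by apply/funext => y; rewrite cov_mxE mx_entry_add.
rewrite /partial derive_add; last 2 first.
- by apply: differentiable_mxE; exact: (smooth_differentiable pXs Ux).
- by apply: differentiable_mxE; exact: (smooth_differentiable XGs Ux).
rewrite -addrA; congr (_ + _).
  apply: near_eq_derive; near=> y.
  have Uy : U y by near: y; exact: open_nbhs_nbhs.
  by rewrite derive_mxE //; exact: (smooth_differentiable Xs Uy).
rewrite -derive_mxE; last exact: (smooth_differentiable XGs Ux).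
by rewrite (derive_smooth_mulmx _ Xs (Gs' j) Ux) mx_entry_add.
Unshelve. all: by end_near. Qed.

(** The row X M is nabla_X X = grad (|X|^2 / 2), so this is the Bochner formula for the Laplacian of
    |grad h|^2 / 2; tr (M M) is the squared norm of the Hessian since M is self-adjoint. The Ricci
    term arises from commuting covariant derivatives of X. *)
Lemma bochner x : U x -> divergence G (fun y => X y *m cov_mx y) x =
  'D_(X x) (laplacian G h) x + \tr (cov_mx x *m cov_mx x)
  + (X x *m ricci G x *m (X x)^T) 0 0.
Proof.
move=> Ux; have Xs := smooth_grad; have Ms := smooth_cov_mx.
rewrite (divergence_smooth (smooth_mulmx Xs Ms) Ux).
have lapd : differentiable (laplacian G h) x by exact: (smooth_differentiable laplacian_smooth Ux).
have Dlap j : partial j (laplacian G h) x = \sum_k (partial j cov_mx x) k k.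
  have Md k : differentiable (fun y => cov_mx y k k) x.
    by apply: differentiable_mxE; exact: (smooth_differentiable Ms Ux).
  transitivity (partial j (fun y => \sum_k cov_mx y k k) x).
    apply: near_eq_derive; near=> y.
    have Uy : U y by near: y; exact: open_nbhs_nbhs.
    exact: laplacianE.
  rewrite /partial derive_bigsum //; apply: eq_bigr => k _.
  by rewrite derive_mxE //; exact: (smooth_differentiable Ms Ux).
pose P i j k := partial i (partial j (fun y => X y 0 k)) x.
have Psym i j k : P i j k = P j i k.
  apply: (derive_commute (delta_mx 0 j) (delta_mx 0 i) oU Ux).
  exact: Ck_on_mxE.
have Gsym i j k : christoffel_mx i x j k = christoffel_mx j x i k.
  by rewrite !christoffel_mxE christoffel_sym.
have := bochner_sums (X x) (cov_mx x) (fun i j => partial i (christoffel_mx j) x)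
   Psym Gsym.
rewrite /=.
(* The abstract sums are folded back: [Dx k] into [partial k X], the brackets into derivatives of
   [cov_mx], and their trace into the derivative of the Laplacian. *)
under eq_bigr => k _.
  rewrite -partial_gradE //.
  under [\sum_j _]eq_bigr => j _ do rewrite -(partial_cov_mx k j k Ux).
over.
under [\sum_j _ in X in _ = X + _ + _]eq_bigr => j _.
  under eq_bigr => k _ do rewrite -partial_gradE // -(partial_cov_mx j k k Ux).
  rewrite -Dlap.
over.
move=> E.
transitivity ('D_(X x) (laplacian G h) x + \tr (cov_mx x *m cov_mx x) +
  \sum_j X x 0 j * \sum_k
     (X x *m (partial k (christoffel_mx j) x - partial j (christoffel_mx k) x
       + christoffel_mx j x *m christoffel_mx k x
       - christoffel_mx k x *m christoffel_mx j x)) 0 k).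
  rewrite derive_partials // -E; apply: eq_bigr => k _; congr (_ + _).
  by rewrite /partial (derive_smooth_mulmx _ Xs Ms Ux) mx_entry_add [X in _ + X]mx_entry_mul.
congr (_ + _); rewrite [RHS]mx_entry_mul.
transitivity (\sum_l \sum_j X x 0 j * ricci G x j l * X x 0 l); last first.
  by apply: eq_bigr => l _; rewrite [(X x *m ricci G x) _ _]mx_entry_mul mulr_suml mx_entry_tr.
rewrite exchange_big /=; apply: eq_bigr => j _.
under [RHS]eq_bigr => l _ do rewrite ricci_christoffel_mx // mulr_sumr mulr_suml.
rewrite exchange_big /= mulr_sumr; apply: eq_bigr => k _.
rewrite [(X x *m _) 0 k]mx_entry_mul.
rewrite [LHS]mulr_sumr; apply: eq_bigr => l _.
by rewrite -mulrA [X in _ * X]mulrC.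
Unshelve. all: by end_near. Qed.
End Chart.

(** * Tangent vectors of zero sets *)

Section MatrixNorm.
Context {R : realType}.

Lemma mx_entry_le_norm m n (A : 'M[R]_(m, n)) i j : `|A i j| <= `|A|.
Proof.
rewrite [leRHS]/Num.Def.normr /= mx_normrE.
by apply: (le_bigmax _ (fun ij => `|A ij.1 ij.2|) (i, j)).
Qed.

Lemma mx_norm_le m n (A : 'M[R]_(m, n)) c : 0 <= c -> (forall i j, `|A i j| <= c) -> `|A| <= c.
Proof.
move=> c0 Ac; rewrite [leLHS]/Num.Def.normr /= mx_normrE.
by apply: bigmax_le => // -[i j] _; exact: Ac.
Qed.

Lemma near_norm_le (V W : normedModType R) (F : V -> W) p : {for p, continuous F} ->
  \forall y \near p, `|F y| <= `|F p| + 1.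
Proof.
move=> /cvgrPdist_lt/(_ _ ltr01); apply: filterS => y yp.
rewrite -(subrK (F p) (F y)) (le_trans (ler_normD _ _)) // addrC lerD2l distrC ltW //.
Qed.

(** The norm is the largest absolute entry, whence one factor for each of the n^2 terms. *)
Lemma ip_norm_le n (G : 'M[R]_n) (w : 'rV[R]_n) :
  (w *m G *m w^T) 0 0 <= n%:R ^+ 2 * `|G| * `|w| ^+ 2.
Proof.
rewrite mxE (le_trans (ler_norm _)) // (le_trans (ler_norm_sum _ _ _)) //.
apply: (@le_trans _ _ (\sum_(j < n) n%:R * `|G| * `|w| ^+ 2)); last first.
  by rewrite sumr_const card_ord -[leLHS]mulr_natl !mulrA.
apply: ler_sum => j _; rewrite normrM expr2 mulrA ler_pM //; last first.
  by rewrite mxE mx_entry_le_norm.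
rewrite mxE (le_trans (ler_norm_sum _ _ _)) //.
apply: (@le_trans _ _ (\sum_(j < n) `|G| * `|w|)); last first.
  by rewrite sumr_const card_ord -[leLHS]mulr_natl !mulrA.
by apply: ler_sum => i _; rewrite normrM mulrC ler_pM ?mx_entry_le_norm.
Qed.

Lemma norm_le_ip n (G : 'M[R]_n) (v : 'rV[R]_n) : G^T = G -> posdef G ->
  `|v| ^+ 2 <= `|invmx G| * (v *m G *m v^T) 0 0.
Proof.
move=> GT Gpos; have vv := posdef_ge0 v Gpos; have Gu := posdef_unitmx Gpos.
have c0 : 0 <= `|invmx G| * (v *m G *m v^T) 0 0 by rewrite mulr_ge0.
rewrite -[leRHS](sqr_sqrtr c0) ler_pXn2r ?nnegrE ?sqrtr_ge0 //.
apply: mx_norm_le => [|i j]; first exact: sqrtr_ge0.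
rewrite (ord1 i) -sqrtr_sqr ler_wsqrtr //.
(* This w represents the j-th coordinate: <v, w> = v_j and <w, w> is the j-th diagonal entry of
   G^-1, so Cauchy-Schwarz bounds each coordinate of v. *)
pose w : 'rV[R]_n := delta_mx 0 j *m invmx G.
have wT : w^T = invmx G *m (delta_mx 0 j)^T by rewrite trmx_mul trmx_inv GT.
have := cauchy_schwarz v w GT Gpos.
rewrite wT !mulmxA mulmxK // mulmxKV // trmx_delta -colE mxE => /le_trans; apply.
rewrite mulrC ler_wpM2r // -rowE -colE !mxE.
by rewrite (le_trans (ler_norm _)) // mx_entry_le_norm.
Qed.

Lemma compact_closed_ball n (p : 'rV[R]_n) (r : R) : 0 < r -> compact [set y | `|y - p| <= r].
Proof.
move=> r0; apply: bounded_closed_compact.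
  exists (r + `|p|); split; first exact: num_real.
  move=> M rM y /= yp; rewrite -(subrK p y) (le_trans (ler_normD _ _)) //.
  by rewrite (le_trans _ (ltW rM)) // lerD2r.
have -> : [set y | `|y - p| <= r] = closed_ball p r.
  by rewrite closed_ballE //; apply/funext => y; rewrite /closed_ball_ /= distrC.
exact: closed_ball_closed.
Qed.

End MatrixNorm.

Section Tangent.
Context {R : realType} {V : normedModType R}.

(** Bouligand's tangent cone: points of Z at distance o(s) from p + s v for arbitrarily small s > 0.
    It asks for points of Z only, not for a curve. *)
Definition tangent_to (Z : set V) (p v : V) : Prop := forall e d : R, 0 < e -> 0 < d ->
  exists s y, [/\ 0 < s < d, Z y & `|y - (p + s *: v)| <= e * s].

Lemma derive_gt_near (f : V -> R) p w m : differentiable f p -> m < 'D_w f p ->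
  exists2 d, 0 < d & forall s, s != 0 -> `|s| < d -> m < s^-1 * (f (p + s *: w) - f p).
Proof.
move=> /(diff_derivable (v := w)) df; rewrite -subr_gt0 => D0.
have /cvgrPdist_lt/(_ _ D0) : h^-1 *: ((f \o shift p) (h *: w) - f p) @[h --> 0^'] --> 'D_w f p.
  exact: df.
rewrite /dnbhs /within /= => /nbhs_ballP[d /= d0 dP]; exists d => // s s0 sd.
have := dP s; rewrite -ball_normE /= sub0r normrN => /(_ sd s0).
rewrite distrC ltr_distl opprB addrC subrK => /andP[+ _].
by rewrite /= (addrC p).
Qed.

Lemma near_diff_approx (W : normedModType R) (F : V -> W) p (e : R) :
  differentiable F p -> 0 < e ->
  \forall y \near p, `|F y - F p - 'd F p (y - p)| <= e * `|y - p|.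
Proof.
move=> dF e0; rewrite (near_shift 0 p) /=.
have /eqaddoP/(_ _ e0) := diff_locally dF; apply: filterS => y /=.
by rewrite !fctE /= subr0 addrK opprD addrA.
Qed.

Lemma near_diff_lipschitz (W : normedModType R) (F : V -> W) p :
  differentiable F p -> exists2 k : R, 0 < k &
  \forall y \near p, `|F y - F p| <= k * `|y - p|.
Proof.
move=> dF; have [k k0 kP] := linear_lipschitz (diff_continuous dF).
exists (k + 1); first by rewrite addr_gt0.
apply: filterS (near_diff_approx dF ltr01) => y yP.
rewrite -(subrK ('d F p (y - p)) (F y - F p)) (le_trans (ler_normD _ _)) //.
by rewrite addrC mulrDl lerD.
Qed.

Lemma tangent_derive0 (W : normedModType R) (Z : set V) (F : V -> W) p v :
  differentiable F p -> F p = 0 -> (\forall y \near p, Z y -> F y = 0) ->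
  tangent_to Z p v -> 'D_v F p = 0.
Proof.
move=> dF Fp ZF tv; rewrite deriveE //.
have [k [k0 kP]] : exists k, 0 < k /\ forall x, `|'d F p x| <= k * `|x|.
  have [k k0 kP] := linear_lipschitz (diff_continuous dF); by exists k.
apply/eqP; rewrite -normr_le0; apply/ler_addgt0Pl => e e0; rewrite addr0.
(* The budget e s is halved: eta |y - p| pays for the linearisation at y, where |y - p| <= s (|v| +
   1) because e1 <= 1, and k e1 s pays for moving from y to p + s v. *)
pose eta := e / 2 / (`|v| + 1); pose e1 := Num.min 1 (e / 2 / k).
have v1 : 0 < `|v| + 1 by rewrite ltr_wpDl.
have e20 : 0 < e / 2 by rewrite divr_gt0.
have eta0 : 0 < eta by rewrite divr_gt0.
have e10 : 0 < e1 by rewrite lt_min ltr01 divr_gt0.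
have near_F := near_diff_approx dF eta0.
have near_p : \forall y \near p, (Z y -> F y = 0) /\
    `|F y - F p - 'd F p (y - p)| <= eta * `|y - p|.
  by apply: filterS2 ZF near_F.
have /nbhs_ballP[rho /= rho0 rhoP] := near_p.
have [s [y [/andP[s0 sd] Zy ys]]] := tv e1 (rho / (`|v| + 1)) e10 (divr_gt0 rho0 v1).
have ypE : y - p = s *: v + (y - (p + s *: v)) by rewrite [RHS]addrC opprD addrA subrK.
have yp : `|y - p| <= s * (`|v| + 1).
  rewrite ypE (le_trans (ler_normD _ _)) // normrZ gtr0_norm // mulrDr lerD2l mulr1.
  by rewrite (le_trans ys) // ler_piMl ?(ltW s0) // ge_min lexx.
have [ZF0 Fy] : (Z y -> F y = 0) /\ `|F y - F p - 'd F p (y - p)| <= eta * `|y - p|.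
  apply: rhoP; rewrite -ball_normE /= distrC (le_lt_trans yp) //.
  by rewrite -ltr_pdivlMr.
rewrite ZF0 // Fp subr0 sub0r normrN in Fy.
rewrite -(ler_pM2l s0) -{1}(gtr0_norm s0) -normrZ.
have -> : s *: 'd F p v = 'd F p (y - p) - 'd F p (y - (p + s *: v)).
  by rewrite ypE linearD linearZ addrK.
rewrite (le_trans (ler_normB _ _)) // [e]splitr mulrDr lerD //.
  rewrite (le_trans Fy) // (le_trans (ler_wpM2l (ltW eta0) yp)) //.
  by rewrite mulrCA /eta divfK // gt_eqF.
rewrite (le_trans (kP _)) // (le_trans (ler_wpM2l (ltW k0) ys)) // mulrA mulrC.
rewrite ler_wpM2l ?(ltW s0) // (@le_trans _ _ (k * (e / 2 / k))) //.
  by rewrite ler_wpM2l ?(ltW k0) // ge_min lexx orbT.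
by rewrite mulrC divfK // gt_eqF.
Qed.

(* F changes sign between v + c u and v - c u, so it vanishes in between: this
   replaces the implicit function theorem. *)
Lemma zero_set_tangent (U : set V) (F : V -> R) p u v : open U -> U p ->
  (forall x, U x -> {for x, continuous F}) -> differentiable F p -> F p = 0 ->
  0 < 'D_u F p -> 'D_v F p = 0 -> tangent_to [set y | U y /\ F y = 0] p v.
Proof.
move=> oU Up Fc dF Fp Du Dv e d e0 d0.
have [rho rho0 Urho] : exists2 r, 0 < r & forall y, `|y - p| < r -> U y.
  have /nbhs_ballP[r /= r0 rU] := open_nbhs_nbhs (conj oU Up).
  by exists r => // y yp; apply: rU; rewrite -ball_normE /= distrC.
have u0 : 0 < `|u| by rewrite normr_gt0; apply: contraTneq Du => ->; rewrite derive0 ltxx.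
(* A zero at p + s (v + r u) with |r| <= c is off p + s v by at most s c |u| = e s. *)
pose c := e / `|u|.
have c0 : 0 < c by rewrite divr_gt0.
have Dp : 0 < 'D_(v + c *: u) F p.
  by rewrite deriveE // linearD linearZ /= -!deriveE // Dv add0r mulr_gt0.
have Dm : 0 < 'D_(- (v - c *: u)) F p.
  by rewrite deriveE // linearN linearB linearZ /= -!deriveE // Dv sub0r opprK mulr_gt0.
have [d1 d10 P1] := derive_gt_near dF Dp.
have [d2 d20 P2] := derive_gt_near dF Dm.
pose m := Num.min d (Num.min (Num.min d1 d2) (rho / (`|v| + c * `|u| + 1))).
have b0 : 0 < `|v| + c * `|u| + 1 by rewrite ltr_wpDl // addr_ge0 // mulr_ge0 // ltW.
have m0 : 0 < m by rewrite !lt_min d0 d10 d20 divr_gt0.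
pose s := m / 2; have s0 : 0 < s by rewrite divr_gt0.
have : s < m by rewrite /s ltr_pdivrMr // ltr_pMr // ltr1n.
rewrite !lt_min => /and3P[sd /andP[sd1 sd2] sr].
have Fs1 : 0 < F (p + s *: (v + c *: u)).
  have := P1 s; rewrite gt_eqF // gtr0_norm // sd1 => /(_ isT isT).
  by rewrite Fp subr0 pmulr_rgt0 // invr_gt0.
have Fs2 : F (p + s *: (v - c *: u)) < 0.
  have := P2 (- s); rewrite oppr_eq0 gt_eqF // normrN gtr0_norm // sd2 => /(_ isT isT).
  by rewrite Fp subr0 scaleNr scalerN opprK invrN mulNr oppr_gt0 pmulr_rlt0 // invr_gt0.
have inU r : - c <= r <= c -> U (p + s *: (v + r *: u)).
  move=> rc; apply: Urho; rewrite addrC addKr normrZ gtr0_norm //.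
  apply: (@le_lt_trans _ _ (s * (`|v| + c * `|u| + 1))); last by rewrite -ltr_pdivlMr.
  rewrite ler_wpM2l // ?(ltW s0) // (le_trans (ler_normD _ _)) // normrZ -addrA lerD2l.
  by rewrite ler_wpDr // ler_wpM2r // ler_norml.
have line_cont : continuous (fun r : R => p + s *: (v + r *: u)).
  move=> r; apply: cvgD; first exact: cvg_cst.
  apply: cvgZ; first exact: cvg_cst.
  by apply: cvgD; [exact: cvg_cst|apply: cvgZr_tmp; exact: cvg_id].
have Fline : {within `[- c, c], continuous (fun r : R => F (p + s *: (v + r *: u)))}.
  apply/continuous_in_subspaceT => r; rewrite inE /= in_itv /= => rc.
  apply: (@continuous_comp _ _ _ (fun r : R => p + s *: (v + r *: u)) F).
    exact: line_cont.
  by apply: Fc; exact: inU.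
have cc : - c <= c by rewrite (@le_trans _ _ 0) ?oppr_le0 ?ltW.
have [|] := IVT cc Fline (v := 0).
  by rewrite ge_min le_max scaleNr (ltW Fs2) (ltW Fs1) orbT.
move=> r; rewrite in_itv /= => rc Fr.
exists s, (p + s *: (v + r *: u)); split; first by rewrite s0.
  by split => //; exact: inU.
rewrite scalerDr addrA [X in `|X - _|]addrC addrK normrZ gtr0_norm // mulrC ler_wpM2r ?(ltW s0) //.
by rewrite normrZ -ler_pdivlMr // ler_norml.
Qed.
End Tangent.

(** * Transnormal functions in a chart *)

Lemma sym_row_entry {R : comNzRingType} {n : nat} (x : 'rV[R]_n) (S : 'M[R]_n) j :
  S^T = S -> (x *m S) 0 j = ((delta_mx 0 j : 'rV[R]_n) *m S *m x^T) 0 0.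
Proof.
move=> ST; rewrite -rowE !mxE; apply: eq_bigr => k _.
by rewrite !mxE -[in LHS]ST mxE mulrC.
Qed.

Section TransnormalChart.
Context {R : realType} {n : nat} (U : set 'rV[R]_n).
Hypothesis oU : open U.
Variable G : 'rV[R]_n -> 'M[R]_n.
Hypotheses (Gs : smooth_on U G) (GT : forall x, U x -> (G x)^T = G x).
Hypothesis Gpos : forall x, U x -> posdef (G x).
Variable h : 'rV[R]_n -> R.
Hypothesis hs : smooth_on U h.
Variables (W : set R) (b : R -> R).
Hypothesis bs : smooth_on W b.
Hypothesis hW : forall x, U x -> W (h x).
Local Notation X := (grad G h).
Local Notation M := (cov_mx G h).
Hypothesis transnormal_h : forall x, U x -> inner G x (X x) (X x) = b (h x).

Let Xs : smooth_on U X := smooth_grad oU Gs Gpos hs.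
Let Ms : smooth_on U M := smooth_cov_mx oU Gs Gpos hs.

(* By [grad_cov_mx], the eigenvalue of the Hessian of h in the direction of grad h. *)
Definition half_slope t := 2^-1 * 'D_1 b t.

Lemma differentiable_half_slope x : U x -> differentiable (fun y => half_slope (h y)) x.
Proof.
move=> Ux; apply: differentiableM; first exact: differentiable_cst.
apply: (@differentiable_comp _ _ _ _ h ('D_1 b)); first exact: (smooth_differentiable hs Ux).
exact: ((bs 2%N).2 1).1 (hW Ux).
Qed.

Lemma differentiable_profile x : U x -> differentiable b (h x).
Proof. by move=> Ux; apply: (bs 1%N).1; exact: hW. Qed.

Lemma grad_cov_mx x : U x -> X x *m M x = half_slope (h x) *: X x.
Proof.
move=> Ux; have Gu := metric_unit Gpos Ux.
suff E : X x *m M x *m G x = half_slope (h x) *: X x *m G x.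
  by rewrite -[LHS](mulmxK Gu) E mulmxK.
apply/rowP => j.
have D : 2 * inner G x (delta_mx 0 j *m M x) (X x) = 'D_1 b (h x) * 'D_(delta_mx 0 j) h x.
  rewrite -(derive_norm_grad oU Gs GT Gpos hs) // -derive_chain; last 2 first.
  - exact: (smooth_differentiable hs Ux).
  - exact: differentiable_profile.
  by apply: near_eq_derive; near=> y; apply: transnormal_h; near: y; exact: open_nbhs_nbhs.
(* Symmetry of the Hessian moves M from the coordinate vector to X. *)
have -> : (X x *m M x *m G x) 0 j = inner G x (delta_mx 0 j *m M x) (X x).
  rewrite /inner -mulmxA (sym_row_entry _ _ (hessian_sym oU Gs GT Gpos hs Ux)).
  by rewrite !mulmxA.
have -> : (half_slope (h x) *: X x *m G x) 0 j = half_slope (h x) * 'D_(delta_mx 0 j) h x.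
  rewrite -scalemxAl (grad_mul Gpos) // mx_entry_scale [X in _ * X]mxE.
  by [].
by apply: (mulfI (x := 2)); rewrite ?pnatr_eq0 // D /half_slope mulrA mulVKf ?pnatr_eq0.
Unshelve. all: by end_near. Qed.

Lemma derive_scale_vec (c : 'rV[R]_n -> R) (Y : 'rV[R]_n -> 'rV[R]_n) x v :
  differentiable c x -> differentiable Y x ->
  'D_v (fun y => c y *: Y y) x = 'D_v c x *: Y x + c x *: 'D_v Y x.
Proof.
move=> dc dY; have dcY : derivable (fun y => c y *: Y y) x v.
  apply/derivable_mxP => i j.
  rewrite (_ : (fun y => _) = (fun y => c y * Y y i j)); last by apply/funext => y; rewrite mxE.
  by apply: diff_derivable; apply: differentiableM => //; exact: differentiable_mxE.
rewrite derive_mx //; apply/matrixP => i j; rewrite [LHS]mxE.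
rewrite (_ : (fun y => _) = (fun y => c y * Y y i j)); last by apply/funext => y; rewrite mxE.
rewrite derive_mul //; last exact: differentiable_mxE.
by rewrite mx_entry_add !mx_entry_scale derive_mxE.
Qed.

Lemma derive_grad_cov_mx x v : U x -> 'D_v (fun y => X y *m M y) x =
  'D_v (fun y => half_slope (h y)) x *: X x + half_slope (h x) *: 'D_v X x.
Proof.
move=> Ux; rewrite -derive_scale_vec; last 2 first.
- exact: differentiable_half_slope.
- exact: (smooth_differentiable Xs Ux).
by apply: near_eq_derive; near=> y; apply: grad_cov_mx; near: y; exact: open_nbhs_nbhs.
Unshelve. all: by end_near. Qed.

Lemma cov_mx_critical x : U x -> X x = 0 -> M x *m M x = half_slope (h x) *: M x.
Proof.
move=> Ux X0; apply/row_matrixP => i; rewrite row_mul [in RHS]linearZ /=.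
have DX : row i (M x) = 'D_(delta_mx 0 i) X x by rewrite row_cov_mx X0 mul0mx addr0.
have := derive_grad_cov_mx (delta_mx 0 i) Ux.
by rewrite (derive_smooth_mulmx oU _ Xs Ms Ux) X0 mul0mx scaler0 addr0 add0r -DX.
Qed.

(** Since X M = mu X, the left side of Bochner's formula is div (mu X) = X(mu) + mu tr M; solve for
    X(tr M) - X(mu). *)
Lemma grad_shape_derivative x : U x ->
  'D_(X x) (fun y => laplacian G h y - half_slope (h y)) x =
  half_slope (h x) * laplacian G h x - \tr (M x *m M x) - (X x *m ricci G x *m (X x)^T) 0 0.
Proof.
move=> Ux; have lap_d : differentiable (laplacian G h) x.
  exact: (smooth_differentiable (laplacian_smooth oU Gs Gpos hs) Ux).
have mu_d := differentiable_half_slope Ux.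
have dXM : divergence G (fun y => X y *m M y) x =
    'D_(X x) (fun y => half_slope (h y)) x + half_slope (h x) * laplacian G h x.
  rewrite (divergence_smooth G (smooth_mulmx oU Xs Ms) Ux) (laplacianE oU Gs Gpos hs Ux).
  rewrite [in RHS]derive_partials // [in RHS]mulr_sumr -big_split /=.
  apply: eq_bigr => i _; rewrite /partial derive_grad_cov_mx // grad_cov_mx //.
  rewrite mx_entry_add !mx_entry_scale -scalemxAl mx_entry_scale cov_mxE mx_entry_add.
  by rewrite mulrDr addrA [_ * X x 0 i]mulrC.
have := bochner oU Gs GT Gpos hs Ux; rewrite dXM => E.
have -> : 'D_(X x) (fun y => laplacian G h y - half_slope (h y)) x =
    'D_(X x) (laplacian G h) x - 'D_(X x) (fun y => half_slope (h y)) x.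
  by apply: deriveB; exact: diff_derivable.
by move: E; move: ('D_(X x) (laplacian G h) x) (laplacian G h x) (\tr _) => A B C; lra.
Qed.

(** At a zero of tr M - mu the term mu tr M is mu^2, at most tr (M M) because mu is the eigenvalue
    of M on the unit vector X / sqrt b; the Ricci term makes the inequality strict. *)
Lemma grad_shape_derivative_lt0 x : U x -> 0 < b (h x) ->
  0 < (X x *m ricci G x *m (X x)^T) 0 0 -> laplacian G h x = half_slope (h x) ->
  'D_(X x) (fun y => laplacian G h y - half_slope (h y)) x < 0.
Proof.
move=> Ux b0 ric lapE; rewrite grad_shape_derivative // lapE.
suff : half_slope (h x) ^+ 2 <= \tr (M x *m M x) by rewrite expr2; lra.
pose u := (Num.sqrt (b (h x)))^-1 *: X x.
have bE := transnormal_h Ux; rewrite /inner in bE.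
apply: (@trace_sqr_ge _ _ (G x) (M x) u).
- exact: GT.
- exact: Gpos.
- rewrite /u ip_scalel ip_scaler bE mulrA -invfM -expr2 sqr_sqrtr ?ltW // mulVf //.
  by rewrite gt_eqF.
- exact: (hessian_sym oU Gs GT Gpos hs Ux).
- by rewrite /u -scalemxAl grad_cov_mx // !scalerA mulrC.
Qed.

End TransnormalChart.

(** * Focal points *)

Section RealLine.
Context {R : realType}.

Lemma derive_scale_dir (f : R -> R) x v : differentiable f x -> 'D_v f x = v * 'D_1 f x.
Proof.
move=> df; rewrite !deriveE // -[X in 'd f x X = _]mulr1.
exact: linearZ.
Qed.

(** The derivative vanishes at c and is differentiable there, so it is at most k |t - c| in size;
    the mean value theorem gains another factor |t - c|. *)
Lemma near_quadratic (W : set R) (f : R -> R) c : open W -> smooth_on W f -> W c ->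
  f c = 0 -> 'D_1 f c = 0 -> exists2 k, 0 < k & \forall t \near c, `|f t| <= k * (t - c) ^+ 2.
Proof.
move=> oW fs Wc f0 f'0.
have [k k0 kP] := near_diff_lipschitz (((fs 2%N).2 1).1 c Wc).
exists k => //.
have : \forall t \near c, W t /\ `|'D_1 f t - 'D_1 f c| <= k * `|t - c|.
  by apply: filterS2 kP (open_nbhs_nbhs (conj oW Wc)).
move=> /nbhs_ballP[rho /= rho0 rhoP]; apply/nbhs_ballP; exists rho => //= t tc.
rewrite -ball_normE /= distrC in tc.
have P r : 0 <= r <= 1 -> W (c + r *: (t - c)) /\
    `|'D_1 f (c + r *: (t - c))| <= k * `|t - c|.
  move=> /andP[r0 r1].
  have rt : `|c + r *: (t - c) - c| <= `|t - c|.
    by rewrite addrC addKr normrZ ger0_norm // ler_piMl.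
  have [|Wt] := rhoP (c + r *: (t - c)).
    by rewrite -ball_normE /= distrC (le_lt_trans rt).
  rewrite f'0 subr0 => /le_trans kt; split => //; apply: kt.
  by rewrite ler_wpM2l // ltW.
have [r r01|r r01] := MVT_line (f := f) (x := c) (v := t - c) ltr01.
  by apply: (fs 1%N).1; exact: (P r r01).1.
rewrite scale1r (addrC c) subrK f0 subr0 mul1r => ->.
rewrite derive_scale_dir; last by apply: (fs 1%N).1; exact: (P r r01).1.
rewrite normrM mulrC -real_normK ?num_real // expr2 mulrA ler_wpM2r //.
exact: (P r r01).2.
Qed.

End RealLine.

Section Estimates.
Context {R : realType} {n : nat} (U : set 'rV[R]_n).
Hypothesis oU : open U.
Variable G : 'rV[R]_n -> 'M[R]_n.
Hypotheses (Gs : smooth_on U G) (GT : forall x, U x -> (G x)^T = G x).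
Hypothesis Gpos : forall x, U x -> posdef (G x).
Variable h : 'rV[R]_n -> R.
Hypothesis hs : smooth_on U h.
Variables (W : set R) (b : R -> R).
Hypotheses (oW : open W) (bs : smooth_on W b).
Hypothesis hW : forall x, U x -> W (h x).
Local Notation X := (grad G h).
Hypothesis transnormal_h : forall x, U x -> inner G x (X x) (X x) = b (h x).

Lemma near_grad_le p : U p -> exists2 C, 0 < C &
  \forall y \near p, `|X y| ^+ 2 <= C * b (h y).
Proof.
move=> Up; pose iG x := invmx (G x); exists (`|iG p| + 1); first by rewrite ltr_wpDl.
have iGc : {for p, continuous iG} by exact: (smooth_invmx oU Gs Gpos 0).
have ncg := near_norm_le iGc.
near=> y; have Uy : U y by near: y; exact: open_nbhs_nbhs.
rewrite -transnormal_h // (le_trans (norm_le_ip _ (GT Uy) (Gpos Uy))) //.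
rewrite ler_wpM2r ?posdef_ge0 //; first exact: Gpos.
by near: y; exact: ncg.
Unshelve. all: by end_near. Qed.

Lemma near_derive_le p : U p -> exists2 C, 0 < C &
  \forall y \near p, forall w, ('D_w h y) ^+ 2 <= C * b (h y) * `|w| ^+ 2.
Proof.
move=> Up; exists (n%:R ^+ 2 * (`|G p| + 1) + 1).
  by rewrite ltr_wpDl // mulr_ge0 ?addr_ge0 // exprn_ge0.
have Gc : {for p, continuous G} by exact: (Gs 0).
have ncg := near_norm_le Gc.
near=> y => w; have Uy : U y by near: y; exact: open_nbhs_nbhs.
rewrite -(inner_grad Gpos hs _ Uy) -transnormal_h //.
rewrite (le_trans (cauchy_schwarz _ _ (GT Uy) (Gpos Uy))) // mulrAC mulrC.
rewrite ler_wpM2r ?posdef_ge0 //; first exact: Gpos.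
rewrite (le_trans (ip_norm_le _ _)) // ler_wpM2r ?exprn_ge0 // ler_wpDr //.
rewrite ler_wpM2l ?exprn_ge0 //.
by near: y; exact: ncg.
Unshelve. all: by end_near. Qed.

(* If m is the maximum of |h - h p| on a ball of radius r, then |dh| <= C m there,
   so m <= C r m by the mean value theorem. *)
Lemma level_flat p : U p -> b (h p) = 0 -> 'D_1 b (h p) = 0 -> \forall y \near p, h y = h p.
Proof.
move=> Up b0 b'0; set c := h p in b0 b'0 *.
have [k k0 kP] := near_quadratic oW bs (hW Up) b0 b'0.
have [C C0 CP] := near_derive_le Up.
have hc : {for p, continuous h} by exact: (hs 0%N).
have kPh : \forall y \near p, `|b (h y)| <= k * (h y - c) ^+ 2 by exact: (hc _ kP).
have : \forall y \near p, U y /\ forall w, ('D_w h y) ^+ 2 <= C * k * (h y - c) ^+ 2 * `|w| ^+ 2.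
  near=> y; split; first by near: y; exact: open_nbhs_nbhs.
  move=> w; rewrite (le_trans (near CP y _ _)) //.
  rewrite ler_wpM2r ?exprn_ge0 // -mulrA ler_wpM2l ?(ltW C0) // (le_trans (ler_norm _)) //.
  by near: y; exact: kPh.
move=> /nbhs_ballP[rho /= rho0 rhoP].
pose K := C * k; have K0 : 0 < K by rewrite mulr_gt0.
(* The bound 1 / (2 (K + 1)) gives K r^2 <= 1/4, hence m^2 <= m^2 / 4 for the maximum m, which
   forces m = 0. The bound rho / 2 puts the closed ball inside the open one. *)
pose r := Num.min (rho / 2) (2^-1 / (K + 1)).
have r0 : 0 < r by rewrite lt_min !divr_gt0 // addr_gt0.
have rrho : r < rho by rewrite gt_min ltr_pdivrMr // ltr_pMr // ltr1n.
have Kr : K * r ^+ 2 <= 4^-1.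
  have Kr2 : (K + 1) * r <= 2^-1.
    by rewrite mulrC -ler_pdivlMr ?addr_gt0 // ge_min lexx orbT.
  apply: (@le_trans _ _ (((K + 1) * r) ^+ 2)).
    rewrite exprMn ler_wpM2r ?exprn_ge0 ?(ltW r0) // expr2.
    by rewrite (@le_trans _ _ (K + 1)) ?lerDl // ler_peMl ?lerDr // ?addr_ge0 // ltW.
  have -> : 4^-1 = 2^-1 ^+ 2 :> R by field.
  by rewrite ler_pXn2r ?nnegrE ?mulr_ge0 ?addr_ge0 // ltW.
have Ball y : `|y - p| <= r -> U y /\ forall w, ('D_w h y) ^+ 2 <= K * (h y - c) ^+ 2 * `|w| ^+ 2.
  by move=> yp; apply: rhoP; rewrite -ball_normE /= distrC (le_lt_trans yp).
have [||y0] := @EVT_max_rV R n (fun y => `|h y - c|) [set y | `|y - p| <= r] _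
  (compact_closed_ball r0).
- by exists p; rewrite /= subrr normr0 ltW.
- apply/continuous_in_subspaceT => y; rewrite inE /= => yp.
  apply: (@continuous_comp _ _ _ (fun y => h y - c) (fun z => `|z|)); last exact: norm_continuous.
  apply: differentiable_continuous; apply: differentiableB => //.
  exact: (smooth_differentiable hs (Ball _ yp).1).
rewrite inE /= => y0p ymax.
have m0 : h y0 = c.
  have [r' r'01|r' r'01 E] := MVT_line (f := h) (x := p) (v := y0 - p) ltr01.
    apply: (smooth_differentiable hs); apply: (Ball _ _).1.
    rewrite addrC addKr normrZ; case/andP: r'01 => r'0 r'1; rewrite ger0_norm //.
    by rewrite (le_trans _ y0p) // ler_piMl.
  rewrite scale1r (addrC p) subrK mul1r in E.
  set z := p + r' *: (y0 - p) in E.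
  have zp : `|z - p| <= r.
    rewrite /z addrC addKr normrZ; case/andP: r'01 => r'0 r'1; rewrite ger0_norm //.
    by rewrite (le_trans _ y0p) // ler_piMl.
  have hz : (h z - c) ^+ 2 <= (h y0 - c) ^+ 2.
    rewrite -[leLHS]real_normK ?num_real // -[leRHS]real_normK ?num_real //.
    by rewrite ler_pXn2r ?nnegrE //; apply: ymax; rewrite inE.
  have := (Ball z zp).2 (y0 - p); rewrite -E -/c => H.
  apply/eqP; rewrite -subr_eq0 -sqrf_eq0 eq_le sqr_ge0 andbT.
  have H2 : (h y0 - c) ^+ 2 <= 4^-1 * (h y0 - c) ^+ 2.
    have Km : 0 <= K * (h y0 - c) ^+ 2 by rewrite mulr_ge0 ?sqr_ge0 ?(ltW K0).
    have H1 : K * (h z - c) ^+ 2 * `|y0 - p| ^+ 2 <= K * (h y0 - c) ^+ 2 * `|y0 - p| ^+ 2.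
      by rewrite ler_wpM2r ?exprn_ge0 // ler_wpM2l ?(ltW K0).
    have H3 : K * (h y0 - c) ^+ 2 * `|y0 - p| ^+ 2 <= K * (h y0 - c) ^+ 2 * r ^+ 2.
      by rewrite ler_wpM2l // ler_pXn2r ?nnegrE // ltW.
    rewrite (le_trans H) // (le_trans H1) // (le_trans H3) //.
    by rewrite mulrAC ler_wpM2r // sqr_ge0.
  by move: H2; move: (_ ^+ 2) => q; lra.
apply/nbhs_ballP; exists r => //= y; rewrite -ball_normE /= distrC => yp.
have := ymax y; rewrite inE /= (ltW yp) m0 subrr normr0 => /(_ isT).
by rewrite normr_le0 subr_eq0 => /eqP.
Unshelve. all: by end_near. Qed.
End Estimates.

Lemma sqrtr_lt {R : rcfType} (x t : R) : 0 < t -> x < t ^+ 2 -> Num.sqrt x < t.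
Proof.
by move=> t0 xt; rewrite -[ltRHS](gtr0_norm t0) -sqrtr_sqr ltr_sqrt ?exprn_gt0.
Qed.

Lemma continuous_penalized {R : realType} {V : normedModType R} (h : V -> R) (c k : R) (x y : V) :
  {for y, continuous h} ->
  {for y, continuous (fun z => Num.sqrt `|h z - c| + k * `|z - x|)}.
Proof.
move=> hy; apply: continuousD.
  apply: (@continuous_comp _ _ _ (fun z => `|h z - c|) Num.sqrt); last exact: sqrt_continuous.
  apply: (@continuous_comp _ _ _ (fun z => h z - c) (fun z => `|z|)); last exact: norm_continuous.
  by apply: continuousB => //; exact: cst_continuous.
apply: (@continuousM _ _ (fun=> k) (fun z => `|z - x|)); first exact: cst_continuous.
apply: (@continuous_comp _ _ _ (fun z : V => z - x) (fun z : V => `|z|)).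
  by apply: differentiable_continuous; exact: differentiableB.
exact: norm_continuous.
Qed.

(** * Distance to a focal level *)

Section ErrorBound.
Context {R : realType} {n : nat} (U : set 'rV[R]_n).
Hypothesis oU : open U.
Variable G : 'rV[R]_n -> 'M[R]_n.
Hypotheses (Gs : smooth_on U G) (GT : forall x, U x -> (G x)^T = G x).
Hypothesis Gpos : forall x, U x -> posdef (G x).
Variable h : 'rV[R]_n -> R.
Hypothesis hs : smooth_on U h.
Variables (W : set R) (b : R -> R).
Hypothesis bs : smooth_on W b.
Hypothesis hW : forall x, U x -> W (h x).
Local Notation X := (grad G h).
Hypothesis transnormal_h : forall x, U x -> inner G x (X x) (X x) = b (h x).

(* A point off the level h = c cannot minimize sqrt |h - c| + kappa |. - x|: moving
   along -+ grad h decreases sqrt |h - c| faster than the penalty can grow. *)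
Lemma steep_descent (c C l kappa : R) y (d : R) : U y -> h y != c -> 0 < d ->
  0 < C -> 0 < l -> 0 < kappa -> 4 * kappa ^+ 2 * C < l ->
  `|X y| ^+ 2 <= C * b (h y) -> l * `|h y - c| <= b (h y) ->
  exists z, `|z - y| < d /\ Num.sqrt `|h z - c| + kappa * `|z - y| < Num.sqrt `|h y - c|.
Proof.
move=> Uy hyc d0 C0 l0 k0 klC XC lb.
set q := `|h y - c| in lb *; set Q := Num.sqrt q.
have q0 : 0 < q by rewrite normr_gt0 subr_eq0.
have Q0 : 0 < Q by rewrite sqrtr_gt0.
have QQ : Q ^+ 2 = q by rewrite sqr_sqrtr // ltW.
pose sg := Num.sg (h y - c); pose w := - sg *: X y.
have sgq : sg * (h y - c) = q by rewrite /q normrEsg.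
have sg2 : sg * sg = 1.
  by rewrite -expr2 sqr_sg subr_eq0 hyc.
have b0 : 0 < b (h y) by rewrite (lt_le_trans _ lb) // mulr_gt0.
have wX : `|w| = `|X y|.
  by rewrite normrZ normrN normr_sg subr_eq0 hyc mul1r.
have Dw : 'D_w h y = - sg * b (h y).
  by rewrite -(inner_grad Gpos hs _ Uy) /inner ip_scaler -transnormal_h.
(* Along w the derivative of sqrt |h - c| is - b / (2 Q), while the penalty grows at rate at most
   kappa |w|. After squaring, the comparison is 4 kappa^2 C b q < l b q <= b^2. *)
have slope : 2 * kappa * `|w| * Q < b (h y).
  rewrite -(@ltr_pXn2r _ 2) ?nnegrE ?mulr_ge0 ?(ltW k0) ?(ltW Q0) ?(ltW b0) //.
  have -> : (2 * kappa * `|w| * Q) ^+ 2 = 4 * kappa ^+ 2 * `|X y| ^+ 2 * q.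
    by rewrite -QQ wX; ring.
  apply: (@le_lt_trans _ _ (4 * kappa ^+ 2 * C * b (h y) * q)).
    rewrite ler_wpM2r ?(ltW q0) // -(mulrA _ C) ler_wpM2l //.
    by rewrite mulr_ge0 // sqr_ge0.
  apply: (@lt_le_trans _ _ (l * b (h y) * q)).
    by rewrite !ltr_pM2r.
  by rewrite mulrAC expr2 ler_wpM2r // ltW.
have dh : differentiable h y by exact: (smooth_differentiable hs Uy).
have Dsg : 'D_w (fun z => - sg * h z) y = b (h y).
  transitivity (- sg * 'D_w h y); last by rewrite Dw mulrA mulrNN sg2 mul1r.
  by apply: (@deriveZ _ _ _ h); exact: diff_derivable.
have dsg : differentiable (fun z => - sg * h z) y.
  by apply: differentiableM => //; exact: differentiable_cst.
have slope' : 2 * kappa * `|w| * Q < 'D_w (fun z => - sg * h z) y by rewrite Dsg.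
have [d1 d10 P1] := derive_gt_near dsg slope'.
have /nbhs_ballP[d2 /= d20 P2] : \forall z \near y, `|h y - h z| < q.
  by move/differentiable_continuous/cvgrPdist_lt: dh; apply.
pose B := `|w| + 1; have B0 : 0 < B by rewrite ltr_wpDl.
pose m := Num.min (Num.min d1 (d2 / B)) (Num.min (d / B) (Q / (kappa * B))).
have kB0 : 0 < kappa * B by rewrite mulr_gt0.
have m0 : 0 < m by rewrite !lt_min d10 !divr_gt0.
pose s := m / 2; have s0 : 0 < s by rewrite divr_gt0.
have : s < m by rewrite /s ltr_pdivrMr // ltr_pMr // ltr1n.
rewrite !lt_min !ltr_pdivlMr // => /andP[/andP[sd1 sd2] /andP[sd sQ]].
have swB : s * `|w| <= s * B by rewrite ler_wpM2l ?(ltW s0) // lerDl.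
exists (y + s *: w).
have zy : `|y + s *: w - y| = s * `|w| by rewrite addrC addKr normrZ gtr0_norm.
rewrite zy; split; first exact: le_lt_trans sd.
set hz := h _.
have hzy : `|h y - hz| < q.
  by apply: P2; rewrite -ball_normE /= distrC zy (le_lt_trans swB).
have nsg : `|sg| = 1 by rewrite normr_sg subr_eq0 hyc.
have pos : 0 < sg * (hz - c).
  rewrite (_ : hz - c = (hz - h y) + (h y - c)); last by rewrite addrA subrK.
  rewrite mulrDr sgq -ltrBlDr sub0r.
  have : `|sg * (hz - h y)| < q by rewrite normrM nsg mul1r distrC.
  by rewrite ltr_norml => /andP[].
have -> : `|hz - c| = sg * (hz - c) by rewrite -[LHS]mul1r -nsg -normrM gtr0_norm.
(* With A = kappa s |w| the right side is at most (Q - A)^2, and A < Q; taking square roots, sqrt |h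
   z - c| + A < Q. *)
have lt1 : sg * (hz - c) < q - 2 * (kappa * (s * `|w|)) * Q.
  have := P1 s; rewrite gt_eqF // gtr0_norm // => /(_ isT sd1).
  rewrite ltr_pdivlMl // -sgq -/hz => H; rewrite -subr_gt0; rewrite -subr_gt0 in H.
  by apply: lt_le_trans H _; rewrite le_eqVlt; apply/orP; left; apply/eqP; ring.
have AQ : kappa * (s * `|w|) < Q.
  by rewrite (le_lt_trans _ sQ) // mulrCA ler_wpM2l ?(ltW s0) // ler_wpM2l ?(ltW k0) // lerDl.
move: lt1 AQ; move: (kappa * (s * _)) => A lt1 AQ.
rewrite -ltrBrDr; apply: sqrtr_lt; first by rewrite subr_gt0.
rewrite (lt_le_trans lt1) // -QQ -subr_ge0.
by rewrite (_ : _ - _ = A ^+ 2) ?sqr_ge0 //; ring.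
Qed.

(* Ekeland's principle: minimize sqrt |h y - h p| + kappa |y - x| over a compact
   ball; by [steep_descent] the minimizer lies on the level of p. *)
Lemma level_error_bound p : U p -> b (h p) = 0 -> 'D_1 b (h p) != 0 ->
  exists2 kappa, 0 < kappa & \forall x \near p,
    exists y, [/\ U y, h y = h p & kappa * `|y - x| <= Num.sqrt `|h x - h p|].
Proof.
move=> Up b0 b'0; set c := h p in b0 b'0 *.
have Wc : W c := hW Up.
have [C C0 CP] := near_grad_le oU Gs GT Gpos transnormal_h Up.
(* Half the slope of b at its zero c: near c, |b t| >= l |t - c|. *)
pose l := `|'D_1 b c| / 2; have l0 : 0 < l by rewrite divr_gt0 // normr_gt0.
have db : differentiable b c by exact: (bs 1%N).1.
have hc : {for p, continuous h} by exact: (hs 0%N).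
have bl : \forall t \near c, l * `|t - c| <= `|b t|.
  apply: filterS (near_diff_approx db l0) => t; rewrite b0 subr0.
  have -> : 'd b c (t - c) = (t - c) * 'D_1 b c.
    by rewrite -deriveE // derive_scale_dir.
  move=> H; have E : `|(t - c) * 'D_1 b c| = 2 * (l * `|t - c|).
    by rewrite normrM mulrC /l mulrA mulrCA mulfV ?mulr1 // pnatr_eq0.
  have := ler_normB (b t) (b t - (t - c) * 'D_1 b c).
  rewrite subKr E mulrDl mul1r => /le_trans/(_ (lerD (lexx _) H)).
  by rewrite lerD2r.
have blh : \forall y \near p, l * `|h y - c| <= `|b (h y)| by exact: (hc _ bl).
have : \forall y \near p, [/\ U y, `|X y| ^+ 2 <= C * b (h y) & l * `|h y - c| <= b (h y)].
  near=> y; have Uy : U y by near: y; exact: open_nbhs_nbhs.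
  split => //; first by near: y.
  rewrite -[leRHS]ger0_norm; first by near: y.
  by rewrite -transnormal_h //; exact: posdef_ge0 (Gpos Uy).
move=> /nbhs_ballP[rho /= rho0 rhoP].
(* With this value 4 kappa^2 C = l / 4, below the l that [steep_descent] allows. *)
pose kappa := Num.sqrt (l / C) / 4.
have k0 : 0 < kappa by rewrite divr_gt0 // sqrtr_gt0 divr_gt0.
have klC : 4 * kappa ^+ 2 * C < l.
  rewrite /kappa exprMn sqr_sqrtr ?divr_ge0 ?(ltW l0) ?(ltW C0) //.
  rewrite (_ : 4 * _ * C = l / 4); first by rewrite ltr_pdivrMr // ltr_pMr // ltr1n.
  by field; rewrite gt_eqF.
pose r := rho / 2; have r0 : 0 < r by rewrite divr_gt0.
have rrho : r < rho by rewrite ltr_pdivrMr // ltr_pMr // ltr1n.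
have Ball y : `|y - p| <= r ->
    [/\ U y, `|X y| ^+ 2 <= C * b (h y) & l * `|h y - c| <= b (h y)].
  by move=> yp; apply: rhoP; rewrite -ball_normE /= distrC (le_lt_trans yp).
exists kappa => //.
(* For x this close to p, the minimiser y satisfies kappa |y - x| <= sqrt |h x - c| < kappa r / 2;
   with |x - p| < r / 2 it is interior to the ball, so a small descent from y stays admissible. *)
have e0 : 0 < (kappa * (r / 2)) ^+ 2 by rewrite exprn_gt0 // mulr_gt0 // divr_gt0.
have near_h : \forall x \near p, `|h p - h x| < (kappa * (r / 2)) ^+ 2.
  by move/cvgrPdist_lt: hc; apply.
have near_r : \forall x \near p, `|x - p| < r / 2.
  apply/nbhs_ballP; exists (r / 2); first by rewrite /= divr_gt0.
  by move=> x; rewrite -ball_normE /= distrC.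
near=> x.
have xp : `|x - p| < r / 2 by near: x.
have hx : Num.sqrt `|h x - c| < kappa * (r / 2).
  apply: sqrtr_lt; first by rewrite mulr_gt0 // divr_gt0.
  by rewrite distrC; near: x.
pose psi y := Num.sqrt `|h y - c| + kappa * `|y - x|.
have [||y] := @EVT_min_rV R n psi [set y | `|y - p| <= r] _
  (compact_closed_ball r0).
- by exists p; rewrite /= subrr normr0 ltW.
- apply/continuous_in_subspaceT => y; rewrite inE /= => yp.
  apply: continuous_penalized; apply: differentiable_continuous.
  by have [Uy _ _] := Ball _ yp; exact: (smooth_differentiable hs Uy).
rewrite inE /= => yp ymin.
have psiy : psi y <= Num.sqrt `|h x - c|.
  have := ymin x; rewrite inE /= /psi subrr normr0 mulr0 addr0; apply.
  by rewrite (le_trans (ltW xp)) // ler_pdivrMr // ler_pMr // ler1n.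
have yx : kappa * `|y - x| <= Num.sqrt `|h x - c|.
  by rewrite (le_trans _ psiy) // lerDr sqrtr_ge0.
have [Uy XC lb] := Ball y yp.
exists y; split => //.
apply: contrapT => /eqP hyc.
have ypr : `|y - p| < r.
  rewrite (_ : y - p = (y - x) + (x - p)); last by rewrite addrA subrK.
  rewrite (le_lt_trans (ler_normD _ _)) // [r]splitr ltrD //.
  by rewrite -(ltr_pM2l k0) (le_lt_trans yx).
have rp0 : 0 < r - `|y - p| by rewrite subr_gt0.
have [z [zy zlt]] := steep_descent Uy hyc rp0 C0 l0 k0 klC XC lb.
have zp : `|z - p| <= r.
  rewrite (_ : z - p = (z - y) + (y - p)); last by rewrite addrA subrK.
  by rewrite (le_trans (ler_normD _ _)) // -lerBrDr ltW.
have := ymin z; rewrite inE => /(_ zp); rewrite leNgt => /negP; apply.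
rewrite /psi; apply: (@le_lt_trans _ _ (Num.sqrt `|h z - c| + kappa * `|z - y| + kappa * `|y - x|)).
  rewrite -addrA lerD2l -mulrDr ler_wpM2l ?(ltW k0) //.
  by rewrite (_ : z - x = (z - y) + (y - x)) ?ler_normD // addrA subrK.
by rewrite ltrD2r.
Unshelve. all: by end_near. Qed.
End ErrorBound.

(** ['D_v h] vanishes to first order along v, hence is o(s) at p + r v for r <= s; the mean value
    theorem adds a factor s. *)
Lemma second_order_flat {R : realType} {V : normedModType R} (U : set V) (h : V -> R) p v (e : R) :
  open U -> U p -> Ck_on 2 U h -> 'D_v h p = 0 -> 'D_v ('D_v h) p = 0 -> 0 < e ->
  exists2 d, 0 < d & forall s, 0 < s < d -> `|h (p + s *: v) - h p| <= e * s ^+ 2.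
Proof.
move=> oU Up [hd /(_ v) [hvd _]] D1 D2 e0.
have B0 : 0 < `|v| + 1 by rewrite ltr_wpDl.
have e'0 : 0 < e / (`|v| + 1) by rewrite divr_gt0.
have nearp : \forall y \near p, U y /\
    `|'D_v h y - 'D_v h p - 'd ('D_v h) p (y - p)| <= e / (`|v| + 1) * `|y - p|.
  by apply: filterS2 (open_nbhs_nbhs (conj oU Up)) (near_diff_approx (hvd p Up) e'0).
have /nbhs_ballP[rho /= rho0 rhoP] := nearp.
exists (rho / (`|v| + 1)); first exact: divr_gt0.
move=> s /andP[s0 sd]; rewrite ltr_pdivlMr // in sd.
have P r : 0 <= r <= s -> U (p + r *: v) /\ `|'D_v h (p + r *: v)| <= e * s.
  move=> /andP[r0 rs]; have E : p + r *: v - p = r *: v by rewrite addrC addKr.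
  have rB : r * `|v| <= s * (`|v| + 1).
    by rewrite (@le_trans _ _ (s * `|v|)) ?ler_wpM2r // ler_wpM2l ?(ltW s0) // lerDl.
  have [|Ur] := rhoP (p + r *: v).
    by rewrite -ball_normE /= distrC E normrZ ger0_norm // (le_lt_trans rB).
  rewrite E linearZ /= -deriveE; last exact: hvd.
  rewrite D1 D2 scaler0 !subr0 normrZ (ger0_norm r0) => H; split => //.
  rewrite (le_trans H) // -mulrA ler_wpM2l ?(ltW e0) // mulrC ler_pdivrMr //.
have [r rs|r rs ->] := MVT_line (f := h) (x := p) (v := v) s0; first exact: hd (P r rs).1.
rewrite normrM gtr0_norm // mulrC expr2 mulrA ler_wpM2r ?(ltW s0) //.
exact: (P r rs).2.
Qed.

Lemma sqrtr_le {R : rcfType} (x t : R) : 0 <= t -> x <= t ^+ 2 -> Num.sqrt x <= t.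
Proof. by move=> t0 xt; rewrite -[leRHS](ger0_norm t0) -sqrtr_sqr ler_wsqrtr. Qed.

Section FocalPoint.
Context {R : realType} {n : nat} (U : set 'rV[R]_n).
Hypothesis oU : open U.
Variable G : 'rV[R]_n -> 'M[R]_n.
Hypotheses (Gs : smooth_on U G) (GT : forall x, U x -> (G x)^T = G x).
Hypothesis Gpos : forall x, U x -> posdef (G x).
Variable h : 'rV[R]_n -> R.
Hypothesis hs : smooth_on U h.
Variables (W : set R) (b : R -> R).
Hypothesis bs : smooth_on W b.
Hypothesis hW : forall x, U x -> W (h x).
Local Notation X := (grad G h).
Local Notation M := (cov_mx G h).
Hypothesis transnormal_h : forall x, U x -> inner G x (X x) (X x) = b (h x).
Variable p : 'rV[R]_n.
Hypotheses (Up : U p) (b0 : b (h p) = 0) (b'0 : 'D_1 b (h p) != 0).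

Let Xs : smooth_on U X := smooth_grad oU Gs Gpos hs.

Lemma grad_critical : X p = 0.
Proof.
by apply: (posdef_eq0 (Gpos Up)); have := transnormal_h Up; rewrite b0.
Qed.

Lemma kernel_tangent v : v *m M p = 0 -> tangent_to [set y | U y /\ h y = h p] p v.
Proof.
move=> vM e d e0 d0.
have X0 := grad_critical.
have D1 : 'D_v h p = 0 by rewrite -(inner_grad Gpos hs) // /inner X0 !mul0mx mxE.
have DX : 'D_v X p = 0.
  rewrite derive_partials; last exact: (smooth_differentiable Xs Up).
  rewrite -[RHS]vM mulmx_sum_row; apply: eq_bigr => i _.
  by rewrite row_cov_mx X0 mul0mx addr0.
(* Near p, ['D_v h] is <X, v>, and every term of its derivative along v at p contains X p = 0 or D_v
   X = v M = 0. *)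
have D2 : 'D_v ('D_v h) p = 0.
  have Bs : smooth_on U (fun y => G y *m v^T).
    by apply: smooth_mulmx => // k; exact: Ck_on_cst.
  have XBs := smooth_mulmx oU Xs Bs.
  have -> : 'D_v ('D_v h) p = 'D_v (fun y => (X y *m (G y *m v^T)) 0 0) p.
    apply: near_eq_derive; near=> y; rewrite mulmxA -(inner_grad Gpos hs) //.
    by near: y; exact: open_nbhs_nbhs.
  rewrite -derive_mxE; last exact: (smooth_differentiable XBs Up).
  rewrite (derive_smooth_mulmx oU _ Xs Bs Up) DX X0 !mul0mx.
  by rewrite addr0 mxE.
have [kappa k0 near_k] := level_error_bound oU Gs GT Gpos hs bs hW transnormal_h Up b0 b'0.
(* The square root in the error bound turns (kappa e)^2 s^2 into kappa e s. *)
have e'0 : 0 < (kappa * e) ^+ 2 by rewrite exprn_gt0 // mulr_gt0.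
have [d1 d10 P1] := second_order_flat oU Up (hs 2%N) D1 D2 e'0.
have /nbhs_ballP[rho /= rho0 rhoP] := near_k.
have B0 : 0 < `|v| + 1 by rewrite ltr_wpDl.
pose m := Num.min d (Num.min d1 (rho / (`|v| + 1))).
have m0 : 0 < m by rewrite !lt_min d0 d10 divr_gt0.
pose s := m / 2; have s0 : 0 < s by rewrite divr_gt0.
have : s < m by rewrite /s ltr_pdivrMr // ltr_pMr // ltr1n.
rewrite !lt_min ltr_pdivlMr // => /and3P[sd sd1 sr].
have [|y [Uy hy ky]] := rhoP (p + s *: v).
  rewrite -ball_normE /= distrC addrC addKr normrZ gtr0_norm //.
  by rewrite (le_lt_trans _ sr) // ler_wpM2l ?(ltW s0) // lerDl.
exists s, y; split => //; first by rewrite s0.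
rewrite -(ler_pM2l k0) (le_trans ky) //.
have kes : 0 <= kappa * (e * s) by rewrite !mulr_ge0 // ltW.
apply: sqrtr_le => //.
have := P1 s; rewrite s0 sd1 => /(_ isT) /le_trans; apply.
by rewrite le_eqVlt; apply/orP; left; apply/eqP; ring.
Unshelve. all: by end_near. Qed.

(** Kernel vectors of M are tangent to the level of p, where F vanishes, so ker M lies in ker dF,
    which has dimension n - k. *)
Lemma rank_cov_mx_ge k (F : 'rV[R]_n -> 'rV[R]_k) : differentiable F p -> F p = 0 ->
  \rank ('J F p) = k -> (\forall y \near p, h y = h p -> F y = 0) -> (k <= \rank (M p))%N.
Proof.
move=> dF Fp rk ZF.
have : (kermx (M p) <= kermx ('J F p))%MS.
  apply/rV_subP => v /sub_kermxP vM; apply/sub_kermxP.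
  rewrite -deriveEjacobian //.
  apply: (tangent_derive0 dF Fp _ (kernel_tangent vM)).
  by apply: filterS ZF => y H [_ /H].
move=> /mxrankS; rewrite !mxrank_ker rk => H.
have := rank_leq_row ('J F p); rewrite rk => kn.
by have := rank_leq_row (M p); lia.
Qed.

Lemma focal_laplacian : laplacian G h p = half_slope b (h p) * (\rank (M p))%:R.
Proof.
rewrite (laplacianE oU Gs Gpos hs Up); apply: trace_scaled_idempotent.
  by rewrite mulf_neq0 // invr_eq0 pnatr_eq0.
exact: (cov_mx_critical oU Gs GT Gpos hs bs hW transnormal_h Up grad_critical).
Qed.

End FocalPoint.

(** * Mean curvature of level sets *)

Lemma delta_mul_entry {R : nzRingType} {m n : nat} (A : 'M[R]_(m, n)) i j :
  ((A i j *: (delta_mx 0 i : 'rV[R]_m)) *m A) 0 j = A i j ^+ 2.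
Proof. by rewrite -scalemxAl mxE -rowE mxE. Qed.

Section LevelSets.
Context {R : realType} {n : nat} (U : set 'rV[R]_n).
Hypothesis oU : open U.
Variable G : 'rV[R]_n -> 'M[R]_n.
Hypotheses (Gs : smooth_on U G) (GT : forall x, U x -> (G x)^T = G x).
Hypothesis Gpos : forall x, U x -> posdef (G x).
Variable h : 'rV[R]_n -> R.
Hypothesis hs : smooth_on U h.
Variables (W : set R) (b : R -> R).
Hypothesis bs : smooth_on W b.
Hypothesis hW : forall x, U x -> W (h x).
Local Notation X := (grad G h).
Local Notation M := (cov_mx G h).
Hypothesis transnormal_h : forall x, U x -> inner G x (X x) (X x) = b (h x).

Let Xs : smooth_on U X := smooth_grad oU Gs Gpos hs.

(** A covariant derivative along v sees only the value and the v-derivative of the field, so nu may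
    differ from k X away from x. *)
Lemma covd_proportional (nu : 'rV[R]_n -> 'rV[R]_n) (k : R) x v : U x ->
  nu x = k *: X x -> 'D_v nu x = k *: 'D_v X x -> covd G v nu x = k *: (v *m M x).
Proof.
move=> Ux nuX DnuX; rewrite -(covd_gradE oU Gs Gpos hs _ Ux) !covdE DnuX nuX scalerDr.
congr (_ + _); rewrite scaler_sumr; apply: eq_bigr => i _.
by rewrite -scalemxAl !scalerA mulrC.
Qed.

(** The normal direction contributes the eigenvalue mu to tr M. For a normal field equal to k X to
    first order along the level, - k times the remaining sum is the mean curvature. *)
Lemma trace_unit_normal x (u : 'rV[R]_n) (k : R) (e : 'I_n.-1 -> 'rV[R]_n) : U x ->
  u = k *: X x -> inner G x u u = 1 -> (forall i, inner G x u (e i) = 0) ->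
  (forall i j, inner G x (e i) (e j) = (i == j)%:R) ->
  laplacian G h x = half_slope b (h x) + \sum_i inner G x (e i *m M x) (e i).
Proof.
move=> Ux uX uu ue ee; rewrite (laplacianE oU Gs Gpos hs Ux).
rewrite (trace_orthonormal (M x) (GT Ux) uu ue ee); congr (_ + _).
rewrite uX -scalemxAl (grad_cov_mx oU Gs GT Gpos hs bs hW transnormal_h Ux).
by rewrite scalerA mulrC -scalerA -uX ip_scalel -/(inner G x u u) uu mulr1.
Qed.

Definition level_function (t : R) (x : 'rV[R]_n) : 'rV[R]_1 := const_mx (h x - t).

Lemma smooth_level_function t : smooth_on U (level_function t).
Proof.
move=> k; apply: Ck_on_mx => // i j.
apply: (@Ck_on_ext _ _ _ oU _ _ (fun x => h x - t)); first by move=> x _; rewrite mxE.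
by apply: Ck_onB => //; exact: Ck_on_cst.
Qed.

Lemma derive_level_function t x v : U x ->
  v *m 'J (level_function t) x = const_mx (inner G x (X x) v).
Proof.
move=> Ux; rewrite -deriveEjacobian; last first.
  exact: (smooth_differentiable (smooth_level_function t) Ux).
apply/matrixP => i j; rewrite derive_mxE; last first.
  exact: (smooth_differentiable (smooth_level_function t) Ux).
rewrite [RHS]mxE (inner_grad Gpos hs) //.
rewrite (_ : (fun y => _) = (fun y => h y - t)); last by apply/funext => y; rewrite mxE.
have dh : derivable h x v by apply: diff_derivable; exact: (smooth_differentiable hs Ux).
by rewrite [LHS](deriveB dh (derivable_cst _ _ _)) derive_cst subr0.
Qed.

Lemma rank_level_function t x : U x -> 0 < b (h x) -> \rank ('J (level_function t) x) = 1%N.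
Proof.
move=> Ux b0; apply/eqP; rewrite eqn_leq rank_leq_col lt0n mxrank_eq0.
apply: contraTneq b0 => J0.
have := derive_level_function t (X x) Ux; rewrite J0 mulmx0 transnormal_h // => /matrixP/(_ 0 0).
by rewrite !mxE => <-; rewrite ltxx.
Qed.

Lemma level_mean_curvature p : U p -> 0 < b (h p) ->
  laplacian G h p = half_slope b (h p) ->
  let nu x := (Num.sqrt (b (h p)))^-1 *: X x in
  exists e : 'I_n.-1 -> 'rV[R]_n,
  [/\ smooth_on U nu,
      forall x, U x -> h x = h p -> inner G x (nu x) (nu x) = 1 /\
        forall v, v *m 'J (level_function (h p)) x = 0 -> inner G x (nu x) v = 0,
      forall i, e i *m 'J (level_function (h p)) p = 0 /\
        forall j, inner G p (e i) (e j) = (i == j)%:R &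
      0 = \sum_i - inner G p (covd G (e i) nu p) (e i)].
Proof.
move=> Up b0 lapE nu; set r := (Num.sqrt _)^-1 in nu *.
have rb : r * (r * b (h p)) = 1.
  by rewrite mulrA -invfM -expr2 sqr_sqrtr ?ltW // mulVf // gt_eqF.
have r0 : r != 0 by apply: contra_eq_neq rb => ->; rewrite mul0r eq_sym oner_eq0.
have nu_unit x : U x -> h x = h p -> inner G x (nu x) (nu x) = 1.
  move=> Ux hx; rewrite /inner /nu ip_scalel ip_scaler.
  by rewrite -/(inner G x (X x) (X x)) transnormal_h // hx.
have nu_normal x v : inner G x (nu x) v = r * inner G x (X x) v.
  by rewrite /inner /nu ip_scalel.
have [e eP] := orthonormal_basis_exists (GT Up) (Gpos Up) (nu_unit p Up erefl).
have ue i : inner G p (nu p) (e i) = 0 by exact: (eP i).1.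
have ee i j : inner G p (e i) (e j) = (i == j)%:R by exact: (eP i).2.
have nus : smooth_on U nu.
  move=> k; apply: Ck_on_mx => // i j.
  apply: (@Ck_on_ext _ _ _ oU _ _ (fun x => r * X x i j)).
    by move=> x _; rewrite mx_entry_scale.
  by apply: Ck_onM => //; [exact: Ck_on_cst|apply: Ck_on_mxE => //; exact: Xs].
exists e; split => //.
- move=> x Ux hx; split; first exact: nu_unit.
  move=> v; rewrite derive_level_function // nu_normal => /matrixP/(_ 0 0).
  by rewrite !mxE => ->; rewrite mulr0.
- move=> i; split; last exact: ee.
  rewrite derive_level_function //; apply/matrixP => j l; rewrite !mxE.
  by have := ue i; rewrite nu_normal => /eqP; rewrite mulf_eq0 (negbTE r0) => /eqP.
- have Dnu v : 'D_v nu p = r *: 'D_v X p.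
    by apply: deriveZ; apply: diff_derivable; exact: (smooth_differentiable Xs Up).
  have := trace_unit_normal Up erefl (nu_unit p Up erefl) ue ee.
  rewrite lapE -[LHS]addr0 => /addrI E.
  rewrite (eq_bigr (fun i => - r * inner G p (e i *m M p) (e i))) => [|i _].
    by rewrite -mulr_sumr -E mulr0.
  by rewrite (covd_proportional Up erefl (Dnu _)) /inner ip_scalel mulNr.
Qed.

(** * Mean curvature from an arbitrary equation and normal field *)

Section Uniqueness.
Variables (V : set 'rV[R]_n) (t : R) (F : 'rV[R]_n -> 'rV[R]_1) (nu : 'rV[R]_n -> 'rV[R]_n).
Hypotheses (oV : open V) (VU : V `<=` U) (Fs : smooth_on V F) (nus : smooth_on V nu).
Hypothesis F_level : forall x, V x -> \rank ('J F x) = 1%N /\ (h x = t <-> F x = 0).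
Hypothesis nu_normal : forall x, V x -> F x = 0 -> inner G x (nu x) (nu x) = 1 /\
  forall v, v *m 'J F x = 0 -> inner G x (nu x) v = 0.
Hypothesis bt : 0 < b t.

Let F0 x := F x 0 0.

Let F0d x : V x -> differentiable F0 x.
Proof. by move=> Vx; apply: differentiable_mxE; exact: (smooth_differentiable Fs Vx). Qed.

Let DF0 x v : V x -> 'D_v F0 x = (v *m 'J F x) 0 0.
Proof.
by move=> Vx; rewrite -deriveEjacobian ?derive_mxE //; exact: (smooth_differentiable Fs Vx).
Qed.

Let F0_eq0 x : F x = 0 <-> F0 x = 0.
Proof.
split => [F1|F1]; first by rewrite /F0 F1 mxE.
by apply/matrixP => i j; rewrite !ord1 [RHS]mxE.
Qed.

Lemma kernel_tangent_zero_set x v : V x -> F x = 0 -> v *m 'J F x = 0 ->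
  tangent_to [set y | V y /\ F0 y = 0] x v.
Proof.
move=> Vx Fx vJ.
have [u Du] : exists u, 0 < 'D_u F0 x.
  have /matrix0Pn[i [j Jij]] : 'J F x != 0.
    by rewrite -mxrank_eq0 (F_level Vx).1.
  rewrite (ord1 j) in Jij.
  (* Weighting the coordinate vector by the nonzero partial derivative makes the derivative along it
     a positive square. *)
  exists ('J F x i 0 *: delta_mx 0 i); rewrite DF0 // delta_mul_entry.
  by rewrite lt_neqAle sqr_ge0 andbT eq_sym sqrf_eq0.
apply: (zero_set_tangent oV Vx _ (F0d Vx) _ Du).
- by move=> y Vy; apply: differentiable_continuous; exact: F0d.
- exact/F0_eq0.
- by rewrite DF0 // vJ mxE.
Qed.

Lemma derive_along_zero_set (Y : normedModType R) (D : 'rV[R]_n -> Y) x v :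
  V x -> F x = 0 -> v *m 'J F x = 0 -> differentiable D x ->
  (\forall y \near x, V y -> F y = 0 -> D y = 0) -> 'D_v D x = 0.
Proof.
move=> Vx Fx vJ dD near_D; have Dx : D x = 0 by exact: (nbhs_singleton near_D).
apply: (tangent_derive0 dD Dx _ (kernel_tangent_zero_set Vx Fx vJ)).
by apply: filterS near_D => y H [Vy /F0_eq0]; exact: H.
Qed.

(** The function h - t vanishes on the zero set of F, so its derivative along tangent vectors is
    0. *)
Lemma grad_normal x v : V x -> F x = 0 -> v *m 'J F x = 0 -> inner G x (X x) v = 0.
Proof.
move=> Vx Fx vJ; have Ux := VU Vx; rewrite (inner_grad Gpos hs) //.
have dh : differentiable h x by exact: (smooth_differentiable hs Ux).
have -> : 'D_v h x = 'D_v (fun y => h y - t) x.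
  rewrite [RHS](deriveB (diff_derivable dh) (derivable_cst _ _ _)).
  by rewrite derive_cst subr0.
apply: derive_along_zero_set => //; first exact: differentiableB.
by near=> y => Vy /(F_level Vy).2 ->; rewrite subrr.
Unshelve. all: by end_near. Qed.

(* dF(X) nu - dF(nu) X is tangent to the level and normal to it. *)
Lemma normal_proportional x : V x -> F x = 0 ->
  nu x = (inner G x (nu x) (X x) / b t) *: X x /\ inner G x (nu x) (X x) ^+ 2 = b t.
Proof.
move=> Vx Fx; have Ux := VU Vx; have hx : h x = t by exact/(F_level Vx).2.
have XX : inner G x (X x) (X x) = b t by rewrite transnormal_h // hx.
have [nn nker] := nu_normal Vx Fx.
pose dX := (X x *m 'J F x) 0 0; pose dn := (nu x *m 'J F x) 0 0.
have w0 : dX *: nu x + - dn *: X x = 0.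
  set w := _ + _.
  have wJ : w *m 'J F x = 0.
    apply/matrixP => i j; rewrite !ord1 mulmxDl -!scalemxAl mx_entry_add !mx_entry_scale [RHS]mxE.
    by rewrite -/dX -/dn mulNr mulrC subrr.
  apply: (posdef_eq0 (Gpos Ux)); rewrite {1}/w ip_linearl ip_scalel.
  rewrite -/(inner G x (nu x) w) -/(inner G x (X x) w).
  by rewrite (nker _ wJ) (grad_normal Vx Fx wJ) !mulr0 addr0.
have dX0 : dX != 0.
  apply: contraTneq bt => dX0; rewrite -XX grad_normal ?ltxx //.
  by apply/matrixP => i j; rewrite !ord1 [RHS]mxE.
have nuX : nu x = (dn / dX) *: X x.
  apply: (scalerI dX0); rewrite scalerA mulrCA mulfV // mulr1.
  by apply/eqP; rewrite -subr_eq0 -scaleNr w0.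
have iE : inner G x (nu x) (X x) = dn / dX * b t by rewrite nuX /inner ip_scalel -XX.
rewrite iE mulfK ?gt_eqF //; split => //.
have : inner G x (nu x) (nu x) = (dn / dX) * (dn / dX * b t).
  by rewrite nuX /inner ip_scalel ip_scaler -/(inner G x (X x) (X x)) XX.
rewrite nn => E; transitivity (dn / dX * (dn / dX * b t) * b t); first by ring.
by rewrite -E mul1r.
Qed.

(** Along the level nu = (sigma / b t) X with sigma^2 = b t. By continuity sigma keeps its sign near
    p, so nu - k X vanishes on the level near p and nu has the same tangential derivatives as k X;
    its second fundamental form is - k times the Hessian on the tangent space. *)
Lemma minimal_laplacian p (e : 'I_n.-1 -> 'rV[R]_n) : V p -> F p = 0 ->
  (forall i, e i *m 'J F p = 0 /\ forall j, inner G p (e i) (e j) = (i == j)%:R) ->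
  0 = \sum_i - inner G p (covd G (e i) nu p) (e i) ->
  laplacian G h p = half_slope b (h p).
Proof.
move=> Vp Fp eP sum0; have Up := VU Vp.
have [nuE sE] := normal_proportional Vp Fp.
pose sigma x := inner G x (nu x) (X x).
have bt0 : b t != 0 by rewrite gt_eqF.
set k := _ / b t in nuE.
have k0 : k != 0.
  rewrite mulf_neq0 ?invr_eq0 //; apply: contra_eq_neq sE => ->.
  by rewrite expr0n eq_sym.
have nud x : V x -> differentiable nu x by move=> Vx; exact: (smooth_differentiable nus Vx).
have sc : {for p, continuous sigma}.
  apply: differentiable_continuous; apply: differentiable_mxE.
  have XsV : smooth_on V X by move=> j; exact: Ck_on_sub VU (Xs j).
  have GsV : smooth_on V G by move=> j; exact: Ck_on_sub VU (Gs j).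
  have XTs : smooth_on V (fun y => (X y)^T).
    move=> d; apply: Ck_on_mx => // i j.
    by apply: Ck_on_ext (Ck_on_mxE oV j i (XsV d)) => // y _; rewrite mx_entry_tr.
  exact: (smooth_differentiable (smooth_mulmx oV (smooth_mulmx oV nus GsV) XTs) Vp).
(* Values with the same square are equal or opposite; opposite ones lie 2 |sigma p| apart, beyond
   the margin |sigma p| granted by continuity. *)
have near_sigma : \forall x \near p, V x -> F x = 0 -> sigma x = sigma p.
  have s0 : 0 < `|sigma p| by rewrite normr_gt0 -sqrf_eq0 sE.
  move/cvgrPdist_lt: sc => /(_ _ s0); apply: filterS => x sx Vx Fx.
  have [_ sxE] := normal_proportional Vx Fx.
  apply/eqP; have : (sigma x == sigma p) || (sigma x == - sigma p).
    by rewrite -eqf_sqr /sigma sxE sE.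
  case/orP => // /eqP sN; move: sx; rewrite sN opprK -mulr2n normrMn.
  by rewrite ltNge => /negP; case; rewrite mulr2n lerDl.
have Dnu i : 'D_(e i) nu p = k *: 'D_(e i) X p.
  have dX : differentiable X p by exact: (smooth_differentiable Xs Up).
  have dkX : differentiable (fun x => k *: X x) p by exact: differentiableZ.
  pose D := (fun x => nu x - k *: X x).
  have dD : differentiable D p by exact: (differentiableB (nud _ Vp) dkX).
  have nearD : \forall x \near p, V x -> F x = 0 -> D x = 0.
    apply: filterS near_sigma => x sx Vx Fx.
    have [nuxE _] := normal_proportional Vx Fx.
    by rewrite /D nuxE -/(sigma x) sx // subrr.
  have D0 := derive_along_zero_set Vp Fp (eP i).1 dD nearD.
  have DD : 'D_(e i) D p = 'D_(e i) nu p - 'D_(e i) (fun x => k *: X x) p.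
    exact: (deriveB (diff_derivable (nud _ Vp)) (diff_derivable dkX)).
  have DZ : 'D_(e i) (fun x => k *: X x) p = k *: 'D_(e i) X p.
    exact: (deriveZ _ (diff_derivable dX)).
  by apply/eqP; rewrite -subr_eq0 -DZ -DD D0.
have [nn nker] := nu_normal Vp Fp.
have ue i : inner G p (nu p) (e i) = 0 by apply: nker; exact: (eP i).1.
rewrite (trace_unit_normal Up nuE nn ue (fun i => (eP i).2)) -[RHS]addr0; congr (_ + _).
apply: (mulfI k0); rewrite mulr0 mulr_sumr.
rewrite -[RHS]oppr0 [X in - X]sum0 -sumrN; apply: eq_bigr => i _.
by rewrite (covd_proportional Up nuE (Dnu _)) /inner ip_scalel opprK.
Qed.

End Uniqueness.
End LevelSets.

(** * Level values *)

Lemma Ck_on_local {R : realType} {V W : normedModType R} k (U : set V) (f : V -> W) :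
  (forall x, U x -> exists2 U', open U' & U' x /\ Ck_on k U' f) -> Ck_on k U f.
Proof.
elim: k f => [|k IH] f H /=.
  by move=> x Ux; have [U' oU' [U'x fc]] := H x Ux; exact: fc.
split=> [x Ux|v]; first by have [U' oU' [U'x [fd _]]] := H x Ux; exact: fd.
by apply: IH => x Ux; have [U' oU' [U'x [_ fk]]] := H x Ux; exists U' => //; split=> //; exact: fk.
Qed.

Section RealLemmas.
Context {R : realType}.

Lemma within_continuous_at (A B : set R) (a : R -> R) x : open B -> B x -> B `<=` A ->
  {within A, continuous a} -> {for x, continuous a}.
Proof.
move=> oB Bx BA ac.
have : {within B, continuous a} by exact: continuous_subspaceW ac.
by rewrite continuous_open_subspace // => /(_ x (mem_set Bx)).
Qed.

Definition crosses_down (phi : R -> R) t := exists2 d, 0 < d &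
  forall t', t' != t -> `|t' - t| < d -> (t' - t) * phi t' < 0.

(** Just after t1 phi is negative. Let c be the first later point where phi >= 0. Whether phi c > 0,
    by continuity, or phi c = 0, by the downward crossing at c, phi is positive just before c,
    against the choice of c. *)
Lemma zero_crossing_unique (phi : R -> R) (I : set R) t1 t2 :
  (forall t, t1 <= t <= t2 -> I t) ->
  (forall t, I t -> {for t, continuous phi}) ->
  (forall t, I t -> phi t = 0 -> crosses_down phi t) ->
  phi t1 = 0 -> phi t2 = 0 -> ~ t1 < t2.
Proof.
move=> It phic cross p1 p2 t12.
have I1 : I t1 by apply: It; rewrite lexx ltW.
have I2 : I t2 by apply: It; rewrite lexx ltW.
have [d1 d10 c1] := cross t1 I1 p1.
pose e := Num.min d1 (t2 - t1); pose u := t1 + e / 2.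
have e0 : 0 < e by rewrite lt_min d10 subr_gt0.
have eh : e / 2 < e by rewrite ltr_pdivrMr // ltr_pMr // ltr1n.
have [ed et] : e / 2 < d1 /\ e / 2 < t2 - t1.
  by split; apply: (lt_le_trans eh); rewrite ge_min lexx ?orbT.
have eh0 : 0 < e / 2 by rewrite divr_gt0.
have t1u : t1 < u by rewrite ltrDl.
have ut2 : u < t2 by rewrite -ltrBrDl.
have phiu : phi u < 0.
  have := c1 u; rewrite gt_eqF // (_ : u - t1 = e / 2); last by rewrite /u addrC addKr.
  by rewrite gtr0_norm // => /(_ isT ed); rewrite pmulr_rlt0.
pose E := [set x | u <= x <= t2 /\ 0 <= phi x].
have hE : has_inf E.
  split; first by exists t2; split; rewrite ?p2 // lexx ltW.
  by exists u => x [/andP[]].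
pose c := inf E.
have uc : u <= c by apply: lb_le_inf; [exact: hE.1|move=> x [/andP[]]].
have ct2 : c <= t2 by apply: ge_inf; [exact: hE.2|split; rewrite ?p2 // lexx ltW].
have Ic : I c by apply: It; rewrite ct2 (le_trans (ltW t1u)).
have left_neg x : u <= x -> x < c -> phi x < 0.
  move=> ux xc; rewrite ltNge; apply/negP => px.
  move: (xc); rewrite ltNge => /negP; apply; apply: ge_inf; first exact: hE.2.
  by split => //; rewrite ux /= (le_trans (ltW xc)).
have phic_ge0 : 0 <= phi c.
  rewrite leNgt; apply/negP => pc.
  have e1 : 0 < - phi c by rewrite oppr_gt0.
  have /cvgrPdist_lt/(_ _ e1) := phic c Ic.
  move=> /nbhs_ballP[r /= r0 rP].
  have [x Ex xr] := inf_adherent r0 hE.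
  have cx : c <= x by apply: ge_inf => //; exact: hE.2.
  have := rP x; rewrite -ball_normE /= distrC ger0_norm ?subr_ge0 // ltrBlDl => /(_ xr).
  rewrite ltr_distlC => /andP[_]; rewrite subrr => px.
  by have := Ex.2; rewrite leNgt px.
have lt_uc : u < c by rewrite lt_neqAle uc andbT; apply: contraTneq phic_ge0 => <-; rewrite -ltNge.
have [r r0 rP] : exists2 r, 0 < r & forall x, x < c -> `|x - c| < r -> 0 < phi x.
  move: phic_ge0; rewrite le_eqVlt => /orP[/eqP/esym pc|pc].
    have [d d0 dP] := cross c Ic pc; exists d => // x xc xd.
    have := dP x; rewrite lt_eqF // => /(_ isT xd).
    by rewrite nmulr_rlt0 // subr_lt0.
  have /cvgrPdist_lt/(_ _ pc)/nbhs_ballP[r /= r0 rP] := phic c Ic.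
  exists r => // x xc xr; have := rP x; rewrite -ball_normE /= distrC => /(_ xr).
  by rewrite ltr_distlC subrr => /andP[].
pose x := Num.max u (c - r / 2).
have r20 : 0 < r / 2 by rewrite divr_gt0.
have xc : x < c by rewrite gt_max lt_uc /= gtrBl.
have xr : `|x - c| < r.
  rewrite distrC gtr0_norm ?subr_gt0 // ltrBlDl -ltrBlDr lt_max; apply/orP; right.
  by rewrite ltrD2l ltrN2 ltr_pdivrMr // ltr_pMr // ltr1n.
have := rP x xc xr; rewrite ltNge => /negP; apply; apply: ltW; apply: left_neg => //.
by rewrite le_max lexx.
Qed.
End RealLemmas.

(** By the intermediate value theorem every t' near h x is h (x + s w) with s small. There t' - h x
    has the sign of s and Psi = phi t' the opposite sign. *)
Lemma crosses_down_along {R : realType} {V : normedModType R} (U : set V) (h Psi : V -> R)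
    (phi : R -> R) x w : open U -> U x ->
  (forall y, U y -> {for y, continuous h}) -> differentiable h x -> differentiable Psi x ->
  (forall y, U y -> Psi y = phi (h y)) -> Psi x = 0 ->
  0 < 'D_w h x -> 'D_w Psi x < 0 -> crosses_down phi (h x).
Proof.
move=> oU Ux hc dh dPsi PsiE Psi0 Dh DPsi.
have [d1 d10 P1] := derive_gt_near dh Dh.
have dN : differentiable (- Psi) x by exact: differentiableN.
have DN : 0 < 'D_w (- Psi) x by rewrite deriveN ?oppr_gt0 //; exact: diff_derivable.
have [d2 d20 P2] := derive_gt_near dN DN.
have /nbhs_ballP[rho /= rho0 rhoU] := open_nbhs_nbhs (conj oU Ux).
have B0 : 0 < `|w| + 1 by rewrite ltr_wpDl.
pose m := Num.min (Num.min d1 d2) (rho / (`|w| + 1)).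
have m0 : 0 < m by rewrite !lt_min d10 d20 divr_gt0.
pose s0 := m / 2; have s00 : 0 < s0 by rewrite divr_gt0.
have : s0 < m by rewrite /s0 ltr_pdivrMr // ltr_pMr // ltr1n.
rewrite !lt_min ltr_pdivlMr // => /andP[/andP[s1 s2] sr].
have inU s : - s0 <= s <= s0 -> U (x + s *: w).
  move=> ss; apply: rhoU; rewrite -ball_normE /= distrC addrC addKr normrZ.
  rewrite (le_lt_trans _ sr) // ler_pM // ?ler_norml // lerDl //.
have hi : h x < h (x + s0 *: w).
  have := P1 s0; rewrite gt_eqF // gtr0_norm // => /(_ isT s1).
  by rewrite pmulr_rgt0 ?invr_gt0 // subr_gt0.
have lo : h (x + - s0 *: w) < h x.
  have := P1 (- s0); rewrite oppr_eq0 gt_eqF // normrN gtr0_norm // => /(_ isT s1).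
  by rewrite nmulr_rgt0 ?invr_lt0 ?oppr_lt0 // subr_lt0.
have line_cont : continuous (fun r : R => x + r *: w).
  move=> r; apply: cvgD; first exact: cvg_cst.
  by apply: cvgZr_tmp; exact: cvg_id.
have hline : {within `[- s0, s0], continuous (fun r : R => h (x + r *: w))}.
  apply/continuous_in_subspaceT => r; rewrite inE /= in_itv /= => rc.
  apply: (@continuous_comp _ _ _ (fun r : R => x + r *: w) h); first exact: line_cont.
  by apply: hc; exact: inU.
have ss : - s0 <= s0 by rewrite (@le_trans _ _ 0) ?oppr_le0 ?ltW.
exists (Num.min (h x - h (x + - s0 *: w)) (h (x + s0 *: w) - h x)).
  by rewrite lt_min !subr_gt0 hi lo.
move=> t' t'x; rewrite lt_min => /andP[tlo thi].
have t'lo : h (x + - s0 *: w) < t'.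
  by move: tlo; rewrite ltr_distl opprB addrC subrK => /andP[].
have t'hi : t' < h (x + s0 *: w).
  by move: thi; rewrite ltr_distl => /andP[_]; rewrite addrC subrK.
have [|s] := IVT ss hline (v := t').
  by rewrite ge_min le_max (ltW t'lo) (ltW t'hi) orbT.
rewrite in_itv /= => sint hs.
have sn0 : s != 0 by apply: contra_neq t'x => s0'; rewrite -hs s0' scale0r addr0.
have sabs : `|s| <= s0 by rewrite ler_norml.
have := P1 s sn0 (le_lt_trans sabs s1); have := P2 s sn0 (le_lt_trans sabs s2).
rewrite hs !fctE PsiE ?hs; last exact: inU.
rewrite Psi0 oppr0 subr0 mulrN oppr_gt0 => A B.
have := nmulr_llt0 (s^-1 * (t' - h x)) A; rewrite B => C.
rewrite -(pmulr_rlt0 _ (_ : 0 < s^-1 ^+ 2)); last by rewrite exprn_even_gt0 //= invr_eq0.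
by rewrite (_ : _ * _ = s^-1 * (t' - h x) * (s^-1 * phi t')) //; ring.
Qed.

(** * From charts to the manifold *)

Section Global.
Context {R : realType} {n : nat} {T : topologicalType}.
Variables (N : riemannian_manifold R n T) (f : T -> R).
Hypothesis N_connected : connected [set: T].
Hypothesis fs : smooth_function N f.
Variable b : R -> R.
Hypothesis fb : forall c x, atlas N c -> chart_img c x ->
  let fc := f \o chart_inv c in let nabla := grad (metric N c) fc x in
  inner (metric N c) x nabla nabla = b (fc x).

Lemma chart_img_mem (c : chart R n T) p : chart_dom c p -> chart_img c (chart_map c p).
Proof. by exists p. Qed.

Lemma chart_posdef c x : atlas N c -> chart_img c x -> posdef (metric N c x).
Proof. by move=> ac xc v v0; exact: metric_posdef. Qed.

(** The part of the chart where f takes values in J. With J the domain of a smooth extension of b,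
    it is the set U to which the lemmas in coordinates apply. *)
Definition chart_over (c : chart R n T) (J : set R) : set 'rV[R]_n :=
  chart_img c `&` (f \o chart_inv c) @^-1` J.

Lemma chart_over_open c J : atlas N c -> open J -> open (chart_over c J).
Proof.
move=> ac oJ; rewrite openE => x [xc xJ]; apply: filterI.
  by apply: open_nbhs_nbhs; split => //; exact: chart_img_open.
have fc : {for x, continuous (f \o chart_inv c)} by exact: (fs ac 0%N).
by apply: fc; exact: open_nbhs_nbhs.
Qed.

Lemma smooth_chart_over (W : normedModType R) c J (g : 'rV[R]_n -> W) :
  smooth_on (chart_img c) g -> smooth_on (chart_over c J) g.
Proof. by move=> gs k; apply: Ck_on_sub (gs k) => x []. Qed.

Lemma chart_over_mem c J p : chart_dom c p -> J (f p) -> chart_over c J (chart_map c p).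
Proof. by move=> pc Jp; split; [exact: chart_img_mem|rewrite /= chart_mapK]. Qed.

Lemma f_continuous : continuous f.
Proof.
move=> p; have [c ac pc] := atlas_cover N p.
have : {for p, continuous ((f \o chart_inv c) \o chart_map c)}.
  apply: continuous_comp; first exact: chart_map_continuous.
  by apply: (fs ac 0%N); exact: chart_img_mem.
rewrite /prop_for /continuous_at /= chart_mapK // => H.
apply: cvg_trans H; apply: near_eq_cvg.
apply: filterS (open_nbhs_nbhs (conj (chart_dom_open c) pc)) => q qc.
by rewrite /= chart_mapK.
Qed.

Lemma range_interval s t u : range f s -> range f u -> s <= t <= u -> range f t.
Proof.
move=> fs' fu stu.
have : connected (range f).
  apply: connected_continuous_connected => //.
  exact: continuous_subspaceT f_continuous.
by move=> /connected_intervalP H; exact: H stu.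
Qed.

Lemma profile_ge0 t : range f t -> 0 <= b t.
Proof.
move=> [p _ <-]; have [c ac pc] := atlas_cover N p.
have xc := chart_img_mem pc; rewrite -(chart_mapK pc).
rewrite -[f _]/((f \o chart_inv c) (chart_map c p)) -(fb ac xc).
exact: posdef_ge0 (chart_posdef ac xc).
Qed.

(* g is a smooth extension of b near t, needed at the ends of the range of f. *)
Definition profile_near (t : R) (W : set R) (g : R -> R) :=
  [/\ open W, W t, smooth_on W g & forall r, W r -> range f r -> b r = g r].

Lemma profile_transnormal c x t W g : profile_near t W g -> atlas N c -> chart_over c W x ->
  inner (metric N c) x (grad (metric N c) (f \o chart_inv c) x)
    (grad (metric N c) (f \o chart_inv c) x) = g ((f \o chart_inv c) x).
Proof.
move=> [_ _ _ bg] ac [xc xW]; rewrite (fb ac xc); exact: bg.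
Qed.

Lemma chart_over_data c J : atlas N c -> open J ->
  let U := chart_over c J in
  [/\ open U, smooth_on U (metric N c), forall x, U x -> (metric N c x)^T = metric N c x,
      forall x, U x -> posdef (metric N c x) & smooth_on U (f \o chart_inv c)].
Proof.
move=> ac oJ; split.
- exact: chart_over_open.
- by apply: smooth_chart_over; exact: metric_smooth.
- by move=> x [xc _]; exact: (Defs.metric_sym ac xc).
- by move=> x [xc _]; exact: (chart_posdef ac xc).
- by apply: smooth_chart_over; exact: fs.
Qed.

Lemma slope_neq0 t W g : (exists p q, f p != f q) -> range f t -> profile_near t W g ->
  b t = 0 -> 'D_1 g t != 0.
Proof.
move=> [p0 [q0 pq]] ft pr bt0; apply/negP => /eqP g'0.
have [oW Wt gs bg] := pr.
have gt0 : g t = 0 by rewrite -bg.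
pose A := f @^-1` [set t].
have oA : open A.
  rewrite openE => p fp; have [c ac pc] := atlas_cover N p.
  have [oU Gs GT Gpos hs] := chart_over_data ac oW.
  have Up : chart_over c W (chart_map c p) by apply: chart_over_mem => //; rewrite fp.
  have hp : (f \o chart_inv c) (chart_map c p) = t by rewrite /= chart_mapK.
  have tn x (Ux : chart_over c W x) := profile_transnormal pr ac Ux.
  have hW x : chart_over c W x -> W ((f \o chart_inv c) x) by case.
  have g1 : g ((f \o chart_inv c) (chart_map c p)) = 0 by rewrite hp.
  have g2 : 'D_1 g ((f \o chart_inv c) (chart_map c p)) = 0 by rewrite hp.
  have flat := level_flat oU Gs GT Gpos hs oW gs hW tn Up g1 g2.
  have fflat : \forall q \near p, (f \o chart_inv c) (chart_map c q) = t.
    by have := chart_map_continuous pc flat; rewrite hp.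
  have pdom := open_nbhs_nbhs (conj (chart_dom_open c) pc).
  suff : nbhs p A by [].
  near=> q; have qc : chart_dom c q by near: q.
  by rewrite /A /= -[in LHS](chart_mapK qc); near: q.
have cA : closed A.
  have /continuous_closedP := f_continuous; apply.
  exact: closed_eq.
have AT : A = [set: T].
  have [p _ fp] := ft.
  by apply: N_connected; [exists p|exists A; rewrite ?setTI|exists A; rewrite ?setTI].
have Ap : A p0 by rewrite AT.
have Aq : A q0 by rewrite AT.
by move: pq; rewrite Ap Aq eqxx.
Unshelve. all: by end_near. Qed.
End Global.

(** * Zeros of the shape defect *)

Section Isoparametric.
Context {R : realType} {n : nat} {T : topologicalType}.
Variables (N : riemannian_manifold R n T) (f : T -> R).
Hypothesis N_connected : connected [set: T].
Hypothesis N_ricci : positive_ricci N.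
Hypothesis nonconst : exists p q, f p != f q.
Hypothesis fs : smooth_function N f.
Variable b : R -> R.
Hypothesis bs : smooth_within (range f) b.
Hypothesis fb : forall c x, atlas N c -> chart_img c x ->
  let fc := f \o chart_inv c in let nabla := grad (metric N c) fc x in
  inner (metric N c) x nabla nabla = b (fc x).
Variable a : R -> R.
Hypothesis ac : {within range f, continuous a}.
Hypothesis fa : forall c x, atlas N c -> chart_img c x ->
  let fc := f \o chart_inv c in laplacian (metric N c) fc x = a (fc x).
Hypothesis codim_max : components_codim_ge2 N (focal_max f).
Hypothesis codim_min : components_codim_ge2 N (focal_min f).

Local Notation profile_near := (profile_near f b).
Local Notation chart_over := (chart_over f).

Variables (pmin pmax : T).
Hypotheses (minP : forall q, f pmin <= f q) (maxP : forall q, f q <= f pmax).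
Local Notation alpha := (f pmin).
Local Notation beta := (f pmax).

Definition inner_values : set R := [set t | alpha < t < beta].
Local Notation I := inner_values.

Lemma inner_values_open : open I.
Proof.
have -> : I = `]alpha, beta[%classic by apply/seteqP; split => t; rewrite /= in_itv.
exact: interval_open.
Qed.

Lemma inner_values_range : I `<=` range f.
Proof.
move=> t /andP[ta tb]; apply: (range_interval N_connected fs (s := alpha) (u := beta)).
- by exists pmin.
- by exists pmax.
- by rewrite !ltW.
Qed.

Lemma extremal_lt : alpha < beta.
Proof.
rewrite lt_neqAle minP andbT; apply/eqP => E; have [p [q]] := nonconst.
suff C r : f r = alpha by rewrite !C eqxx.
by apply/eqP; rewrite eq_le minP {1}E maxP.
Qed.

Lemma profile_exists t : range f t -> exists W g, profile_near t W g.
Proof. by move=> ft; have [W [g [oW Wt gs bg]]] := bs ft; exists W, g. Qed.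

Lemma derive_extremal c x v : atlas N c -> chart_img c x ->
  (forall q, f q <= (f \o chart_inv c) x) \/ (forall q, (f \o chart_inv c) x <= f q) ->
  'D_v (f \o chart_inv c) x = 0.
Proof.
move=> atc xc ext; set h := f \o chart_inv c in ext *.
have oU : open (chart_img c) by exact: chart_img_open.
have /nbhs_ballP[rho /= rho0 rhoU] := open_nbhs_nbhs (conj oU xc).
have B0 : 0 < `|v| + 1 by rewrite ltr_wpDl.
pose d := rho / (`|v| + 1); have d0 : 0 < d by rewrite divr_gt0.
have inU s : s \in `]- d, d[%R -> chart_img c (x + s *: v).
  rewrite in_itv /= -ltr_norml => sd; apply: rhoU.
  rewrite -ball_normE /= distrC addrC addKr normrZ.
  rewrite ltr_pdivlMr // in sd; rewrite (le_lt_trans _ sd) // ler_wpM2l // lerDl //.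
have dd s : s \in `]- d, d[%R -> is_derive s 1 (fun s : R => h (x + s *: v)) ('D_v h (x + s *: v)).
  move=> sd; apply: is_derive_line; exact: (smooth_differentiable (fs atc) (inU s sd)).
have z0 : 0 \in `]- d, d[%R by rewrite in_itv /= oppr_lt0 d0.
have ddv s : s \in `]- d, d[%R -> derivable (fun s : R => h (x + s *: v)) s 1.
  by move=> sd; exact: (@ex_derive _ _ _ _ _ _ _ (dd s sd)).
have dle : - d <= d by rewrite (@le_trans _ _ 0) ?oppr_le0 ?ltW.
have D0 : is_derive (0 : R) 1 (fun s : R => h (x + s *: v)) 0.
  case: ext => ext.
    by apply: (derive1_at_max dle ddv z0) => s _; rewrite /= scale0r addr0; exact: ext.
  by apply: (derive1_at_min dle ddv z0) => s _; rewrite /= scale0r addr0; exact: ext.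
have := @derive_val _ _ _ _ _ _ _ (dd 0 z0).
by rewrite (@derive_val _ _ _ _ _ _ _ D0) scale0r addr0.
Qed.

Lemma profile_extremal p : focal_max f p \/ focal_min f p -> b (f p) = 0.
Proof.
move=> ext; have [c atc pc] := atlas_cover N p.
have xc := chart_img_mem pc.
have hp : (f \o chart_inv c) (chart_map c p) = f p by rewrite /= chart_mapK.
rewrite -hp -(fb atc xc) (inner_grad (U := chart_img c)) //.
- by apply: derive_extremal => //; rewrite hp.
- by move=> x Ux; exact: (chart_posdef atc Ux).
- exact: fs.
Qed.

(** As b >= 0 on the range of f, an interior zero would be a minimum, with zero slope, which
    [slope_neq0] excludes. *)
Lemma profile_pos t : I t -> 0 < b t.
Proof.
move=> It; have ft := inner_values_range It.
rewrite lt_neqAle (profile_ge0 fb ft) andbT; apply/eqP => /esym bt0.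
have [W [g pr]] := profile_exists ft; have [oW Wt gs bg] := pr.
have := slope_neq0 N_connected fs fb nonconst ft pr bt0.
have oWI : open (W `&` I) by apply: openI => //; exact: inner_values_open.
have /nbhs_ballP[d /= d0 dP] := open_nbhs_nbhs (conj oWI (conj Wt It)).
have inWI s : s \in `](t - d), (t + d)[%R -> W s /\ I s.
  by rewrite in_itv /= -ltr_distl => sd; apply: dP; rewrite -ball_normE /= distrC.
have dd s : s \in `](t - d), (t + d)[%R -> derivable g s 1.
  by move=> /inWI[Ws _]; apply: diff_derivable; exact: (gs 1%N).1.
have tt : t \in `](t - d), (t + d)[%R by rewrite in_itv /= ltrDl gtrBl d0.
have tle : t - d <= t + d by rewrite lerD2l (@le_trans _ _ 0) ?oppr_le0 ?ltW.
have D0 : is_derive t 1 g 0.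
  apply: (derive1_at_min tle dd tt) => s /inWI[Ws Is].
  rewrite -!bg //; last exact: inner_values_range.
  by rewrite bt0 (profile_ge0 fb) //; exact: inner_values_range.
by rewrite (@derive_val _ _ _ _ _ _ _ D0) eqxx.
Qed.

Lemma profile_smooth : smooth_on I b.
Proof.
move=> k; apply: Ck_on_local => t It.
have [W [g [oW Wt gs bg]]] := profile_exists (inner_values_range It).
have oWI : open (W `&` I) by apply: openI => //; exact: inner_values_open.
exists (W `&` I) => //; split => //.
apply: (@Ck_on_ext _ _ _ oWI _ _ g).
  by move=> s [Ws Is]; rewrite bg //; exact: inner_values_range.
by apply: Ck_on_sub (gs k) => s [].
Qed.

Lemma profile_near_inner t : I t -> profile_near t I b.
Proof. by move=> It; split=> //; [exact: inner_values_open|exact: profile_smooth]. Qed.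

(* Up to the factor - 1 / sqrt (b t), the mean curvature of the level t. *)
Definition shape_defect t := a t - half_slope b t.

Lemma shape_defect_continuous t : I t -> {for t, continuous shape_defect}.
Proof.
move=> It; apply: continuousB.
  exact: (within_continuous_at inner_values_open It inner_values_range ac).
apply: continuousM; first exact: cst_continuous.
exact: (profile_smooth 1%N).2.
Qed.

(** From any point of the level, moving along X raises f at rate b > 0 and lowers the defect by
    Bochner's formula. *)
Lemma shape_defect_crosses_down t : I t -> shape_defect t = 0 -> crosses_down shape_defect t.
Proof.
move=> It phi0; have [p _ fp] := inner_values_range It.
have [c atc pc] := atlas_cover N p; pose x := chart_map c p.
have pr := profile_near_inner It; have [oI _ Is _] := pr.
have [oU Gs GT Gpos hs] := chart_over_data fs atc oI.
set h := f \o chart_inv c in hs.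
have Ux : chart_over c I x by apply: chart_over_mem => //; rewrite fp.
have hx : h x = t by rewrite /h /= chart_mapK.
have tn y (Uy : chart_over c I y) := profile_transnormal fb pr atc Uy.
have hI y : chart_over c I y -> I (h y) by case.
have bt : 0 < b (h x) by rewrite hx; exact: profile_pos.
pose X := grad (metric N c) h.
pose Psi y := laplacian (metric N c) h y - half_slope b (h y).
have PsiE y : chart_over c I y -> Psi y = shape_defect (h y).
  by move=> [yc _]; rewrite /Psi fa.
have X0 : X x != 0.
  apply: contraTneq bt => X0; rewrite -(tn x Ux) -/h -/X X0.
  by rewrite /inner !mul0mx mxE ltxx.
rewrite -hx; apply: (crosses_down_along (U := chart_over c I) (Psi := Psi) (w := X x)) => //.
- by move=> y Uy; exact: (hs 0%N).
- exact: (smooth_differentiable hs Ux).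
- apply: differentiableB.
    exact: (smooth_differentiable (laplacian_smooth oU Gs Gpos hs) Ux).
  exact: (differentiable_half_slope hs Is hI Ux).
- by rewrite PsiE // hx.
- by rewrite -(inner_grad Gpos hs) // tn.
- apply: (grad_shape_derivative_lt0 oU Gs GT Gpos hs Is hI tn Ux bt).
    by apply: N_ricci => //; case: Ux.
  by apply/eqP; rewrite -subr_eq0 -/(Psi x) PsiE // hx phi0.
Qed.

(** The factor b' = 2 mu treats maximum and minimum at once: the product is (rank M - 1) b'^2 / 2.
    The slope is that of an extension g, as f p is an end of the range. *)
Lemma extremal_shape p : focal_max f p \/ focal_min f p ->
  exists W g, profile_near (f p) W g /\ 0 < (a (f p) - half_slope g (f p)) * 'D_1 g (f p).
Proof.
move=> ext; have ft : range f (f p) by exists p.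
have [W [g pr]] := profile_exists ft; have [oW Wt gs bg] := pr.
exists W, g; split => //.
have bt0 := profile_extremal ext.
have gt0 : g (f p) = 0 by rewrite -bg.
have g'0 := slope_neq0 N_connected fs fb nonconst ft pr bt0.
have [k k2 [c [V [F leq]]]] : exists2 k, (2 <= k)%N &
    exists c V (F : 'rV[R]_n -> 'rV[R]_k), local_equation N (f @^-1` [set f p]) p c V F.
  (* The level of an extremal value is the whole focal variety, so the codimension hypothesis yields
     an equation of this level at p. *)
  have [S [SE Sp Scodim]] : exists S, [/\ S = f @^-1` [set f p], S p & components_codim_ge2 N S].
    case: ext => ext; [exists (focal_max f)|exists (focal_min f)]; split => //;
      apply/seteqP; split => q /= H.
    - by apply/eqP; rewrite eq_le H ext.
    - by rewrite /focal_max /= H.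
    - by apply/eqP; rewrite eq_le H ext.
    - by rewrite /focal_min /= H.
  have [k k2 kP] := Scodim p Sp; exists k => //.
  have [c [V [F leq]]] := kP p (connected_component_refl Sp).
  by exists c, V, F; rewrite -SE.
case: leq => atc pc [oV Vimg Vx] Fs FP.
have [oU Gs GT Gpos hs] := chart_over_data fs atc oW.
set h := f \o chart_inv c in hs; set x := chart_map c p in Vx.
have Ux : chart_over c W x by exact: chart_over_mem.
have hx : h x = f p by rewrite /h /= chart_mapK.
have tn y (Uy : chart_over c W y) := profile_transnormal fb pr atc Uy.
have hW y : chart_over c W y -> W (h y) by case.
have g0 : g (h x) = 0 by rewrite hx.
have g1 : 'D_1 g (h x) != 0 by rewrite hx.
have Fx : F x = 0 by apply/(FP x Vx).2; rewrite /= chart_mapK.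
have near_F : \forall y \near x, h y = h x -> F y = 0.
  near=> y => hy; have Vy : V y by near: y; exact: open_nbhs_nbhs.
  by apply/(FP y Vy).2; rewrite /= -hx -hy.
have dF : differentiable F x by exact: (smooth_differentiable Fs Vx).
have rk := rank_cov_mx_ge oU Gs GT Gpos hs gs hW tn Ux g0 g1 dF Fx (FP x Vx).1 near_F.
have := focal_laplacian oU Gs GT Gpos hs gs hW tn Ux g0 g1.
rewrite fa //; last by case: Ux.
rewrite -/h hx => ->; set r := \rank _ in rk *.
have r1 : 0 < r%:R - 1 :> R by rewrite subr_gt0 ltr1n (leq_trans k2).
have -> : (half_slope g (f p) * r%:R - half_slope g (f p)) * 'D_1 g (f p) =
   2^-1 * (r%:R - 1) * 'D_1 g (f p) ^+ 2 by rewrite /half_slope; ring.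
rewrite mulr_gt0 //; first by rewrite mulr_gt0 // invr_gt0.
by rewrite exprn_even_gt0 //=.
Unshelve. all: by end_near. Qed.

(** By continuity within the range, the defect keeps the sign of D near f p, and t - f p has that
    sign too, because b increases from 0 when moving into the range. *)
Lemma shape_defect_near_extremal p : focal_max f p \/ focal_min f p ->
  exists2 d, 0 < d & forall t, I t -> `|t - f p| < d -> 0 < shape_defect t * (t - f p).
Proof.
move=> ext; have [W [g [pr pos]]] := extremal_shape ext.
have [oW Wt gs bg] := pr.
have ft : range f (f p) by exists p.
set D := 'D_1 g (f p) in pos *.
pose psi t := (a t - half_slope g t) * D.
have ac_p : a t @[t --> within (range f) (nbhs (f p))] --> a (f p).
  by rewrite (nbhs_subspace_in ft); exact: ac.
have hsc : half_slope g t @[t --> within (range f) (nbhs (f p))] --> half_slope g (f p).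
  apply: cvg_within_filter; apply: cvgM; first exact: cvg_cst.
  exact: ((gs 1%N).2 1 _ Wt).
have psic : psi t @[t --> within (range f) (nbhs (f p))] --> psi (f p).
  by apply: cvgM; [apply: cvgB|exact: cvg_cst].
have /cvgrPdist_lt/(_ _ pos) := psic.
rewrite near_withinE => near_psi.
have : \forall t \near f p, W t /\ (range f t -> `|psi (f p) - psi t| < psi (f p)).
  near=> t; split; first by near: t; exact: open_nbhs_nbhs.
  by near: t.
move=> /nbhs_ballP[d /= d0 dP].
(* The difference quotient of g at f p has the sign of D nearby; as g is 0 at f p and positive at
   inner values, t - f p has this sign too. *)
have [d1 d10 d1P] : exists2 d1, 0 < d1 &
    forall t, I t -> W t -> `|t - f p| < d1 -> 0 < D * (t - f p).
  have dg : differentiable g (f p) by exact: (gs 1%N).1.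
  have gp : g (f p) = 0 by rewrite -bg // profile_extremal.
  have gpos t : I t -> W t -> 0 < g t.
    by move=> It Wt'; rewrite -bg //; [exact: profile_pos|exact: inner_values_range].
  have tE t : f p + (t - f p) *: 1 = t by rewrite [_ *: _]mulr1 addrC subrK.
  have D0 : D != 0 by apply: contraTneq pos => ->; rewrite mulr0 ltxx.
  have I_ne t : I t -> t - f p != 0.
    rewrite subr_eq0 => It; apply: contraTneq (profile_pos It) => ->.
    by rewrite profile_extremal // ltxx.
  case: (ltgtP 0 D) D0 => // Dsg _.
    have [d1 d10 d1P] := derive_gt_near dg Dsg; exists d1 => // t It Wt' td.
    have := d1P _ (I_ne t It) td; rewrite tE gp subr0 pmulr_lgt0 ?gpos // invr_gt0 => ts.
    exact: mulr_gt0.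
  have dN : differentiable (- g) (f p) by exact: differentiableN.
  have DN : 0 < 'D_1 (- g) (f p) by rewrite deriveN ?oppr_gt0 //; exact: diff_derivable.
  have [d1 d10 d1P] := derive_gt_near dN DN; exists d1 => // t It Wt' td.
  have := d1P _ (I_ne t It) td; rewrite tE !fctE gp oppr0 subr0 nmulr_lgt0 ?oppr_lt0 ?gpos //.
  by rewrite invr_lt0 => ts; rewrite nmulr_rgt0.
exists (Num.min d d1); first by rewrite lt_min d0.
move=> t It; rewrite lt_min => /andP[td td1].
have [|Wt'] := dP t; first by rewrite -ball_normE /= distrC.
move=> /(_ (inner_values_range It)); rewrite ltr_distlC subrr => /andP[psi0 _].
(* Around an inner t in W, b and g agree on a neighbourhood, hence so do their derivatives. *)
have phiE : shape_defect t = a t - half_slope g t.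
  congr (_ - _ * _); apply: near_eq_derive; near=> s; apply: bg.
    by near: s; exact: open_nbhs_nbhs.
  by apply: inner_values_range; near: s; apply: open_nbhs_nbhs; split; [exact: inner_values_open|].
have phiD : 0 < shape_defect t * D by rewrite phiE.
have Dt := d1P t It Wt' td1.
have := mulr_gt0 phiD Dt.
have -> : shape_defect t * D * (D * (t - f p)) = shape_defect t * (t - f p) * D ^+ 2 by ring.
rewrite pmulr_lgt0 // exprn_even_gt0 //=.
by apply: contraTneq pos => ->; rewrite mulr0 ltxx.
Unshelve. all: by end_near. Qed.

Lemma shape_defect_neg_near_max : exists2 t, I t & shape_defect t < 0.
Proof.
have ext : focal_max f pmax \/ focal_min f pmax by left.
have [d d0 dP] := shape_defect_near_extremal ext.
(* The midpoint keeps t above alpha, and beta - d / 2 keeps it within d of beta. *)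
pose t := Num.max ((alpha + beta) / 2) (beta - d / 2).
have d20 : 0 < d / 2 by rewrite divr_gt0.
have tb : t < beta by rewrite gt_max (midf_lt extremal_lt).2 gtrBl.
have It : I t by rewrite /I /= tb lt_max (midf_lt extremal_lt).1.
exists t => //; have := dP t It.
rewrite distrC gtr0_norm ?subr_gt0 // ltrBlDl -ltrBlDr lt_max.
rewrite (_ : beta - d < beta - d / 2); last first.
  by rewrite ltrD2l ltrN2 ltr_pdivrMr // ltr_pMr // ltr1n.
by rewrite orbT => /(_ isT); rewrite nmulr_lgt0 // subr_lt0.
Qed.

Lemma shape_defect_pos_near_min : exists2 t, I t & 0 < shape_defect t.
Proof.
have ext : focal_max f pmin \/ focal_min f pmin by right.
have [d d0 dP] := shape_defect_near_extremal ext.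
pose t := Num.min ((alpha + beta) / 2) (alpha + d / 2).
have d20 : 0 < d / 2 by rewrite divr_gt0.
have ta : alpha < t by rewrite lt_min (midf_lt extremal_lt).1 ltrDl.
have It : I t by rewrite /I /= ta gt_min (midf_lt extremal_lt).2.
exists t => //; have := dP t It.
rewrite gtr0_norm ?subr_gt0 // ltrBlDl gt_min.
rewrite (_ : alpha + d / 2 < alpha + d); last first.
  by rewrite ltrD2l ltr_pdivrMr // ltr_pMr // ltr1n.
by rewrite orbT => /(_ isT); rewrite pmulr_lgt0 // subr_gt0.
Qed.

Lemma shape_defect_zero : exists2 t, I t & shape_defect t = 0.
Proof.
have [u Iu u0] := shape_defect_neg_near_max.
have [v Iv v0] := shape_defect_pos_near_min.
have sub s t : I s -> I t -> forall r, r \in `[s, t]%R -> I r.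
  move=> /andP[as_ _] /andP[_ tb] r; rewrite in_itv /= => /andP[sr rt].
  by apply/andP; split; [exact: lt_le_trans sr|exact: le_lt_trans tb].
have cont s t : I s -> I t -> {within `[s, t], continuous shape_defect}.
  move=> Is It; apply/continuous_in_subspaceT => r; rewrite inE => rst.
  by apply: shape_defect_continuous; exact: (sub s t).
have [uv|vu] := leP u v.
  have [|r rst r0] := IVT uv (cont u v Iu Iv) (v := 0).
    by rewrite ge_min le_max (ltW u0) (ltW v0) orbT.
  by exists r => //; exact: (sub u v).
have [|r rst r0] := IVT (ltW vu) (cont v u Iv Iu) (v := 0).
  by rewrite ge_min le_max (ltW u0) (ltW v0) orbT.
by exists r => //; exact: (sub v u).
Qed.

Lemma regular_value_inner t : I t -> regular_value N f t.
Proof.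
move=> It p c fp atc pc; apply/negP => /eqP X0.
have xc := chart_img_mem pc; have := fb atc xc.
rewrite /= X0 /inner !mul0mx mxE chart_mapK // fp => b0.
by have := profile_pos It; rewrite -b0 ltxx.
Qed.

Lemma minimal_of_shape_defect0 t : I t -> shape_defect t = 0 ->
  minimal_hypersurface N (f @^-1` [set t]).
Proof.
move=> It phi0 p fp; have [c atc pc] := atlas_cover N p.
have pr := profile_near_inner It; have [oI _ Is _] := pr.
have [oU Gs GT Gpos hs] := chart_over_data fs atc oI.
set h := f \o chart_inv c in hs; pose x := chart_map c p.
have Ux : chart_over c I x by apply: chart_over_mem => //; rewrite fp.
have hx : h x = t by rewrite /h /= chart_mapK.
have tn y (Uy : chart_over c I y) := profile_transnormal fb pr atc Uy.
have hI y : chart_over c I y -> I (h y) by case.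
have bx : 0 < b (h x) by rewrite hx; exact: profile_pos.
have lapE : laplacian (metric N c) h x = half_slope b (h x).
  rewrite fa //; last by case: Ux.
  by apply/eqP; rewrite -/h hx -subr_eq0 -/(shape_defect t) phi0.
have [e [nus nu_unit eP Esum]] := level_mean_curvature oU Gs GT Gpos hs Is hI tn Ux bx lapE.
exists c, (chart_over c I), (level_function h t),
  (fun y => (Num.sqrt (b t))^-1 *: grad (metric N c) h y), e => /=.
have zeroE y : (level_function h t y = 0) <-> h y = t.
  split=> [/matrixP/(_ 0 0)|hy]; first by rewrite !mxE => /eqP; rewrite subr_eq0 => /eqP.
  by apply/matrixP => i j; rewrite !mxE hy subrr.
rewrite hx in nus nu_unit eP Esum.
split => //.
- split => //; first by split => // y [].
    exact: smooth_level_function.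
  move=> y Uy; split; last by split => [hy|/zeroE //]; apply/zeroE.
  apply: (rank_level_function oU Gpos hs tn) => //.
  by apply: profile_pos; exact: hI.
- by move=> y Uy /zeroE hy; exact: (nu_unit y Uy hy).
Qed.

(** A point of a regular level has nonzero gradient, so b t > 0 and t is not extremal. Minimality at
    that single point then determines the defect, which depends on t only. *)
Lemma shape_defect0_of_minimal t : range f t -> regular_value N f t ->
  minimal_hypersurface N (f @^-1` [set t]) -> I t /\ shape_defect t = 0.
Proof.
move=> [p _ fp] treg tmin.
have It : I t.
  have [c atc pc] := atlas_cover N p; have xc := chart_img_mem pc.
  have := treg p c fp atc pc => X0.
  have bt : 0 < b t.
    rewrite -fp -(chart_mapK pc) -[f _]/((f \o chart_inv c) _) -(fb atc xc).
    exact: (chart_posdef atc xc).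
  apply/andP; split; rewrite lt_neqAle -fp ?minP ?maxP andbT; apply/negP => /eqP E;
    move: bt; rewrite -fp profile_extremal ?ltxx //.
    by right => q; rewrite -E.
  by left => q; rewrite E.
split => //; have [c [V [F [nu [e [leq nus nuP eP Esum]]]]]] := tmin p fp.
case: leq => atc pc [oV Vimg Vx] Fs FP.
have pr := profile_near_inner It; have [oI _ Is _] := pr.
have [oU Gs GT Gpos hs] := chart_over_data fs atc oI.
set h := f \o chart_inv c in hs; set x := chart_map c p in Vx.
have Ux : chart_over c I x by apply: chart_over_mem => //; rewrite fp.
have hx : h x = t by rewrite /h /= chart_mapK.
have tn y (Uy : chart_over c I y) := profile_transnormal fb pr atc Uy.
have hI y : chart_over c I y -> I (h y) by case.
pose V' := V `&` chart_over c I.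
have oV' : open V' by exact: openI.
have V'U : V' `<=` chart_over c I by move=> y [].
have V'x : V' x by [].
have Fs' : smooth_on V' F by move=> k; apply: Ck_on_sub (Fs k) => y [].
have nus' : smooth_on V' nu by move=> k; apply: Ck_on_sub (nus k) => y [].
have FP' y : V' y -> \rank ('J F y) = 1%N /\ (h y = t <-> F y = 0).
  by move=> [Vy _]; exact: FP.
have nuP' y : V' y -> F y = 0 -> inner (metric N c) y (nu y) (nu y) = 1 /\
    forall v, v *m 'J F y = 0 -> inner (metric N c) y (nu y) v = 0.
  by move=> [Vy _]; exact: nuP.
have Fx : F x = 0 by apply/(FP x Vx).2; rewrite /= chart_mapK.
have := minimal_laplacian oU Gs GT Gpos hs Is hI tn oV' V'U Fs' nus' FP' nuP'
  (profile_pos It) V'x Fx eP Esum.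
rewrite fa //; last by case: Ux.
by rewrite -/h hx /shape_defect => ->; rewrite subrr.
Qed.

(** The condition [range f t] excludes empty levels, for which the other two hold vacuously. *)
Lemma unique_minimal_level : exists! t : R,
  [/\ range f t, regular_value N f t & minimal_hypersurface N (f @^-1` [set t])].
Proof.
have [t It t0] := shape_defect_zero; exists t; split.
  split; [exact: inner_values_range|exact: regular_value_inner|exact: minimal_of_shape_defect0].
move=> t' [ft' reg' min']; have [It' t'0] := shape_defect0_of_minimal ft' reg' min'.
have uniq s r : I s -> I r -> shape_defect s = 0 -> shape_defect r = 0 -> ~ s < r.
  move=> Is Ir; apply: (zero_crossing_unique (I := I)).
  - move=> q /andP[sq qr]; move: Is Ir => /andP[as_ _] /andP[_ rb].
    by apply/andP; split; [exact: lt_le_trans sq|exact: le_lt_trans rb].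
  - exact: shape_defect_continuous.
  - exact: shape_defect_crosses_down.
have := uniq t t' It It' t0 t'0; have := uniq t' t It' It t'0 t0.
by case: ltgtP.
Qed.

End Isoparametric.

Theorem corollary2p1 (R : realType) (n : nat) (T : topologicalType)
    (N : riemannian_manifold R n T) (f : T -> R)
    (N_connected : connected [set: T])
    (N_closed : compact [set: T])
    (N_ricci : positive_ricci N)
    (f_proper : properly_isoparametric N f) :
  exists! t : R,
    [/\ range f t, regular_value N f t &
        minimal_hypersurface N (f @^-1` [set t])].
Proof.
case: f_proper => -[[nonconst fs [b bs fb]] [a ac fa]] codim_max codim_min.
have T0 : [set: T] !=set0 by case: nonconst => p _; exists p.
have f_cont : {within [set: T], continuous f}.
  exact: continuous_subspaceT (f_continuous fs).
have [pmax _ maxP] := compact_EVT_max T0 N_closed f_cont.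
have [pmin _ minP] := compact_EVT_min T0 N_closed f_cont.
apply: (unique_minimal_level N_connected N_ricci nonconst fs bs fb ac fa codim_max codim_min
  (pmin := pmin) (pmax := pmax)).
- by move=> q; apply: minP; rewrite inE.
- by move=> q; apply: maxP; rewrite inE.
Qed.
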